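(* (a) Let $m\ge 2$ and $\mathfrak g=\mathfrak{sl}_{n+m}$. The formulas $$\bar{\Theta}^{\mathrm{cl}}(A)=\bar{\iota}(A),\quad \bar{\Theta}^{\mathrm{cl}}(y)=\bar{\iota}(y),\quad \bar{\Theta}^{\mathrm{cl}}(x)=\bar{\iota}(x),\quad \bar{\Theta}^{\mathrm{cl}}(\zeta_k)=(-1)^{m-k}\bar{\Theta}_k$$ ($A\in\mathfrak{gl}_n$, $y\in V_n$, $x\in V_n^*$, $0\le k\le m-2$) define an isomorphism $\bar{\Theta}^{\mathrm{cl}}:H_m^{\mathrm{cl}}(\mathfrak{gl}_n)\to S(\mathfrak z_{n,m})\simeq\mathbb{C}[\mathcal S_{n,m}]$ of Poisson algebras. (b) Let $m\ge1$ and $\mathfrak g=\mathfrak{sp}_{2n+2m}$. The formulas $$\bar{\Theta}^{\mathrm{cl}}(A)=\bar{\iota}(A),\quad \bar{\Theta}^{\mathrm{cl}}(y)=\bar{\iota}(y)/\sqrt{2},\quad \bar{\Theta}^{\mathrm{cl}}(\zeta_k)=\bar{\Theta}_k$$ ($A\in\mathfrak{sp}_{2n}$, $y\in V_{2n}$, $0\le k\le m-1$) define an isomorphism $\bar{\Theta}^{\mathrm{cl}}:H_m^{\mathrm{cl}}(\mathfrak{sp}_{2n})\to S(\mathfrak z_{n,m})\simeq\mathbb{C}[\mathcal S_{n,m}]$ of Poisson algebras.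
   Context: Everything is over $\mathbb{C}$ and $n\ge1$. For all matrix Lie algebras, $\mathfrak g\simeq\mathfrak g^*$ and $S(\mathfrak g)\simeq\mathbb{C}[\mathfrak g]$ are identified via the invariant form (Killing form) in the normalization $(a,b)=\mathrm{tr}(ab)$. **The Poisson algebra $H_m^{\mathrm{cl}}(\mathfrak{gl}_n)$.** $V_n$ is the basic representation of $\mathfrak{gl}_n$ with basis $y_1,\dots,y_n$, $V_n^*$ its dual with dual basis $x_1,\dots,x_n$. Define $\alpha_j(y,x)\in\mathbb{C}[\mathfrak{gl}_n]\simeq S(\mathfrak{gl}_n)$ by $(x,(1-\tau A)^{-1}y)\det(1-\tau A)^{-1}=\sum_{j\ge0}\alpha_j(y,x)(A)\tau^j$. As an algebra $H_m^{\mathrm{cl}}(\mathfrak{gl}_n)=S(\mathfrak{gl}_n\oplus V_n\oplus V_n^* )[\zeta_0,\dots,\zeta_{m-2}]$; the $\zeta_j$ are Poisson central and $\{A,B\}=[A,B]$, $\{A,y\}=A(y)$, $\{A,x\}=A(x)$, $\{y,y'\}=\{x,x'\}=0$, $\{y,x\}=\alpha_m(y,x)+\sum_{j=0}^{m-2}\zeta_j\alpha_j(y,x)$. **The Poisson algebra $H_m^{\mathrm{cl}}(\mathfrak{sp}_{2n})$.** $V_{2n}$ is the standard representation of $\mathfrak{sp}_{2n}$ with basis $y_1,\dots,y_{2n}$ and symplectic form $\omega(y_i,y_j)=(-1)^{j}\delta_{i+j,2n+1}$; $\mathfrak{sp}_{2n}$ is realized by this form. Define $\beta_{2j}(x,y)\in\mathbb{C}[\mathfrak{sp}_{2n}]\simeq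 S(\mathfrak{sp}_{2n})$ by $\omega(x,(1-\tau^2A^2)^{-1}y)\det(1-\tau A)^{-1}=\sum_{j\ge0}\beta_{2j}(x,y)(A)\tau^{2j}$. As an algebra $H_m^{\mathrm{cl}}(\mathfrak{sp}_{2n})=S(\mathfrak{sp}_{2n}\oplus V_{2n})[\zeta_0,\dots,\zeta_{m-1}]$; the $\zeta_j$ are Poisson central and $\{A,B\}=[A,B]$, $\{A,y\}=A(y)$, $\{x,y\}=\beta_{2m}(x,y)+\sum_{j=0}^{m-1}\zeta_j\beta_{2j}(x,y)$. **Slices.** For a simple $\mathfrak g$, an $\mathfrak{sl}_2$-triple $(e,h,f)$ and $\chi=(e,\cdot)$, the Slodowy slice is $\mathcal S=e+\ker\mathrm{ad} f\subset\mathfrak g\simeq\mathfrak g^*$, and $\mathfrak z_\chi$ is the centralizer of $e$. One identifies $\mathbb{C}[\mathcal S]\simeq S(\mathfrak z_\chi)$ by sending $\xi\in\mathfrak z_\chi$ to the function $X\mapsto(\xi,X)$ on $\mathcal S$. The Poisson structure on $\mathbb{C}[\mathcal S]$ is inherited from $\mathbb{C}[\mathfrak g^*]=S(\mathfrak g)$: with $\mathfrak g(i)=\{\xi:[h,\xi]=i\xi\}$, $l\subset\mathfrak g(-1)$ Lagrangian for $\langle\chi,[\cdot,\cdot]\rangle$, $\mathfrak m=\bigoplus_{i\le-2}\mathfrak g(i)\oplus l$, $\mathfrak m'=\{\xi-\langle\chi,\xi\rangle:\xi\in\mathfrak m\}$, restriction of functions to $\mathcal S$ gives $(S(\mathfrak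 g)/S(\mathfrak g)\mathfrak m')^{\mathrm{ad}\,\mathfrak m}\simeq\mathbb{C}[\mathcal S]$, and the left side carries the bracket induced from $S(\mathfrak g)$. The slice and centralizer for the element $e_m$ below are denoted $\mathcal S_{n,m}$ and $\mathfrak z_{n,m}$. **Case $\mathfrak g=\mathfrak{sl}_{n+m}$.** $e_m=\sum_{j=1}^{m-1}E_{n+j,n+j+1}$, $h=\sum_{j=1}^m(m+1-2j)E_{n+j,n+j}$, $f=\sum_{j=1}^{m-1}j(m-j)E_{n+j+1,n+j}$. The vector space identification $\bar\iota:\mathfrak{gl}_n\oplus V_n\oplus V_n^*\oplus\mathbb{C}^{m-1}\to\mathfrak z_{n,m}$ is: $\mathfrak{sl}_n$ goes to the upper left block, $I_n\mapsto\mathrm{diag}(\frac{m}{n+m},\dots,\frac{m}{n+m},\frac{-n}{n+m},\dots,\frac{-n}{n+m})$ ($n$ entries followed by $m$ entries), $y_i\mapsto E_{i,n+m}$, $x_i\mapsto E_{n+1,i}$, and $\mathbb{C}^{m-1}$ is spanned by the elements $\xi_{m-2-j}=E_{n+1,n+j+2}+\dots+E_{n+m-j-1,n+m}$, $0\le j\le m-2$. Let $\widetilde F_j\in\mathbb{C}[\mathfrak{sl}_{n+m}]$ be defined by $\det(1+zX)=1+\sum_{j\geq 2}\widetilde F_j(X)z^j$, and set $\bar\Theta_k=\widetilde F_{m-k}|_{\mathcal S_{n,m}}$ for $0\le k\le m-2$. **Case $\mathfrak g=\mathfrak{sp}_{2n+2m}$.** With $N=n+m$, $\mathfrak{sp}_{2N}$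 is realized by the form with matrix $(-1)^j\delta_{i+j,2N+1}$, and $e_m=\sum_{j=1}^{2m-1}E_{n+j,n+j+1}$, $h=\sum_{j=1}^{2m}(2m+1-2j)E_{n+j,n+j}$, $f=\sum_{j=1}^{2m-1}j(2m-j)E_{n+j+1,n+j}$. The identification $\bar\iota:\mathfrak{sp}_{2n}\oplus V_{2n}\oplus\mathbb{C}^m\to\mathfrak z_{n,m}$ is: $\mathfrak{sp}_{2n}$ is embedded via the four $n\times n$ corner blocks; for $1\le i\le n$, $y_i\mapsto E_{i,n+2m}+(-1)^{n+i+1}E_{n+1,2n+2m+1-i}$ and $y_{n+i}\mapsto E_{n+2m+i,n+2m}+(-1)^{i+1}E_{n+1,n+1-i}$; and $\mathbb{C}^m$ is spanned by $\xi_{m-k}=E_{n+1,n+2k}+\dots+E_{n+2m-2k+1,n+2m}$, $1\le k\le m$. Let $\widetilde F_j\in\mathbb{C}[\mathfrak{sp}_{2N}]$ be defined by $\det(1+zX)=1+\sum_{j\ge1}\widetilde F_j(X)z^{2j}$, and set $\bar\Theta_k=\widetilde F_{m-k}|_{\mathcal S_{n,m}}$ for $0\le k\le m-1$.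
   Formalization: In (b) the image of y is ῑ(y)/√(2(−1)^{n+1}) instead of ῑ(y)/√2: unchanged for odd n; for even n (e.g. n=2, m=1) the stated formula gives {x,y} the opposite sign and is not Poisson, so it is corrected to ῑ(y)/√(−2). *)

(* Defs.v *)
From HB Require Import structures.
From mathcomp Require Import all_boot all_order all_algebra.
From mathcomp Require Import zify ring mpoly.
From mathcomp Require Export complex reals.

Set Implicit Arguments.
Unset Strict Implicit.
Unset Printing Implicit Defensive.

Import Order.TTheory GRing.Theory Num.Theory.
Local Open Scope ring_scope.

(* The symmetric algebra S(V): polynomials in the vectors of the basis
   [vbasis {:V}] of V, with V -> S(V) given by [symg].                      *)

Definition Sym (K : fieldType) (V : vectType K) := {mpoly K[\dim {:V}]}.

Section SymmetricAlgebra.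
Variables (K : fieldType) (V : vectType K).

Definition symb (i : 'I_(\dim {:V})) : V := (vbasis {:V})`_i.

Definition symg (v : V) : Sym V :=
  \sum_(i < \dim {:V}) coord (vbasis {:V}) i v *: 'X_i.

(* The polynomial function F on V^*, at the point phi. *)
Definition symev (phi : V -> K) (F : Sym V) : K := F.@[fun i => phi (symb i)].

Lemma symev_symg (phi : V -> K) v : scalar phi -> symev phi (symg v) = phi v.
Proof.
move=> lin; have add x y : phi (x + y) = phi x + phi y.
  by rewrite -[x]scale1r lin mul1r scale1r.
have z0 : phi 0 = 0 by apply: (addIr (phi 0)); rewrite -add !add0r.
have sc a x : phi (a *: x) = a * phi x by rewrite -[a *: x]addr0 lin z0 addr0.
rewrite /symev /symg raddf_sum /= [in RHS](coord_vbasis (memvf v)).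
rewrite (big_morph phi add z0).
by apply: eq_bigr => i _; rewrite mevalZ mevalXU sc.
Qed.

(* The biderivation of S(V) extending the bilinear map c on V. *)
Definition symbr (c : V -> V -> Sym V) (F G : Sym V) : Sym V :=
  \sum_(i < \dim {:V}) \sum_(j < \dim {:V})
    c (symb i) (symb j) * F^`M(i) * G^`M(j).

End SymmetricAlgebra.

(* The algebra morphism S(V) -> S(W) extending a linear map V -> W. *)
Definition symmap (K : fieldType) (V W : vectType K) (f : V -> W)
    (F : Sym V) : Sym W :=
  F \mPo [tuple symg (f (symb i)) | i < \dim {:V}].

Lemma symmap_symg (K : fieldType) (V W : vectType K) (f : {linear V -> W}) v :
  symmap f (symg v) = symg (f v).
Proof.
rewrite /symmap /symg [in RHS](coord_vbasis (memvf v)) raddf_sum /=.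
rewrite linear_sum.
under [RHS]eq_bigr => k _.
  rewrite linear_sum scaler_suml.
  under eq_bigr => i _ do rewrite linearZ /= linearZ /= -scalerA.
  over.
rewrite exchange_big /=; apply: eq_bigr => i _.
by rewrite comp_mpolyZ comp_mpolyXU -[in LHS]tnth_nth tnth_mktuple -scaler_sumr.
Qed.

(* A power series in tau is the sequence of its coefficients. *)

Definition psmul (R : comNzRingType) (a b : nat -> R) (k : nat) : R :=
  \sum_(i < k.+1) a i * b (k - i)%N.

(* 1 / D(tau) for a polynomial D with D(0) = 1: modulo tau^(k+1) it is the sum
   of the (1 - D)^i, i <= k.                                                *)
Definition psinv (R : comNzRingType) (D : {poly R}) (k : nat) : R :=
  (\sum_(i < k.+1) (1 - D) ^+ i)`_k.

Lemma coef_expr_lt (R : comNzRingType) (u : {poly R}) i k :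
  u`_0 = 0 -> (k < i)%N -> (u ^+ i)`_k = 0.
Proof.
move=> u0; elim: i k => // i IHi k ltki; rewrite exprS coefM big_ord_recl u0.
rewrite mul0r add0r big1 // => j _; rewrite IHi ?mulr0 //=.
rewrite /bump leq0n add1n; case: k ltki j => [_ [] //|k lt_ki j].
by rewrite subSS; apply: leq_ltn_trans (leq_subr _ _) _; rewrite -ltnS.
Qed.

Lemma psinvP (R : comNzRingType) (D : {poly R}) k :
  D`_0 = 1 -> psmul (fun i => D`_i) (psinv D) k = (k == 0)%:R.
Proof.
move=> D0; have u0 : (1 - D)`_0 = 0 by rewrite coefB coef1 D0 subrr.
have psinvE j : (j <= k)%N -> psinv D j = (\sum_(i < k.+1) (1 - D) ^+ i)`_j.
  move=> lejk; rewrite /psinv !coef_sum.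
  rewrite (big_ord_widen k.+1 (fun i => ((1 - D) ^+ i)`_j)) //.
  rewrite [RHS](bigID (fun i : 'I_k.+1 => (i < j.+1)%N)) /=.
  rewrite [X in _ = _ + X]big1 ?addr0 // => i; rewrite -leqNgt => ltji.
  exact: coef_expr_lt.
transitivity ((D * \sum_(i < k.+1) (1 - D) ^+ i)`_k).
  by rewrite coefM; apply: eq_bigr => i _; rewrite psinvE // leq_subr.
have -> : D * \sum_(i < k.+1) (1 - D) ^+ i = 1 - (1 - D) ^+ k.+1.
  have := subrXX 1 (1 - D) k.+1; rewrite expr1n subKr => ->; congr (_ * _).
  by apply: eq_bigr => i _; rewrite expr1n mul1r.
by rewrite coefB coef_expr_lt // coef1 subr0.
Qed.

(* det (1 - tau A) and det (1 + z A), with 'X as tau, resp. z. *)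
Definition det1B (R : comNzRingType) k (A : 'M[R]_k) : {poly R} :=
  \det (1%:M - 'X *: map_mx polyC A).
Definition det1D (R : comNzRingType) k (A : 'M[R]_k) : {poly R} :=
  \det (1%:M + 'X *: map_mx polyC A).

Lemma det1B_0 (R : comNzRingType) k (A : 'M[R]_k) : (det1B A)`_0 = 1.
Proof.
rewrite -horner_coef0 /det1B -[_.[0]]/(horner_eval 0 _) -det_map_mx.
rewrite (_ : map_mx _ _ = 1%:M) ?det1 //; apply/matrixP => i j.
rewrite !mxE rmorphB rmorphM /= rmorph_nat /horner_eval hornerX mul0r.
by rewrite subr0.
Qed.

(* Elementary matrices of size k, rows and columns being numbered from 1. *)
Definition Emx (K : fieldType) (k i j : nat) : 'M[K]_k :=
  \matrix_(a < k, b < k) ((a.+1 == i) && (b.+1 == j))%:R.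
Arguments Emx {K k} i j.

Definition commx (K : fieldType) k (A B : 'M[K]_k) : 'M[K]_k :=
  A *m B - B *m A.

Fact commx_is_linear (K : fieldType) k (A : 'M[K]_k) : linear (commx A).
Proof.
move=> a u v; rewrite /commx mulmxDr mulmxDl -!scalemxAr -!scalemxAl scalerBr.
by rewrite addrACA opprD.
Qed.
HB.instance Definition _ (K : fieldType) k (A : 'M[K]_k) :=
  GRing.isLinear.Build K 'M[K]_k 'M[K]_k _ (commx A) (commx_is_linear A).

(* The trace form. *)
Definition trform (K : fieldType) k (A B : 'M[K]_k) : K := \tr (A *m B).

Fact trform_is_scalar (K : fieldType) k (A : 'M[K]_k) : scalar (fun B => trform B A).
Proof. by move=> a u v; rewrite /trform mulmxDl -scalemxAl linearD linearZ. Qed.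

Lemma trform_delta (K : fieldType) k (A : 'M[K]_k) i j :
  trform (delta_mx j i) A = A i j.
Proof.
rewrite /trform /mxtrace (bigD1 j) //= big1 ?addr0 => [|a ne_aj]; rewrite mxE.
  rewrite (bigD1 i) //= big1 ?addr0 => [|b ne_bi]; rewrite !mxE !eqxx ?mul1r //.
  by rewrite (negbTE ne_bi) mul0r.
by rewrite big1 // => b _; rewrite mxE (negbTE ne_aj) mul0r.
Qed.

(* A matrix Lie algebra g is a subspace U of 'M_k closed under commx; its
   vector space is [subvs_of U].  S(g) = C[g] through the trace form.       *)

Section MatrixLieAlgebra.
Variables (K : fieldType) (k : nat) (U : {vspace 'M[K]_k}).

Definition lie (a b : subvs_of U) : subvs_of U :=
  vsproj U (commx (vsval a) (vsval b)).

Definition liebr : Sym (subvs_of U) -> Sym (subvs_of U) -> Sym (subvs_of U) :=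
  symbr (fun a b => symg (lie a b)).

(* The value at X of an element of S(U), for a subspace U of 'M_k. *)
Definition fval (F : Sym (subvs_of U)) (X : 'M[K]_k) : K :=
  symev (fun a => trform (vsval a) X) F.

End MatrixLieAlgebra.

Section Slice.
Variables (K : fieldType) (k : nat) (U : {vspace 'M[K]_k}) (e h f : 'M[K]_k).

Definition slice (X : 'M[K]_k) : Prop :=
  X - e \in (U :&: lker (linfun (commx f)))%VS.

Definition centr : {vspace 'M[K]_k} := (U :&: lker (linfun (commx e)))%VS.

Definition grade (i : K) : {vspace 'M[K]_k} :=
  (U :&: lker (linfun (commx h) - i *: \1%VF))%VS.

Definition lagrangian (l : {vspace 'M[K]_k}) : Prop :=
  (l <= grade (- 1))%VS /\
  forall u, u \in grade (- 1) ->
    (u \in l <-> forall v, v \in l -> trform e (commx u v) = 0).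

(* The eigenvalues of ad h on 'M_k are differences of eigenvalues of the
   diagonal matrix h; in both families below they are > - 2 k.              *)
Definition nilm (l : {vspace 'M[K]_k}) : {vspace 'M[K]_k} :=
  ((\sum_(2 <= i < k.*2) grade (- i%:R)) + l)%VS.

(* The ideal S(g) m' of S(g). *)
Definition in_ideal (l : {vspace 'M[K]_k}) (F : Sym (subvs_of U)) : Prop :=
  exists s : seq (Sym (subvs_of U) * subvs_of U),
    (forall p, p \in s -> vsval p.2 \in nilm l) /\
    F = \sum_(p <- s) p.1 * (symg p.2 - (trform e (vsval p.2))%:MP).

(* F represents an element of (S(g) / S(g) m')^(ad m). *)
Definition ad_invariant (l : {vspace 'M[K]_k}) (F : Sym (subvs_of U)) : Prop :=
  forall xi : subvs_of U, vsval xi \in nilm l ->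
    in_ideal l (liebr (symg xi) F).

(* F in S(g) and p in S(z) = C[S] define the same function on the slice S. *)
Definition restricts (F : Sym (subvs_of U)) (p : Sym (subvs_of centr)) : Prop :=
  forall X, slice X -> fval F X = fval p X.

(* The graph of the Poisson bracket of C[S] = S(z): r = {p, q}. *)
Definition slice_bracket (l : {vspace 'M[K]_k})
    (p q r : Sym (subvs_of centr)) : Prop :=
  exists F G : Sym (subvs_of U),
    [/\ ad_invariant l F, ad_invariant l G, restricts F p, restricts G q
      & restricts (liebr F G) r].

End Slice.
Arguments restricts {K k} U e f F p.
Arguments slice_bracket {K k} U e h f l p q r.

Definition slv (K : fieldType) k : {vspace 'M[K]_k} :=
  lker (linfun (mxtrace : 'M[K]_k -> K^o)).

Lemma memv_sl (K : fieldType) k (A : 'M[K]_k) : (A \in slv K k) = (\tr A == 0).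
Proof. by rewrite memv_ker lfunE. Qed.

Lemma commx_sl (K : fieldType) k (A B : 'M[K]_k) : commx A B \in slv K k.
Proof. by rewrite memv_sl /commx linearB /= mxtrace_mulC subrr. Qed.

(* The matrix of the symplectic form of K^k, k even: with indices numbered from
   1, the entry (i, j) is (-1)^j if i + j = k + 1, and 0 otherwise.          *)
Definition Jmx (K : nzRingType) k : 'M[K]_k :=
  \matrix_(i, j) (if (i.+1 + j.+1 == k.+1)%N then (-1) ^+ j.+1 else 0).

Lemma Jmx_sqr (K : nzRingType) k : ~~ odd k -> Jmx K k *m Jmx K k = - 1%:M.
Proof.
move=> even_k; apply/matrixP => i j; have lt_ik := ltn_ord i.
rewrite !mxE (bigD1 (rev_ord i)) //= big1 ?addr0 => [|a ne_a]; rewrite !mxE.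
  rewrite /= ifT; last by lia.
  case: (eqVneq i j) => [<-|ne_ij].
    rewrite ifT; last by lia.
    rewrite -exprD -signr_odd (_ : odd _ = true) //; lia.
  by rewrite ifF ?mulr0 ?oppr0 //; move: ne_ij; rewrite -val_eqE /=; lia.
rewrite ifF ?mul0r //; move: ne_a; rewrite -val_eqE /=; lia.
Qed.

Definition spdef (K : fieldType) k (X : 'M[K]_k) : 'M[K]_k :=
  X^T *m Jmx K k + Jmx K k *m X.

Fact spdef_is_linear (K : fieldType) k : linear (@spdef K k).
Proof.
move=> a u v; rewrite /spdef linearD linearZ /= mulmxDl mulmxDr.
by rewrite -scalemxAl -scalemxAr scalerDr addrACA.
Qed.
HB.instance Definition _ (K : fieldType) k :=
  GRing.isLinear.Build K 'M[K]_k 'M[K]_k _ (@spdef K k) (@spdef_is_linear K k).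

Definition spv (K : fieldType) k : {vspace 'M[K]_k} := lker (linfun (@spdef K k)).

Lemma memv_sp (K : fieldType) k (X : 'M[K]_k) :
  (X \in spv K k) = (X^T *m Jmx K k + Jmx K k *m X == 0).
Proof. by rewrite memv_ker lfunE. Qed.

Lemma commx_sp (K : fieldType) k (A B : 'M[K]_k) :
  A \in spv K k -> B \in spv K k -> commx A B \in spv K k.
Proof.
rewrite !memv_sp !addr_eq0 => /eqP trA /eqP trB.
rewrite /commx linearB /= !trmx_mul mulmxBl mulmxBr -!mulmxA trA trB.
by rewrite !mulmxN !mulmxA trA trB !mulNmx !opprK opprB.
Qed.

Lemma symbr_symg (K : fieldType) (V : vectType K) (c : V -> V -> Sym V) u v :
  (forall w, linear (c w)) -> (forall w, linear (c^~ w)) ->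
  symbr c (symg u) (symg v) = c u v.
Proof.
move=> linr linl.
have dX w i : (symg w)^`M(i) = (coord (vbasis {:V}) i w)%:MP :> Sym V.
  rewrite /symg linear_sum (bigD1 i) //= big1 ?addr0 => [|j ne_ji].
    rewrite mderivZ mderivX mnm1E eqxx scale1r (_ : (_ - _)%MM = 0%MM).
      by rewrite mpolyX0 -mul_mpolyC mulr1.
    by apply/mnmP => l; rewrite mnmBE subnn mnm0E.
  by rewrite mderivZ mderivX mnm1E (negbTE ne_ji) scale0r scaler0.
have cDr w (F : 'I_(\dim {:V}) -> K) :
    c w (\sum_i F i *: symb i) = \sum_i F i *: c w (symb i).
  have add x y : c w (x + y) = c w x + c w y by rewrite -[x]scale1r linr !scale1r.
  have z0 : c w 0 = 0 by apply: (addIr (c w 0)); rewrite -add !add0r.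
  have sc a x : c w (a *: x) = a *: c w x by rewrite -[a *: x]addr0 linr z0 addr0.
  by rewrite (big_morph (c w) add z0); apply: eq_bigr => i _.
have cDl w (F : 'I_(\dim {:V}) -> K) :
    c (\sum_i F i *: symb i) w = \sum_i F i *: c (symb i) w.
  have add x y : c (x + y) w = c x w + c y w.
    by have := linl w 1 x y; rewrite !scale1r.
  have z0 : c 0 w = 0 by apply: (addIr (c 0 w)); rewrite -add !add0r.
  have sc a x : c (a *: x) w = a *: c x w.
    by have := linl w a x 0; rewrite z0 !addr0.
  rewrite (big_morph (c^~ w) add z0); apply: eq_bigr => i _; exact: sc.
rewrite [in RHS](coord_vbasis (memvf u)) [in RHS](coord_vbasis (memvf v)) cDl.
apply: eq_bigr => i _; rewrite cDr scaler_sumr; apply: eq_bigr => j _.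
by rewrite !dX -mulrA -mpolyCM mulrC mul_mpolyC -scalerA.
Qed.

(* The coefficient of tau^j in (x, (1 - tau A)^-1 y) det (1 - tau A)^-1, where
   (1 - tau A)^-1 is the series of the A ^+ i tau^i.                         *)
Definition alpha_at (R : comNzRingType) n (A : 'M[R]_n) (y : 'cV[R]_n)
    (x : 'rV[R]_n) : nat -> R :=
  psmul (fun i => (x *m A ^+ i *m y) 0 0) (psinv (det1B A)).

(* The coefficient of tau^j in omega(u, (1 - tau^2 A^2)^-1 v) det (1 - tau A)^-1. *)
Definition beta_at (R : comNzRingType) n (A : 'M[R]_n) (u v : 'cV[R]_n) :
    nat -> R :=
  psmul (fun i => if odd i then 0 else (u^T *m Jmx R n *m A ^+ i *m v) 0 0)
        (psinv (det1B A)).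

Section MapCoefficients.
Variables (R S : comNzRingType) (phi : {rmorphism R -> S}) (n : nat).
Local Notation mp := (map_mx phi).

Lemma psmul_map (a b : nat -> R) (a' b' : nat -> S) k :
  (forall i, phi (a i) = a' i) -> (forall i, phi (b i) = b' i) ->
  phi (psmul a b k) = psmul a' b' k.
Proof.
move=> ha hb; rewrite /psmul rmorph_sum /=.
by apply: eq_bigr => i _; rewrite rmorphM /= ha hb.
Qed.

Lemma psinv_det1B_map (A : 'M[R]_n) k :
  phi (psinv (det1B A) k) = psinv (det1B (mp A)) k.
Proof.
rewrite /psinv -coef_map rmorph_sum /=; congr (nth _ (polyseq _) k).
apply: eq_bigr => i _.
rewrite rmorphXn rmorphB rmorph1 /= /det1B -det_map_mx; congr ((1 - \det _) ^+ _).
apply/matrixP => a b; rewrite !mxE rmorphB rmorphM /= rmorph_nat map_polyX.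
by rewrite map_polyC.
Qed.

Lemma expmx_map (A : 'M[R]_n) i : mp (A ^+ i) = (mp A) ^+ i.
Proof. by elim: i => [|i IHi]; rewrite ?map_mx1 // !exprS map_mxM IHi. Qed.

Lemma alpha_at_map (A : 'M[R]_n) y x j :
  phi (alpha_at A y x j) = alpha_at (mp A) (mp y) (mp x) j.
Proof.
apply: psmul_map => i; last exact: psinv_det1B_map.
by rewrite -expmx_map -!map_mxM [RHS]mxE.
Qed.

Lemma Jmx_map : mp (Jmx R n) = Jmx S n.
Proof.
apply/matrixP => i j; rewrite !mxE.
by case: ifP => _; rewrite ?rmorph0 // rmorphXn rmorphN1.
Qed.

Lemma beta_at_map (A : 'M[R]_n) u v j :
  phi (beta_at A u v j) = beta_at (mp A) (mp u) (mp v) j.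
Proof.
apply: psmul_map => i; last exact: psinv_det1B_map.
case: ifP => _; first exact: rmorph0.
by rewrite -expmx_map -Jmx_map map_trmx -!map_mxM [RHS]mxE.
Qed.

End MapCoefficients.

Section CherednikGl.
Variables (K : fieldType) (n m : nat).

(* The entry functions A |-> A i j on gl_n, as elements of S(gl_n). *)
Definition gl_mx : 'M[Sym 'M[K]_n]_n := \matrix_(i, j) symg (delta_mx j i).

Definition alpha (y : 'cV[K]_n) (x : 'rV[K]_n) (j : nat) : Sym 'M[K]_n :=
  alpha_at gl_mx (map_mx (@mpolyC _ _) y) (map_mx (@mpolyC _ _) x) j.

Lemma alphaE (A : 'M[K]_n) y x j :
  symev (fun B => trform B A) (alpha y x j) = alpha_at A y x j.
Proof.
rewrite /symev alpha_at_map; congr (alpha_at _ _ _ j); apply/matrixP => a b.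
- rewrite !mxE -trform_delta; apply: (@symev_symg K _ (fun B => trform B A)).
  exact: trform_is_scalar.
- by rewrite !mxE /= mevalC.
- by rewrite !mxE /= mevalC.
Qed.

Definition gl_space : vectType K :=
  ('M[K]_n * 'cV[K]_n * 'rV[K]_n * 'rV[K]_m.-1)%type.

Definition Hgl := Sym gl_space.

Definition gl_A (A : 'M[K]_n) : gl_space := (A, 0, 0, 0).
Definition gl_y (y : 'cV[K]_n) : gl_space := (0, y, 0, 0).
Definition gl_x (x : 'rV[K]_n) : gl_space := (0, 0, x, 0).
Definition gl_zeta (j : 'I_m.-1) : gl_space := (0, 0, 0, delta_mx 0 j).

Definition gl_yx (y : 'cV[K]_n) (x : 'rV[K]_n) : Hgl :=
  symmap gl_A (alpha y x m) +
  \sum_(j < m.-1) symg (gl_zeta j) * symmap gl_A (alpha y x j).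

(* A acts on the dual of V_n by x |-> - x A. *)
Definition gl_bracket (u v : gl_space) : Hgl :=
  let: (A, y, x, _) := u in let: (A', y', x', _) := v in
  symg ((commx A A', A *m y' - A' *m y, x *m A' - x' *m A, 0) : gl_space)
  + gl_yx y x' - gl_yx y' x.

Definition Hgl_br : Hgl -> Hgl -> Hgl := symbr gl_bracket.

End CherednikGl.

Section CherednikSp.
Variables (K : fieldType) (n m : nat).
Local Notation sp := (spv K n.*2).

(* The projection of gl_2n onto sp_2n that is orthogonal for the trace form. *)
Definition sp_proj (M : 'M[K]_(n.*2)) : subvs_of sp :=
  vsproj sp (2^-1 *: (M + Jmx K n.*2 *m M^T *m Jmx K n.*2)).

(* The entry functions A |-> A i j on sp_2n, as elements of S(sp_2n). *)
Definition sp_mx : 'M[Sym (subvs_of sp)]_(n.*2) :=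
  \matrix_(i, j) symg (sp_proj (delta_mx j i)).

Definition beta (u v : 'cV[K]_(n.*2)) (j : nat) : Sym (subvs_of sp) :=
  beta_at sp_mx (map_mx (@mpolyC _ _) u) (map_mx (@mpolyC _ _) v) j.

Lemma sp_projE (M : 'M[K]_(n.*2)) (A : subvs_of sp) : 2 != 0 :> K ->
  trform (vsval (sp_proj M)) (vsval A) = trform M (vsval A).
Proof.
move=> nz2; have J2 := @Jmx_sqr K n.*2; rewrite odd_double in J2.
have {}J2 := J2 isT; set J := Jmx K _ in J2 *.
have /eqP defA : (vsval A)^T *m J + J *m vsval A == 0 by rewrite -memv_sp subvsP.
have {}defA : J *m (vsval A) *m J = (vsval A)^T.
  by rewrite -(addrK ((vsval A)^T *m J) (J *m vsval A)) [J *m _ + _]addrC defA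
     sub0r mulNmx -mulmxA J2 mulmxN mulmx1 opprK.
have trJ : \tr (J *m M^T *m J *m vsval A) = \tr (M *m vsval A).
  rewrite -!mulmxA mxtrace_mulC -!mulmxA [J *m (_ *m J)]mulmxA defA.
  by rewrite -trmx_mul mxtrace_tr mxtrace_mulC.
rewrite /sp_proj vsprojK.
  rewrite /trform -scalemxAl mxtraceZ mulmxDl mxtraceD trJ.
  by rewrite -mulr2n -[X in 2^-1 * X]mulr_natl mulrA mulVf ?mul1r.
rewrite memv_sp linearZ linearD /= -scalemxAl -scalemxAr -scalerDr.
rewrite mulmxDl mulmxDr !trmx_mul trmxK -/J !mulmxA J2.
have -> : J^T = - J.
  apply/matrixP => i j; rewrite !mxE; case: ifP => [eq_ij|ne_ij].
    rewrite ifT; last by lia.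
    rewrite -[RHS]mulN1r -exprS -signr_odd -[RHS]signr_odd; congr (_ ^+ _).
    lia.
  by rewrite ifF ?oppr0 //; lia.
rewrite !(mulNmx, mulmxN) opprK mul1mx -[_ *m J *m J]mulmxA J2 mulmxN mulmx1.
by rewrite -[X in _ + X]opprB subrr scaler0.
Qed.

Lemma betaE (A : subvs_of sp) u v j : 2 != 0 :> K ->
  fval (beta u v j) (vsval A) = beta_at (vsval A) u v j.
Proof.
move=> nz2; rewrite /fval /symev beta_at_map.
congr (beta_at _ _ _ j); apply/matrixP => a b.
- rewrite !mxE -[RHS]trform_delta -sp_projE //.
  apply: (@symev_symg K _ (fun B => trform (vsval B) (vsval A))) => c B C.
  exact: trform_is_scalar.
- by rewrite !mxE /= mevalC.
- by rewrite !mxE /= mevalC.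
Qed.

Definition sp_space : vectType K :=
  (subvs_of sp * 'cV[K]_(n.*2) * 'rV[K]_m)%type.

Definition Hsp := Sym sp_space.

Definition sp_A (A : subvs_of sp) : sp_space := (A, 0, 0).
Definition sp_y (y : 'cV[K]_(n.*2)) : sp_space := (0, y, 0).
Definition sp_zeta (j : 'I_m) : sp_space := (0, 0, delta_mx 0 j).

Definition sp_yy (x y : 'cV[K]_(n.*2)) : Hsp :=
  symmap sp_A (beta x y m.*2) +
  \sum_(j < m) symg (sp_zeta j) * symmap sp_A (beta x y j.*2).

Definition sp_bracket (u v : sp_space) : Hsp :=
  let: (A, y, _) := u in let: (A', y', _) := v in
  symg ((lie A A', vsval A *m y' - vsval A' *m y, 0) : sp_space) + sp_yy y y'.

Definition Hsp_br : Hsp -> Hsp -> Hsp := symbr sp_bracket.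

End CherednikSp.

Section Emx.
Variables (K : fieldType) (k : nat).
Implicit Types i j a b : nat.

Lemma mxtrace_Emx i : (0 < i <= k)%N -> \tr (Emx i i : 'M[K]_k) = 1.
Proof.
case: i => // i lt_ik; rewrite /mxtrace (bigD1 (Ordinal lt_ik)) //= mxE eqxx.
rewrite big1 ?addr0 // => a ne_a; rewrite mxE eqSS.
by rewrite [_ == _ :> nat](negbTE ne_a).
Qed.

Lemma mxtrace_Emx0 i j : i != j -> \tr (Emx i j : 'M[K]_k) = 0.
Proof.
move=> ne_ij; rewrite /mxtrace big1 // => a _; rewrite mxE.
by case: eqP => // ->; rewrite (negbTE ne_ij).
Qed.

Lemma mulEmx0 i j a b : j != a -> (Emx i j *m Emx a b : 'M[K]_k) = 0.
Proof.
move=> ne_ja; apply/matrixP => x y; rewrite !mxE big1 // => z _; rewrite !mxE.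
by case: (eqVneq z.+1 j) => [->|]; rewrite ?(negbTE ne_ja) ?andbF ?mulr0 ?mul0r.
Qed.

Lemma mulEmx i j b :
  (0 < j <= k)%N -> (Emx i j *m Emx j b : 'M[K]_k) = Emx i b.
Proof.
case: j => // j lt_jk; apply/matrixP => x y; rewrite !mxE.
rewrite (bigD1 (Ordinal lt_jk)) //= big1 ?addr0 => [|z ne_z]; rewrite !mxE !eqSS.
  by rewrite !eqxx andbT -natrM mulnb.
by rewrite [z == j :> nat](negbTE ne_z) andbF mul0r.
Qed.

Lemma comm_shift0 n r i j :
  (forall l, (1 <= l < r)%N -> (n + l.+1 != i)%N && (n + l != j)%N) ->
  commx (\sum_(1 <= l < r) Emx (n + l) (n + l.+1)) (Emx i j : 'M[K]_k) = 0.
Proof.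
move=> sep; rewrite /commx mulmx_suml mulmx_sumr !big_nat !big1 ?subr0 // => l.
  by move=> /sep/andP[_ ?]; rewrite mulEmx0 // eq_sym.
by move=> /sep/andP[? _]; rewrite mulEmx0.
Qed.

End Emx.

Section SliceGl.
Variables (K : fieldType) (n m : nat).
Local Notation M := 'M[K]_(n + m).

Definition gl_e : M := \sum_(1 <= j < m) Emx (n + j) (n + j.+1).
Definition gl_h : M :=
  \sum_(1 <= j < m.+1) ((m.+1)%:R - (2 * j)%:R) *: Emx (n + j) (n + j).
Definition gl_f : M :=
  \sum_(1 <= j < m) (j * (m - j))%:R *: Emx (n + j.+1) (n + j).

Definition gl_iA (A : 'M[K]_n) : M :=
  let a := \tr A / n%:R in
  \sum_(i < n) \sum_(j < n) (A - a%:M) i j *: Emx i.+1 j.+1 +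
  a *: (\sum_(1 <= i < n.+1) (m%:R / (n + m)%:R) *: Emx i i +
        \sum_(1 <= j < m.+1) (- n%:R / (n + m)%:R) *: Emx (n + j) (n + j)).
Definition gl_iy (y : 'cV[K]_n) : M := \sum_(i < n) y i 0 *: Emx i.+1 (n + m).
Definition gl_ix (x : 'rV[K]_n) : M := \sum_(i < n) x 0 i *: Emx n.+1 i.+1.

Definition gl_z : {vspace M} := centr (slv K (n + m)) gl_e.

Lemma gl_e_sl : gl_e \in slv K (n + m).
Proof.
rewrite memv_suml // => j _; rewrite memv_sl mxtrace_Emx0 //; lia.
Qed.

Lemma gl_iA_z A : n%:R != 0 :> K -> gl_iA A \in gl_z.
Proof.
move=> nz_n; rewrite memv_cap memv_sl memv_ker lfunE; apply/andP; split.
  rewrite /gl_iA linearD linearZ linearD /= !linear_sum /=.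
  rewrite (eq_bigr (fun i => (A - (\tr A / n%:R)%:M) i i)) => [|i _]; last first.
    rewrite linear_sum (bigD1 i) //= big1 ?addr0 => [|j ne_ji].
      by rewrite mxtraceZ mxtrace_Emx ?mulr1 //; have := ltn_ord i; lia.
    by rewrite mxtraceZ mxtrace_Emx0 ?mulr0 // eq_sym.
  rewrite -/(mxtrace (A - _)) linearB /= mxtrace_scalar -[_ *+ n]mulr_natr.
  rewrite divfK // subrr add0r.
  have tr1 (c : K) :
      \sum_(1 <= i < n.+1) \tr (c *: (Emx i i : M)) = c * n%:R.
    rewrite mulr_natr -[n in RHS]subn0 -subSS -sumr_const_nat.
    by apply: eq_big_nat => i ?; rewrite mxtraceZ mxtrace_Emx ?mulr1 //; lia.
  have tr2 (c : K) :
      \sum_(1 <= i < m.+1) \tr (c *: (Emx (n + i) (n + i) : M)) = c * m%:R.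
    rewrite mulr_natr -[m in RHS]subn0 -subSS -sumr_const_nat.
    by apply: eq_big_nat => i ?; rewrite mxtraceZ mxtrace_Emx ?mulr1 //; lia.
  rewrite tr1 tr2 [m%:R / _ * _]mulrAC [- _ / _ * _]mulrAC -mulrDl mulNr.
  by rewrite [n%:R * _]mulrC subrr mul0r mulr0.
rewrite /gl_iA linearD linearZ /= [X in X + _](_ : _ = 0) ?add0r; last first.
  rewrite linear_sum big1 // => i _; rewrite linear_sum big1 // => j _.
  rewrite linearZ /= comm_shift0 ?scaler0 // => l.
  by have := ltn_ord i; have := ltn_ord j; lia.
rewrite (_ : commx _ _ = 0) ?scaler0 //.
set P := _ + _; have PE a b : P a b = if a == b then
    if (a < n)%N then m%:R / (n + m)%:R else - n%:R / (n + m)%:R else 0.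
  have ent (c : K) g r : (\sum_(1 <= i < r.+1) c *: (Emx (g + i) (g + i) : M)) a b
      = if (a == b) && (g <= a < g + r)%N then c else 0.
    rewrite summxE; case: ifP => [/andP[/eqP <- lt_a]|out].
      rewrite (bigD1_seq (a.+1 - g)%N) ?mem_index_iota ?iota_uniq //=; last by lia.
      rewrite !mxE subnKC; last by lia.
      rewrite eqxx mulr1 big1 ?addr0 // => i ne_i; rewrite !mxE.
      by rewrite (_ : (a.+1 == _) = false) ?mulr0 //; lia.
    rewrite big_nat big1 // => i lt_i; rewrite !mxE.
    rewrite (_ : _ && _ = false) ?mulr0 //.
    by apply/negbTE/negP => /andP[/eqP ea /eqP eb]; move: out; rewrite -val_eqE /=; lia.
  rewrite mxE (ent _ 0%N n) ent; have lt_a := ltn_ord a.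
  case: (a == b); rewrite ?addr0 //=; case: ltnP => le_a.
    by rewrite addr0.
  by rewrite lt_a add0r.
have eE a b : (gl_e : M) a b = ((n <= a)%N && (b == a.+1 :> nat))%:R.
  have [lt_a lt_b] := (ltn_ord a, ltn_ord b).
  rewrite summxE; case: andP => [[le_a /eqP eq_b]|out].
    rewrite (bigD1_seq (a.+1 - n)%N) ?mem_index_iota ?iota_uniq //=; last by lia.
    rewrite !mxE (_ : _ && _ = true); last by lia.
    rewrite big1 ?addr0 // => i ne_i; rewrite !mxE.
    by rewrite (_ : (a.+1 == _) = false) //; lia.
  rewrite big_nat big1 // => i lt_i; rewrite !mxE.
  rewrite (_ : _ && _ = false) //; apply/negbTE/negP => ?; apply: out; lia.
apply/matrixP => a b; rewrite !mxE (bigD1 b) //= [in X in _ - X](bigD1 a) //=.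
rewrite !big1 ?addr0; first last.
- by move=> c ne_c; rewrite PE (negbTE ne_c) mulr0.
- by move=> c ne_c; rewrite PE eq_sym (negbTE ne_c) mul0r.
rewrite eE !PE !eqxx mulrC; case: andP => [[le_a /eqP eq_b]|_].
  by rewrite !ifF ?subrr //; lia.
by rewrite !(mulr0, mul0r) subrr.
Qed.

Lemma gl_iy_z y : (0 < m)%N -> gl_iy y \in gl_z.
Proof.
move=> m_gt0; rewrite memv_suml // => i _; have lt_in := ltn_ord i.
rewrite memvZ // memv_cap memv_sl memv_ker lfunE /=.
by rewrite comm_shift0 ?mxtrace_Emx0 ?eqxx // => [|l]; lia.
Qed.

Lemma gl_ix_z x : gl_ix x \in gl_z.
Proof.
rewrite memv_suml // => i _; have lt_in := ltn_ord i.
rewrite memvZ // memv_cap memv_sl memv_ker lfunE /=.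
by rewrite comm_shift0 ?mxtrace_Emx0 ?eqxx // => [|l]; lia.
Qed.

End SliceGl.

Section SliceSp.
Variables (K : fieldType) (n m : nat).
Local Notation M := 'M[K]_((n + m).*2).

Definition sp_e : M := \sum_(1 <= j < m.*2) Emx (n + j) (n + j.+1).
Definition sp_h : M :=
  \sum_(1 <= j < m.*2.+1) ((m.*2.+1)%:R - (2 * j)%:R) *: Emx (n + j) (n + j).
Definition sp_f : M :=
  \sum_(1 <= j < m.*2) (j * (m.*2 - j))%:R *: Emx (n + j.+1) (n + j).

Definition corner (a : nat) : nat := if (a <= n)%N then a else (a + m.*2)%N.

Definition sp_iA (A : 'M[K]_(n.*2)) : M :=
  \sum_(a < n.*2) \sum_(b < n.*2) A a b *: Emx (corner a.+1) (corner b.+1).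

(* The image of y_a, for 1 <= a <= 2 n. *)
Definition sp_iy1 (a : nat) : M :=
  if (a <= n)%N then
    Emx a (n + m.*2) +
    (-1) ^+ (n + a + 1) *: Emx n.+1 (n.*2 + m.*2 + 1 - a)
  else
    let i := (a - n)%N in
    Emx (n + m.*2 + i) (n + m.*2) + (-1) ^+ (i + 1) *: Emx n.+1 (n + 1 - i).

Definition sp_iy (y : 'cV[K]_(n.*2)) : M := \sum_(a < n.*2) y a 0 *: sp_iy1 a.+1.

Definition sp_z : {vspace M} := centr (spv K (n + m).*2) sp_e.

Lemma Emx_sp i j : (0 < i <= (n + m).*2)%N -> (0 < j <= (n + m).*2)%N ->
  Emx i j + (-1) ^+ (i + j).+1 *: Emx ((n + m).*2.+1 - j) ((n + m).*2.+1 - i)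
    \in spv K (n + m).*2.
Proof.
set k := (n + m).*2 => lt_i lt_j; rewrite memv_sp; apply/eqP/matrixP => a b.
have even_k : ~~ odd k by rewrite odd_double.
have [lt_a lt_b] := (ltn_ord a, ltn_ord b).
rewrite !mxE (bigD1 (rev_ord b)) //= [in X in _ + X](bigD1 (rev_ord a)) //=.
rewrite !big1 ?addr0; first last.
- by move=> c ne_c; rewrite !mxE ifF ?mulr0 //; move: ne_c; rewrite -val_eqE /=; lia.
- by move=> c ne_c; rewrite !mxE ifF ?mul0r //; move: ne_c; rewrite -val_eqE /=; lia.
rewrite !mxE /= !ifT; [|lia|lia].
set p := _ && (_ == j) in |- *; set q := _ && (_ == (_ - i)%N) in |- *.
rewrite (_ : ((k - a.+1).+1 == i) && _ = q); last by rewrite /q; lia.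
rewrite (_ : _ && (b.+1 == (_ - i)%N) = p); last by rewrite /p; lia.
have sgn x y : odd x != odd y -> (-1) ^+ x + (-1) ^+ y = 0 :> K.
  rewrite -[_ ^+ x]signr_odd -[_ ^+ y]signr_odd.
  by case: (odd x); case: (odd y); rewrite // expr0 expr1 ?subrr ?addNr.
have p_eq0 : p%:R * ((-1) ^+ b.+1 + (-1) ^+ ((k - a.+1).+1 + (i + j).+1)) = 0 :> K.
  case p_ab: p; last by rewrite mul0r.
  by rewrite sgn ?mulr0 //; move: p_ab; rewrite /p; lia.
have q_eq0 : q%:R * ((-1) ^+ ((i + j).+1 + b.+1) + (-1) ^+ (k - a.+1).+1) = 0 :> K.
  case q_ab: q; last by rewrite mul0r.
  by rewrite sgn ?mulr0 //; move: q_ab; rewrite /q; lia.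
rewrite -[RHS](addr0 0) -{1}p_eq0 -q_eq0 !exprD; ring.
Qed.

Lemma sp_e_sp : 2 != 0 :> K -> sp_e \in spv K (n + m).*2.
Proof.
move=> nz2; rewrite -[sp_e]scale1r -(mulVf nz2) -scalerA; apply: memvZ.
have -> : 2 *: sp_e = \sum_(1 <= j < m.*2) (Emx (n + j) (n + j.+1) +
    (-1) ^+ ((n + j) + (n + j.+1)).+1 *:
      Emx ((n + m).*2.+1 - (n + j.+1)) ((n + m).*2.+1 - (n + j))).
  rewrite scaler_nat mulr2n [in X in _ + X]/sp_e big_nat_rev -big_split /=.
  apply: eq_big_nat => j lt_j; congr (_ + _).
  rewrite -signr_odd (_ : odd _ = false) ?scale1r; last by lia.
  by congr (Emx _ _); lia.
by rewrite big_nat memv_suml // => j lt_j; apply: Emx_sp; lia.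
Qed.

Lemma sp_iy_z y : (0 < m)%N -> sp_iy y \in sp_z.
Proof.
move=> m_gt0; rewrite memv_suml // => a _; have lt_a := ltn_ord a.
apply: memvZ; rewrite memv_cap memv_ker lfunE /= /sp_iy1 /sp_e.
case: ifP => le_a; apply/andP; split.
- rewrite (_ : Emx _ _ + _ = Emx a.+1 (n + m.*2) +
    (-1) ^+ (a.+1 + (n + m.*2)).+1 *: Emx ((n + m).*2.+1 - (n + m.*2)) ((n + m).*2.+1 - a.+1)).
    by apply: Emx_sp; lia.
  congr (Emx _ _ + _ *: Emx _ _); try lia.
  by rewrite -[LHS]signr_odd -[RHS]signr_odd; congr (_ ^+ _); lia.
- by rewrite linearD linearZ /= !comm_shift0 ?scaler0 ?addr0 // => l; lia.
- set i := (a.+1 - n)%N; rewrite -/i.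
  rewrite (_ : Emx _ _ + _ = Emx (n + m.*2 + i) (n + m.*2) +
    (-1) ^+ ((n + m.*2 + i) + (n + m.*2)).+1 *:
       Emx ((n + m).*2.+1 - (n + m.*2)) ((n + m).*2.+1 - (n + m.*2 + i))).
    by apply: Emx_sp; lia.
  congr (Emx _ _ + _ *: Emx _ _); try lia.
  by rewrite -[LHS]signr_odd -[RHS]signr_odd; congr (_ ^+ _); lia.
- by rewrite linearD linearZ /= !comm_shift0 ?scaler0 ?addr0 // => l; lia.
Qed.

(* omega(y_1, y_2n) = 1, so that [sp_iy u, sp_iy v] is
   2 (-1)^n omega(u, v) E_{n+1,n+2m}: the sign is that of the form on the middle
   block.  As X_{n+2m,n+1} has the coefficient -1 in the coefficient of z^(2m) of
   det(1 + z X), this is why sp_iy has to be divided by a square root of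
   2 (-1)^(n+1), which is sqrt 2 for odd n only.                             *)
Lemma commx_sp_iy1 : (0 < n)%N -> (0 < m)%N ->
  commx (sp_iy1 1) (sp_iy1 n.*2) = (2 * (-1) ^+ n) *: Emx n.+1 (n + m.*2).
Proof.
move=> n_gt0 m_gt0; rewrite /sp_iy1 n_gt0 ifF; last by lia.
rewrite (_ : n.*2 - n = n)%N; last by lia.
rewrite (_ : n + 1 - n = 1)%N; last by lia.
rewrite (_ : n.*2 + m.*2 + 1 - 1 = n + m.*2 + n)%N; last by lia.
rewrite /commx !mulmxDl !mulmxDr -!scalemxAl -!scalemxAr.
rewrite !mulEmx; try lia.
rewrite !mulEmx0; try lia.
rewrite !scaler0 !add0r !addr0 -scalerBl !exprD expr1.
by congr (_ *: _); ring.
Qed.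

Lemma corner_rev a : (a < n.*2)%N ->
  corner (n.*2 - a) = ((n + m).*2.+1 - corner a.+1)%N.
Proof. by rewrite /corner; do 2?case: ifP; lia. Qed.

Lemma sp_iA_z (A : subvs_of (spv K n.*2)) : 2 != 0 :> K ->
  sp_iA (vsval A) \in sp_z.
Proof.
move=> nz2; rewrite -[sp_iA _]scale1r -(mulVf nz2) -scalerA.
apply: memvZ.
set X := vsval A; have spX : X \in spv K n.*2 by exact: subvsP.
have symX (a b : 'I_n.*2) : X (rev_ord b) (rev_ord a) = (-1) ^+ (a + b).+1 * X a b.
  have even_k : ~~ odd n.*2 by rewrite odd_double.
  have [lt_a lt_b] := (ltn_ord a, ltn_ord b).
  move: spX; rewrite memv_sp => /eqP/matrixP/(_ (rev_ord a) b); rewrite !mxE.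
  rewrite (bigD1 (rev_ord b)) //= [in X in _ + X](bigD1 a) //=.
  rewrite !big1 ?addr0; first last.
  - by move=> c ne_c; rewrite !mxE ifF ?mulr0 //; move: ne_c; rewrite -val_eqE /=; lia.
  - by move=> c ne_c; rewrite !mxE ifF ?mul0r //; move: ne_c; rewrite -val_eqE /=; lia.
  rewrite !mxE /= !ifT; [|lia|lia].
  move/eqP; rewrite addr_eq0 => /eqP eqX.
  apply: (@mulIf _ ((-1) ^+ b.+1)); first by rewrite signr_eq0.
  rewrite eqX -mulNr -[- _]mulN1r -exprS [RHS]mulrAC -exprD; congr (_ * _).
  by rewrite -[LHS]signr_odd -[RHS]signr_odd; congr (_ ^+ _); lia.
have -> : 2 *: sp_iA X = \sum_(a < n.*2) \sum_(b < n.*2) X a b *: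
   (Emx (corner a.+1) (corner b.+1) + (-1) ^+ (corner a.+1 + corner b.+1).+1 *:
    Emx ((n + m).*2.+1 - corner b.+1) ((n + m).*2.+1 - corner a.+1)).
  rewrite scaler_nat mulr2n [in X in _ + X]/sp_iA exchange_big /=.
  rewrite [in X in _ + X](reindex_inj rev_ord_inj) /= -big_split /=.
  apply: eq_bigr => a _; rewrite [in X in _ + X](reindex_inj rev_ord_inj) -big_split /=.
  apply: eq_bigr => b _; rewrite scalerDr; congr (_ + _); rewrite symX.
  have [lt_a lt_b] := (ltn_ord a, ltn_ord b).
  rewrite !subnSK // !corner_rev // mulrC -scalerA; congr (_ *: (_ *: _)).
  rewrite -[LHS]signr_odd -[RHS]signr_odd; congr (_ ^+ _).
  by rewrite /corner; do 2?case: ifP; lia.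
rewrite memv_suml // => a _; rewrite memv_suml // => b _.
have [lt_a lt_b] := (ltn_ord a, ltn_ord b).
apply: memvZ.
rewrite memv_cap memv_ker lfunE /= Emx_sp; try by rewrite /corner; case: ifP; lia.
rewrite /sp_e linearD linearZ /= !comm_shift0 ?scaler0 ?addr0 // => l;
  by rewrite /corner; do 2?case: ifP; lia.
Qed.

End SliceSp.

(* Main.v *)
From HB Require Import structures.
Require Import Defs.
From mathcomp Require Import all_boot all_order all_algebra.
From mathcomp Require Import zify ring.
From mathcomp Require Import mpoly complex reals.

(* In both cases a point X of the slice has, up to a reordering of the indices, the
   block form [[A, b e_1^T], [e_r c, E]] with E = e + sum_j a_j f^j in the middle
   block, and the images of A, y, x are the entries of A, c, b.  Modulo tau^(r+1)
   det (1 - tau X) equals det (1 - tau A) det (1 - tau E), and its coefficient of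
   tau^(j+1) is, for given a_i, i < j, an affine function of a_j of nonzero slope.
   So A, b, c and the coefficients of the determinant are coordinates on the slice
   (for sp_2N, b being determined by c).

   The bracket of the slice is computed from Hamiltonian vectors: xi_u in g with the
   same differential along the slice as Theta u, and such that [X, xi_u] is
   orthogonal to m.  Then {Theta u, Theta w}(X) = (X, [xi_u, xi_w]).  For the
   coefficients of the determinant the coefficients of adj (1 + z X) do, and they
   commute with X.  For y one takes the block sum_i A^i y e_1^T G_(r-1-i), with G_k
   the coefficient of tau^k of det (1 - tau E) (1 - tau E)^-1: the commutator with X
   telescopes to the vector q = sum_i D_(r-i) A^i y, D = det (1 - tau E).  Replacing
   D by det (1 - tau X) / det (1 - tau A) turns the pairing of q with x into the sum
   of the zeta_j alpha_j.  For sp_2N these vectors are projected orthogonally to sp_2N.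

   The facts on sl_2-triples needed for the slice follow from the positive definite
   form tr (u * star v), for which ad e and ad f are adjoint. *)

Set Implicit Arguments.
Unset Strict Implicit.
Unset Printing Implicit Defensive.

Import Order.TTheory GRing.Theory Num.Theory.
Local Open Scope ring_scope.

(** The bracket of the slice is defined by [ad m]-invariant lifts, and the functions given by y have
    no convenient ones. Hence the detour through Hamiltonian vectors, which needs two facts.
    Uniqueness: at a point of the slice, the gradient of an invariant lift and a Hamiltonian vector
    of the same function differ by an element of m. The difference is orthogonal to the tangent
    space; descending through its degrees shows that nothing above degree -1 survives, and in degree
    -1 the Lagrangian condition puts it in l. Existence: lifts are built by adjoining the vectors
    eta of m one at a time, from the lowest degree upwards. Each eta has a partner s, vanishing on
    the slice, with {eta, s} = 1 modulo the ideal, and sum_i (-s)^i / i! (ad eta)^i F is the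
    corrected function.

    Identities in coordinate rings are checked at points, K being infinite. Accordingly the inverse
    of Theta is no formula on generators: it evaluates functions at one point of the slice with
    coordinates in S(V), found by solving recursively for the a_j. *)

(** The chain rule: both sides are derivations along [phi], so constants and variables decide. It
    serves for restrictions to a line ([D] the derivative of polynomials in one variable) and for
    partial derivatives of [Theta]. *)
Lemma derivation_mpoly (K : comNzRingType) (S : comNzRingType) (n : nat)
    (D : {additive S -> S}) (phi : {rmorphism {mpoly K[n]} -> S}) :
  (forall a b, D (a * b) = D a * b + a * D b) ->
  (forall c, D (phi c%:MP) = 0) ->
  forall p, D (phi p) = \sum_(i < n) phi p^`M(i) * D (phi 'X_i).
Proof.
move=> DM Dc.
pose P p := D (phi p) = \sum_(i < n) phi p^`M(i) * D (phi 'X_i).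
have PC c : P c%:MP.
  by rewrite /P Dc big1 // => i _; rewrite mderivC rmorph0 mul0r.
have PM p q : P p -> P q -> P (p * q).
  rewrite /P rmorphM DM => -> ->; rewrite mulr_suml mulr_sumr -big_split /=.
  apply: eq_bigr => i _; rewrite mderivM rmorphD !rmorphM /=; ring.
have PD p q : P p -> P q -> P (p + q).
  rewrite /P rmorphD raddfD => -> ->; rewrite -big_split /=.
  by apply: eq_bigr => i _; rewrite mderivD rmorphD mulrDl.
have PX i : P 'X_i.
  rewrite /P (bigD1 i) //= big1 => [|j ne_ji]; rewrite mderivX mnm1E.
    rewrite eqxx scale1r (_ : (_ - _)%MM = 0%MM) ?mpolyX0 ?rmorph1 ?mul1r ?addr0 //.
    by apply/mnmP => l; rewrite mnmBE subnn mnm0E.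
  by rewrite eq_sym (negbTE ne_ji) scale0r rmorph0 mul0r.
elim/mpolyind => [|c m p _ _ Pp]; first by rewrite -mpolyC0; apply: (PC).
apply: (PD) => //; rewrite -mul_mpolyC; apply: (PM) => //.
rewrite mpolyXE_id; apply: (big_ind P) => [|a b|i _]; first by rewrite -mpolyC1.
  exact: (PM).
elim: (m i) => [|l IHl]; first by rewrite expr0 -mpolyC1.
by rewrite exprS; apply: (PM).
Qed.

Lemma poly_fun_eq0 (K : numDomainType) (q : {poly K}) :
  (forall t, q.[t] = 0) -> q = 0.
Proof.
move=> q0; apply/eqP/negP => /negP nz_q.
have uniq_s : uniq [seq i%:R : K | i <- iota 0 (size q)].
  by rewrite map_inj_uniq ?iota_uniq // => i j /eqP; rewrite eqr_nat => /eqP.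
have all_s : all (root q) [seq i%:R : K | i <- iota 0 (size q)].
  by apply/allP => x _; rewrite rootE q0.
by have := max_poly_roots nz_q all_s uniq_s; rewrite size_map size_iota ltnn.
Qed.

(** Restricting to lines parallel to an axis shows that the partial derivatives vanish everywhere
    too. A coefficient of positive degree is, up to a nonzero integer, a coefficient of lower degree
    of a partial derivative, and the constant term is the value at 0. *)
Lemma mpoly_fun_eq0 (K : numDomainType) n (p : {mpoly K[n]}) :
  (forall v, p.@[v] = 0) -> p = 0.
Proof.
have der (q : {mpoly K[n]}) i :
    (forall v, q.@[v] = 0) -> forall v, q^`M(i).@[v] = 0.
  move=> q0 v.
  pose w j : {poly K} := (v j)%:P + (j == i)%:R *: 'X.
  pose phi : {rmorphism {mpoly K[n]} -> {poly K}} := mmap polyC w.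
  have phiE (t : K) a : (phi a).[t] = a.@[fun j => v j + (j == i)%:R * t].
    rewrite /phi /mmap mevalE -[_.[t]]/(horner_eval t _) rmorph_sum /=.
    apply: eq_bigr => m _; rewrite rmorphM /= /horner_eval hornerC; congr (_ * _).
    rewrite /mmap1 -/(horner_eval _ _) rmorph_prod /=; apply: eq_bigr => j _.
    by rewrite rmorphXn /= /horner_eval /w hornerD hornerC hornerZ hornerX.
  have phi0 : phi q = 0.
    by apply: poly_fun_eq0 => t; rewrite phiE q0.
  have := @derivation_mpoly K {poly K} n (@deriv K) phi (@derivM K) _ q.
  rewrite /= phi0 raddf0 (bigD1 i) //= big1 => [|j ne_ji]; last first.
    by rewrite /phi /= mmapX mmap1U /w (negbTE ne_ji) scale0r addr0 derivC mulr0.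
  rewrite mmapX mmap1U /w eqxx scale1r derivD derivC derivX add0r.
  rewrite mulr1 addr0 => E.
  have {E} : phi q^`M(i) = 0 by rewrite /phi /= /w -E // => c; rewrite mmapC derivC.
  move/(congr1 (fun a => a.[0])); rewrite phiE horner0.
  by rewrite (@meval_eq _ _ _ v) // => j; rewrite mulr0 addr0.
have ev0 (q : {mpoly K[n]}) : q.@[fun=> 0] = q@_0%MM.
  elim/mpolyind: q => [|c m q _ _ IHq]; first by rewrite raddf0 mcoeff0.
  rewrite mevalD mevalZ mcoeffD mcoeffZ IHq mevalX mcoeffX; congr (_ * _ + _).
  have [->|nz_m] := eqVneq m 0%MM.
    by rewrite big1 // => i _; rewrite mnm0E expr0.
  have /existsP[i nz_mi] : [exists i, m i != 0%N].
    apply: contraNT nz_m => /existsPn m0; apply/eqP/mnmP => i.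
    by have := m0 i; rewrite mnm0E negbK => /eqP.
  by rewrite (bigD1 i) //= expr0n (negbTE nz_mi) mul0r.
have coef0 d (m : 'X_{1..n}) : mdeg m = d ->
    forall q : {mpoly K[n]}, (forall v, q.@[v] = 0) -> q@_m = 0.
  elim: d m => [|d IHd] m.
    by move/eqP; rewrite mdeg_eq0 => /eqP-> q q0; rewrite -ev0.
  move=> deg_m q q0.
  have /existsP[i nz_mi] : [exists i, m i != 0%N].
    apply: contra_eqT deg_m => /existsPn m0.
    by rewrite mdegE big1 // => i _; apply/eqP; have := m0 i; rewrite negbK.
  have def_m : m = (m - U_(i) + U_(i))%MM.
    by rewrite submK // lep1mP.
  have : (q^`M(i))@_(m - U_(i)) = 0.
    apply: IHd; last exact: der.
    by move: deg_m; rewrite {1}def_m mdegD mdeg1 addn1 => -[].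
  rewrite mcoeff_mderiv -def_m => /eqP; rewrite mulrn_eq0 /= => /eqP //.
by move=> p0; apply/mpolyP => m; rewrite mcoeff0 (coef0 _ m erefl).
Qed.
(** * Symmetric algebras and Lie-Poisson brackets *)

Section SymTheory.
Variables (K : fieldType) (V : vectType K).
Implicit Types (u v w : V) (F G H : Sym V) (phi : V -> K).

Fact symg_is_linear : linear (@symg K V).
Proof.
move=> a u v; rewrite /symg scaler_sumr -big_split /=; apply: eq_bigr => i _.
by rewrite linearP scalerDl scalerA.
Qed.
HB.instance Definition _ :=
  GRing.isLinear.Build K V (Sym V) _ (@symg K V) symg_is_linear.

Lemma coord_symb (i j : 'I_(\dim {:V})) : coord (vbasis {:V}) i (symb j) = (i == j)%:R.
Proof. by rewrite /symb coord_free ?(basis_free (vbasisP _)) // eq_sym. Qed.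

Lemma symg_symb i : symg (symb i : V) = 'X_i.
Proof.
rewrite /symg (bigD1 i) //= big1 ?addr0 => [|j ne_ji]; rewrite coord_symb.
  by rewrite eqxx scale1r.
by rewrite (negbTE ne_ji) scale0r.
Qed.

(** The differential of [F] at the point [phi] of the dual space, regarded as a vector of [V]. *)
Definition sgrad phi F : V := \sum_i symev phi F^`M(i) *: symb i.

Lemma mderiv_symg u i : (symg u)^`M(i) = (coord (vbasis {:V}) i u)%:MP.
Proof.
rewrite /symg linear_sum (bigD1 i) //= big1 ?addr0 => [|j ne_ji].
  rewrite mderivZ mderivX mnm1E eqxx scale1r (_ : (_ - _)%MM = 0%MM).
    by rewrite mpolyX0 -mul_mpolyC mulr1.
  by apply/mnmP => l; rewrite mnmBE subnn mnm0E.
by rewrite mderivZ mderivX mnm1E (negbTE ne_ji) scale0r scaler0.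
Qed.

Lemma sgrad_symg phi u : sgrad phi (symg u) = u.
Proof.
rewrite /sgrad [RHS](coord_vbasis (memvf u)); apply: eq_bigr => i _.
by rewrite mderiv_symg /symev mevalC.
Qed.

Lemma sgradD phi F G : sgrad phi (F + G) = sgrad phi F + sgrad phi G.
Proof.
rewrite /sgrad -big_split /=; apply: eq_bigr => i _.
by rewrite mderivD /symev mevalD scalerDl.
Qed.

Lemma sgradZ phi a F : sgrad phi (a *: F) = a *: sgrad phi F.
Proof.
rewrite /sgrad scaler_sumr; apply: eq_bigr => i _.
by rewrite mderivZ /symev mevalZ scalerA.
Qed.

Lemma sgradC phi a : sgrad phi a%:MP = 0.
Proof.
by rewrite /sgrad big1 // => i _; rewrite mderivC /symev meval0 scale0r.
Qed.

Lemma derivation_eq (D D' : {additive Sym V -> Sym V}) :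
  (forall F G, D (F * G) = D F * G + F * D G) -> (forall a, D a%:MP = 0) ->
  (forall F G, D' (F * G) = D' F * G + F * D' G) -> (forall a, D' a%:MP = 0) ->
  (forall u, D (symg u) = D' (symg u)) -> D =1 D'.
Proof.
move=> DM D0 D'M D'0 DD' F.
have := @derivation_mpoly K (Sym V) _ D idfun DM D0 F.
have := @derivation_mpoly K (Sym V) _ D' idfun D'M D'0 F.
by move=> /= -> ->; apply: eq_bigr => i _; rewrite -symg_symb DD'.
Qed.

Variable c : V -> V -> Sym V.

Lemma symbrM F G H : symbr c F (G * H) = symbr c F G * H + G * symbr c F H.
Proof.
rewrite /symbr mulr_suml mulr_sumr -big_split; apply: eq_bigr => i _ /=.
rewrite mulr_suml mulr_sumr -big_split; apply: eq_bigr => j _ /=.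
by rewrite mderivM; ring.
Qed.

Fact symbr_is_linear F : linear (symbr c F).
Proof.
move=> a G H; rewrite /symbr scaler_sumr -big_split; apply: eq_bigr => i _ /=.
rewrite scaler_sumr -big_split; apply: eq_bigr => j _ /=.
by rewrite linearP /= mulrDr scalerAr.
Qed.
HB.instance Definition _ F :=
  GRing.isLinear.Build K (Sym V) (Sym V) _ (symbr c F) (symbr_is_linear F).

Lemma symbrC F a : symbr c F a%:MP = 0.
Proof.
by rewrite /symbr big1 // => i _; rewrite big1 // => j _; rewrite mderivC mulr0.
Qed.

Lemma symev_symbr phi F G : symev phi (symbr c F G) =
  \sum_i \sum_j symev phi (c (symb i) (symb j)) *
    symev phi F^`M(i) * symev phi G^`M(j).
Proof.
rewrite /symev /symbr raddf_sum /=; apply: eq_bigr => i _.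
by rewrite raddf_sum /=; apply: eq_bigr => j _; rewrite !mevalM.
Qed.

End SymTheory.

(** * Commutators, the trace form and the Lie-Poisson bracket *)

Section Commutator.
Variables (K : fieldType) (k : nat).
Implicit Types A B C : 'M[K]_k.

Lemma commxC A B : commx A B = - commx B A.
Proof. by rewrite /commx opprB. Qed.

Lemma commxDl A B C : commx (A + B) C = commx A C + commx B C.
Proof. by rewrite /commx mulmxDl mulmxDr opprD addrACA. Qed.

Lemma commxZl a A B : commx (a *: A) B = a *: commx A B.
Proof. by rewrite /commx -scalemxAl -scalemxAr scalerBr. Qed.

Lemma commx0l A : commx 0 A = 0.
Proof. by rewrite /commx mul0mx mulmx0 subrr. Qed.

Lemma commx_suml I (s : seq I) (P : pred I) (F : I -> 'M[K]_k) A :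
  commx (\sum_(i <- s | P i) F i) A = \sum_(i <- s | P i) commx (F i) A.
Proof.
elim/big_ind2: _ => [|? ? ? ? <- <-|//]; [exact: commx0l | exact: commxDl].
Qed.

Lemma commxJ A B C : commx A (commx B C) = commx (commx A B) C + commx B (commx A C).
Proof.
rewrite /commx !(mulmxBl, mulmxBr) !mulmxA !opprB.
rewrite [RHS]addrACA -[in RHS]addrA; set a := A *m B *m C; set b := C *m _ *m _.
by apply/matrixP => i j; rewrite !mxE; ring.
Qed.

Lemma trformC A B : trform A B = trform B A.
Proof. exact: mxtrace_mulC. Qed.

Lemma trform_commx A B C : trform (commx A B) C = trform A (commx B C).
Proof.
rewrite /trform /commx mulmxBl mulmxBr !raddfB /= !mulmxA; congr (_ - _).
by rewrite -[B *m A *m C]mulmxA mxtrace_mulC.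
Qed.

Lemma trformDl A B C : trform (A + B) C = trform A C + trform B C.
Proof. by rewrite /trform mulmxDl linearD. Qed.

Lemma trformZl a A B : trform (a *: A) B = a * trform A B.
Proof. by rewrite /trform -scalemxAl linearZ. Qed.

Lemma trformDr A B C : trform A (B + C) = trform A B + trform A C.
Proof. by rewrite /trform mulmxDr linearD. Qed.

Lemma trformZr a A B : trform A (a *: B) = a * trform A B.
Proof. by rewrite /trform -scalemxAr linearZ. Qed.

Lemma trformNl A B : trform (- A) B = - trform A B.
Proof. by rewrite /trform mulNmx linearN. Qed.

Lemma trformNr A B : trform A (- B) = - trform A B.
Proof. by rewrite /trform mulmxN linearN. Qed.

Lemma trform0l A : trform 0 A = 0.
Proof. by rewrite /trform mul0mx linear0. Qed.

Lemma trform0r A : trform A 0 = 0.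
Proof. by rewrite /trform mulmx0 linear0. Qed.

Lemma trform_suml I (s : seq I) (P : pred I) (F : I -> 'M[K]_k) A :
  trform (\sum_(i <- s | P i) F i) A = \sum_(i <- s | P i) trform (F i) A.
Proof. by rewrite /trform mulmx_suml linear_sum. Qed.

Lemma trform_sumr I (s : seq I) (P : pred I) (F : I -> 'M[K]_k) A :
  trform A (\sum_(i <- s | P i) F i) = \sum_(i <- s | P i) trform A (F i).
Proof. by rewrite /trform mulmx_sumr linear_sum. Qed.

Lemma trformE A B : trform A B = \sum_i \sum_j A i j * B j i.
Proof. by rewrite /trform /mxtrace; apply: eq_bigr => i _; rewrite mxE. Qed.

End Commutator.

Lemma vsval_inj (K : fieldType) (V : vectType K) (U : {vspace V}) :
  injective (@vsval K V U).
Proof. exact: val_inj. Qed.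

Section LiePoisson.
Variables (K : fieldType) (k : nat) (U : {vspace 'M[K]_k}).
Hypothesis lieU : forall A B, A \in U -> B \in U -> commx A B \in U.
Implicit Types (a b : subvs_of U) (F G : Sym (subvs_of U)) (X : 'M[K]_k).

Lemma vsval_lie a b : vsval (lie a b) = commx (vsval a) (vsval b).
Proof. by rewrite vsprojK // lieU ?subvsP. Qed.

Lemma lie_linear a : linear (lie a).
Proof. by move=> t b b'; apply: vsval_inj; rewrite vsval_lie !linearP /= !vsval_lie. Qed.

Lemma lieC a b : lie a b = - lie b a.
Proof. by apply: vsval_inj; rewrite vsval_lie commxC -vsval_lie linearN. Qed.

Lemma lie_linearl a : linear (fun b => lie b a).
Proof. by move=> t b b'; rewrite /= lieC lie_linear opprD -scalerN -!lieC. Qed.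

Lemma liebr_symg a b : liebr (symg a) (symg b) = symg (lie a b).
Proof.
apply: symbr_symg => w t x y.
  by rewrite lie_linear linearP.
by rewrite lie_linearl linearP.
Qed.

Definition grad X F : subvs_of U := sgrad (fun a => trform (vsval a) X) F.

Lemma fval_symg a X : fval (symg a) X = trform (vsval a) X.
Proof.
apply: (@symev_symg K _ (fun B => trform (vsval B) X)) => t B C.
exact: trform_is_scalar.
Qed.

Lemma fvalM F G X : fval (F * G) X = fval F X * fval G X.
Proof. exact: mevalM. Qed.
Lemma fvalD F G X : fval (F + G) X = fval F X + fval G X.
Proof. exact: mevalD. Qed.
Lemma fvalB F G X : fval (F - G) X = fval F X - fval G X.
Proof. exact: mevalB. Qed.
Lemma fvalZ t F X : fval (t *: F) X = t * fval F X.
Proof. exact: mevalZ. Qed.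
Lemma fvalC t X : fval (t%:MP : Sym (subvs_of U)) X = t.
Proof. exact: mevalC. Qed.
Lemma fval_sum I (s : seq I) (P : pred I) (F : I -> Sym (subvs_of U)) X :
  fval (\sum_(i <- s | P i) F i) X = \sum_(i <- s | P i) fval (F i) X.
Proof. exact: (raddf_sum (meval _)). Qed.

(** The Kirillov-Kostant formula: at [X] the bracket depends only on the two differentials, which
    are elements of the Lie algebra. *)
Lemma fval_liebr F G X :
  fval (liebr F G) X = trform (commx (vsval (grad X F)) (vsval (grad X G))) X.
Proof.
rewrite /fval symev_symbr /grad /sgrad [vsval _]linear_sum /= commx_suml.
rewrite trform_suml; apply: eq_bigr => i _.
rewrite [vsval (\sum_i _)]linear_sum linear_sum trform_suml.
apply: eq_bigr => j _.
rewrite !linearZ /= commxZl !trformZl -vsval_lie -fval_symg /fval; ring.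
Qed.

HB.instance Definition _ F :=
  GRing.isLinear.Build K (Sym (subvs_of U)) (Sym (subvs_of U)) _ (liebr F)
    (symbr_is_linear _ F).

(** As functions of [F] both sides are derivations, so the Jacobi identity for matrices, applied to
    generators, is enough. *)
Lemma liebr_jacobi a b F :
  liebr (symg (lie a b)) F =
  liebr (symg a) (liebr (symg b) F) - liebr (symg b) (liebr (symg a) F).
Proof.
pose D' := (liebr (symg a) \o liebr (symg b)) \- (liebr (symg b) \o liebr (symg a)).
apply: (@derivation_eq _ _ (liebr (symg (lie a b))) D') F => [F G|t|F G|t|c].
- exact: symbrM.
- exact: symbrC.
- have liebrD H : {morph liebr H : p q / p + q} := raddfD (liebr H).
  have liebrM H p q : liebr H (p * q) = liebr H p * q + p * liebr H q.
    exact: symbrM.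
  rewrite /D' /= !(liebrM, liebrD).
  move: (liebr _ (liebr (symg a) F)) (liebr _ (liebr (symg b) F)).
  move: (liebr _ (liebr (symg a) G)) (liebr _ (liebr (symg b) G)).
  move: (liebr _ F) (liebr _ F) (liebr _ G) (liebr _ G) => *; ring.
- by rewrite /D' /= /liebr !symbrC !raddf0 addr0.
rewrite /D' /= !liebr_symg -linearB /=; congr symg; apply: vsval_inj.
rewrite [in RHS]raddfB /= !vsval_lie commxJ.
by rewrite addrK.
Qed.

End LiePoisson.
(** Nondegeneracy on the side of [V] says that the Gram matrix has full column rank, so every row of
    values of a linear form lies in its row space. No dimension of [W] has to be known. *)
Lemma pairing_repr (K : fieldType) (V W : vectType K) (B : V -> W -> K)
    (phi : V -> K) :
  (forall w, scalar (B^~ w)) -> (forall v, scalar (B v)) -> scalar phi ->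
  (forall v, (forall w, B v w = 0) -> v = 0) ->
  exists w, forall v, B v w = phi v.
Proof.
move=> Bl Br phil nondeg.
pose bl w : {linear V -> K^o} := HB.pack (B^~ w) (GRing.isLinear.Build _ _ _ _ _ (Bl w)).
pose br v : {linear W -> K^o} := HB.pack (B v) (GRing.isLinear.Build _ _ _ _ _ (Br v)).
pose ph : {linear V -> K^o} := HB.pack phi (GRing.isLinear.Build _ _ _ _ _ phil).
pose A := \matrix_(j < \dim {:W}, i < \dim {:V}) B (symb i) (symb j).
have fullA : row_full A.
  rewrite -cokermx_eq0; apply/eqP/matrixP => a b; rewrite [RHS]mxE.
  pose v := \sum_i cokermx A i b *: symb i : V.
  have v0 : v = 0.
    apply: nondeg => w; rewrite -[B v w]/(br v w) (coord_vbasis (memvf w)).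
    rewrite linear_sum big1 // => j _; rewrite linearZ /= -/(symb j).
    rewrite -[B v _]/(bl (symb j) v) linear_sum.
    have /matrixP/(_ j b) := mulmx_coker A; rewrite !mxE => E.
    rewrite (_ : \sum_i _ = 0) ?scaler0 // -[RHS]E; apply: eq_bigr => i _.
    by rewrite linearZ /= !mxE mulrC.
  have := coord_sum_free (fun i => cokermx A i b) a (basis_free (vbasisP {:V})).
  by rewrite -/v v0 linear0.
have /submxP[D defD] : (\row_i phi (symb i) <= A)%MS by exact: submx_full.
exists (\sum_j D 0 j *: symb j) => v.
rewrite -[LHS]/(bl _ v) -[RHS]/(ph v) [v](coord_vbasis (memvf v)) !linear_sum.
apply: eq_bigr => i _; rewrite !linearZ /= -/(symb i); congr (_ * _).
have /matrixP/(_ 0 i) := defD; rewrite !mxE => ->.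
rewrite -[LHS]/(br _ _) linear_sum; apply: eq_bigr => j _.
by rewrite linearZ /= mxE.
Qed.

(** * Graded sl_2-triples of matrices *)

Section Grading.
Variables (K : numClosedFieldType) (k : nat) (hh : 'I_k -> int).
Implicit Types (a b u v : 'M[K]_k) (s t : int).

(** The entry (i, j) has degree [hh i - hh j] for ad h. Degrees are controlled entry by entry, which
    makes their behaviour under products and the trace form immediate. *)
Definition supp_le t u := forall i j, u i j != 0 -> hh i - hh j <= t.
Definition homdeg t u := forall i j, u i j != 0 -> hh i - hh j = t.
Definition comp t u : 'M[K]_k := \matrix_(i, j) (u i j *+ (hh i - hh j == t)).

Lemma homdeg_le t u : homdeg t u -> supp_le t u.
Proof. by move=> hu i j /hu ->. Qed.

Lemma supp_leW s t u : s <= t -> supp_le s u -> supp_le t u.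
Proof. by move=> le_st hu i j /hu/le_trans; apply. Qed.

Lemma supp_leD t a b : supp_le t a -> supp_le t b -> supp_le t (a + b).
Proof.
move=> ha hb i j; rewrite mxE; have [->|/ha //] := eqVneq (a i j) 0.
by rewrite add0r => /hb.
Qed.

Lemma supp_le0 t : supp_le t 0.
Proof. by move=> i j; rewrite mxE eqxx. Qed.

Lemma supp_le_sum t I (r : seq I) (P : pred I) (F : I -> 'M[K]_k) :
  (forall i, P i -> supp_le t (F i)) -> supp_le t (\sum_(i <- r | P i) F i).
Proof.
by move=> hF; apply: big_ind => //; [exact: supp_le0 | exact: supp_leD].
Qed.

Lemma mulmx_neq0 a b i j : (a *m b) i j != 0 ->
  exists2 l, a i l != 0 & b l j != 0.
Proof.
move=> nz; have [/existsP[l /andP[al bl]]|/existsPn none] :=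
  boolP [exists l, (a i l != 0) && (b l j != 0)]; first by exists l.
case/negP: nz; rewrite mxE big1 // => l _; have := none l.
by rewrite negb_and !negbK => /orP[] /eqP->; rewrite ?mul0r ?mulr0.
Qed.

Lemma supp_le_commx s t a b :
  supp_le s a -> supp_le t b -> supp_le (s + t) (commx a b).
Proof.
move=> ha hb i j; rewrite mxE; have [E0|] := eqVneq ((a *m b) i j) 0.
  rewrite E0 add0r mxE oppr_eq0 => /mulmx_neq0[l /hb lb /ha la]; lia.
by move=> /mulmx_neq0[l /ha la /hb lb] _; lia.
Qed.

Lemma homdeg_commx s t a b : homdeg s a -> homdeg t b -> homdeg (s + t) (commx a b).
Proof.
move=> ha hb i j; rewrite mxE; have [E0|] := eqVneq ((a *m b) i j) 0.
  rewrite E0 add0r mxE oppr_eq0 => /mulmx_neq0[l /hb lb /ha la]; lia.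
by move=> /mulmx_neq0[l /ha la /hb lb] _; lia.
Qed.

Lemma trform_supp s t a b :
  supp_le s a -> supp_le t b -> s + t < 0 -> trform a b = 0.
Proof.
move=> ha hb lt0; rewrite trformE big1 // => i _; rewrite big1 // => j _.
have [->|/ha la] := eqVneq (a i j) 0; first by rewrite mul0r.
have [->|/hb lb] := eqVneq (b j i) 0; first by rewrite mulr0.
lia.
Qed.

Lemma trform_homdeg s t a b :
  homdeg s a -> homdeg t b -> s + t != 0 -> trform a b = 0.
Proof.
move=> ha hb lt0; rewrite trformE big1 // => i _; rewrite big1 // => j _.
have [->|/ha la] := eqVneq (a i j) 0; first by rewrite mul0r.
have [->|/hb lb] := eqVneq (b j i) 0; first by rewrite mulr0.
lia.
Qed.

Lemma comp_homdeg t u : homdeg t (comp t u).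
Proof. by move=> i j; rewrite mxE; have [|_] := eqVneq (_ - _) t; rewrite ?mulr0n ?eqxx. Qed.

Fact comp_is_linear t : linear (comp t).
Proof. by move=> c u v; apply/matrixP => i j; rewrite !mxE mulrnDl mulrnAr. Qed.
HB.instance Definition _ t :=
  GRing.isLinear.Build K 'M[K]_k 'M[K]_k _ (comp t) (comp_is_linear t).

Lemma comp_commx s t a u :
  homdeg s a -> comp (s + t) (commx a u) = commx a (comp t u).
Proof.
move=> ha; apply/matrixP => i j; rewrite !mxE -[in RHS]sumrB -sumrB -sumrMnl.
apply: eq_bigr => l _; rewrite !mxE mulrnBl mulrnAr mulrnAl; congr (_ - _).
  have [->|/ha la] := eqVneq (a i l) 0; first by rewrite !mul0r !mul0rn.
  by congr (_ *+ _); lia.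
have [->|/ha la] := eqVneq (a l j) 0; first by rewrite !mulr0 !mul0rn.
by congr (_ *+ _); lia.
Qed.

Lemma trform_comp t a b : trform (comp t a) b = trform a (comp (- t) b).
Proof.
rewrite !trformE; apply: eq_bigr => i _; apply: eq_bigr => j _.
rewrite !mxE mulrnAl mulrnAr; congr (_ *+ _); lia.
Qed.

Lemma comp_sum (N : nat) u : (forall i j, `|hh i - hh j| <= N%:Z) ->
  u = \sum_(i < (N.*2).+1) comp (N%:Z - i%:Z) u.
Proof.
move=> bd; apply/matrixP => i j; rewrite summxE.
have lt_i : (absz (N%:Z - (hh i - hh j))%R < N.*2.+1)%N by have := bd i j; lia.
rewrite (bigD1 (Ordinal lt_i)) //= big1 ?addr0 => [|l ne_l].
  by rewrite mxE (_ : (_ == _) = true) //; have := bd i j; lia.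
rewrite mxE (_ : (_ == _) = false) ?mulr0n //.
by apply/negP => /eqP E; case/negP: ne_l; apply/eqP/val_inj => /=; lia.
Qed.

Variable d : 'I_k -> K.
Hypothesis d_gt0 : forall i, 0 < d i.

(** The adjoint for the hermitian form with diagonal Gram matrix of entries 1 / d_i. The weights are
    there to allow [star e = f]. *)
Definition star u : 'M[K]_k := \matrix_(i, j) (d i / d j * (u j i)^*).

Let nz_d i : d i != 0. Proof. by rewrite gt_eqF. Qed.
Let d_conj i : (d i)^* = d i. Proof. by apply/CrealP/gtr0_real. Qed.

Lemma starK : involutive star.
Proof.
move=> u; apply/matrixP => i j; rewrite !mxE !rmorphM /= conjCK fmorphV /=.
rewrite !d_conj; field; by rewrite !nz_d.
Qed.

Lemma star_mul a b : star (a *m b) = star b *m star a.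
Proof.
apply/matrixP => i j; rewrite !mxE rmorph_sum mulr_sumr; apply: eq_bigr => l _.
rewrite !mxE rmorphM /=; field; by rewrite !nz_d.
Qed.

Lemma star_commx a b : star (commx a b) = commx (star b) (star a).
Proof.
rewrite /commx -!star_mul; apply/matrixP => i j; rewrite !mxE.
by rewrite rmorphB mulrBr.
Qed.

Lemma star0 : star 0 = 0.
Proof. by apply/matrixP => i j; rewrite !mxE rmorph0 mulr0. Qed.

Lemma star_homdeg t u : homdeg t u -> homdeg (- t) (star u).
Proof.
move=> hu i j; rewrite mxE mulf_eq0 negb_or conjC_eq0 => /andP[_ /hu <-]; lia.
Qed.

Lemma star_trform u :
  trform u (star u) = \sum_i \sum_j d j / d i * `|u i j| ^+ 2.
Proof.
rewrite trformE; apply: eq_bigr => i _; apply: eq_bigr => j _.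
by rewrite mxE normCK mulrCA.
Qed.

Lemma star_ge0 u : 0 <= trform u (star u).
Proof.
rewrite star_trform sumr_ge0 // => i _; rewrite sumr_ge0 // => j _.
by rewrite mulr_ge0 ?exprn_ge0 // divr_ge0 // ltW.
Qed.

Lemma star_eq0 u : trform u (star u) = 0 -> u = 0.
Proof.
rewrite star_trform => /eqP; rewrite psumr_eq0 => [/allP z|i _]; last first.
  by rewrite sumr_ge0 // => j _; rewrite mulr_ge0 ?exprn_ge0 // divr_ge0 // ltW.
apply/matrixP => i j; have := z i (mem_index_enum i); rewrite psumr_eq0 /=.
  move=> /allP/(_ j (mem_index_enum j)) /=; rewrite !mulf_eq0 invr_eq0.
  by rewrite !(negbTE (nz_d _)) /= orbb normr_eq0 mxE => /eqP.
by move=> l _; rewrite mulr_ge0 ?exprn_ge0 // divr_ge0 // ltW.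
Qed.

End Grading.
(* An sl_2-triple (e, h, f) in a Lie algebra U of matrices, graded by h, together
   with a conjugate-linear anti-involution exchanging e and f: the positive
   definite form tr (u * star v), for which ad f is the adjoint of ad e, replaces
   the representation theory of sl_2. *)
Record graded_triple (K : numClosedFieldType) (k : nat) (U : {vspace 'M[K]_k})
    (e h f : 'M[K]_k) (hh : 'I_k -> int) (d : 'I_k -> K) : Prop := GradedTriple {
  triple_weight : forall i, 0 < d i;
  triple_h : forall i j, h i j = (hh i)%:~R *+ (i == j);
  triple_ef : commx e f = h;
  triple_star : star d e = f;
  triple_deg : homdeg hh 2 e;
  triple_mem : e \in U;
  triple_lie : forall a b, a \in U -> b \in U -> commx a b \in U;
  triple_starP : forall a, a \in U -> star d a \in U;
  triple_comp : forall t a, a \in U -> comp hh t a \in U;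
  triple_bound : forall i j, `|hh i - hh j| < k.*2%:Z }.

Section Triple.
Variables (K : numClosedFieldType) (k : nat) (U : {vspace 'M[K]_k}).
Variables (e h f : 'M[K]_k) (hh : 'I_k -> int) (d : 'I_k -> K).
Hypothesis gt : graded_triple U e h f hh d.
Implicit Types (a b u v w X : 'M[K]_k) (s t : int).
Local Notation star := (star d).
Local Notation comp := (comp hh).
Local Notation homdeg := (homdeg hh).
Local Notation supp_le := (supp_le hh).
Local Notation z := (centr U e).

Let lieU := triple_lie gt.
Let star_K : involutive star. Proof. exact/starK/(triple_weight gt). Qed.
Let star_f : star f = e. Proof. by rewrite -(triple_star gt) star_K. Qed.

Lemma triple_degf : homdeg (- 2) f.
Proof. by rewrite -(triple_star gt); apply/star_homdeg/(triple_deg gt). Qed.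

Lemma commx_h u i j : commx h u i j = (hh i - hh j)%:~R * u i j.
Proof.
rewrite !mxE (bigD1 i) //= big1 => [|l ne_l]; last first.
  by rewrite (triple_h gt) eq_sym (negbTE ne_l) mulr0n mul0r.
rewrite (bigD1 j) //= big1 => [|l ne_l]; last first.
  by rewrite (triple_h gt) (negbTE ne_l) mulr0n mulr0.
by rewrite !(triple_h gt) !eqxx !mulr1n !addr0 intrB; ring.
Qed.

Lemma commx_h_homdeg t u : homdeg t u -> commx h u = t%:~R *: u.
Proof.
move=> hu; apply/matrixP => i j; rewrite commx_h [RHS]mxE.
by have [->|/hu -> //] := eqVneq (u i j) 0; rewrite !mulr0.
Qed.

Lemma memv_grade t u : reflect (u \in U /\ homdeg t u) (u \in grade U h t%:~R).
Proof.
rewrite memv_cap memv_ker add_lfunE opp_lfunE scale_lfunE id_lfunE lfunE /=.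
apply: (iffP andP) => -[Uu]; last first.
  by move=> /commx_h_homdeg->; rewrite subrr.
rewrite subr_eq0 => /eqP/matrixP E; split=> // i j nz_u.
have := E i j; rewrite commx_h mxE => /(mulIf nz_u)/eqP.
by rewrite eqr_int => /eqP.
Qed.

Lemma memv_centr u : (u \in z) = (u \in U) && (commx e u == 0).
Proof. by rewrite memv_cap memv_ker lfunE. Qed.

Lemma sliceP X :
  slice U e f X <-> X - e \in U /\ commx f (X - e) = 0.
Proof.
rewrite /slice memv_cap memv_ker lfunE; split=> [/andP[UX /eqP fX]|[UX fX]] //.
by apply/andP; split=> //; apply/eqP.
Qed.

Lemma dot_f u v : trform (commx f u) (star v) = trform u (star (commx e v)).
Proof.
rewrite star_commx ?(triple_star gt); last exact: (triple_weight gt).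
by rewrite [commx f u]commxC trformNl trform_commx [commx f _]commxC trformNr opprK.
Qed.

Lemma dot_e u v : trform (commx e u) (star v) = trform u (star (commx f v)).
Proof.
rewrite star_commx ?star_f; last exact: (triple_weight gt).
by rewrite [commx e u]commxC trformNl trform_commx [commx e _]commxC trformNr opprK.
Qed.

(** For a component u of degree t, [f, u] = 0 gives t u = [[e, f], u] = - [f, [e, u]]. Pairing with
    [star u] turns this into t |u|^2 = - |[e, u]|^2, so t > 0 forces u = 0. *)
Lemma kerf_nonpos v : commx f v = 0 -> supp_le 0 v.
Proof.
move=> fv0 i j nz_v; rewrite leNgt; apply/negP => t_gt0.
pose t := hh i - hh j; pose u := comp t v.
have fu0 : commx f u = 0.
  by rewrite -(comp_commx _ _ triple_degf) fv0 linear0.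
have hu : t%:~R *: u = - commx f (commx e u).
  rewrite -(commx_h_homdeg (@comp_homdeg _ _ hh t v)) -(triple_ef gt).
  by have := commxJ e f u; rewrite fu0 linear0 => /esym/eqP; rewrite addr_eq0 => /eqP.
have := star_ge0 (triple_weight gt) (commx e u).
rewrite -dot_f -[commx f _]opprK -hu trformNl trformZl oppr_ge0.
rewrite pmulr_rle0 ?ltr0z // => le0.
have /(star_eq0 (triple_weight gt))/matrixP/(_ i j) : trform u (star u) = 0.
  by apply/eqP; rewrite eq_le le0 star_ge0 //; exact: (triple_weight gt).
by rewrite !mxE eqxx mulr1n => /eqP; rewrite (negbTE nz_v).
Qed.

(** Pairing [f, [e, u]] with [star u] gives |[e, u]|^2, so [e, u] = 0. Then t u = [e, [f, u]] and t
    |u|^2 = |[f, u]|^2, impossible for t < 0 unless u = 0. *)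
Lemma neg_inj t u : t < 0 -> homdeg t u -> commx f (commx e u) = 0 -> u = 0.
Proof.
move=> t_lt0 hu feu0; apply: (star_eq0 (triple_weight gt)).
have eu0 : commx e u = 0.
  by apply: (star_eq0 (triple_weight gt)); rewrite -dot_f feu0 trform0l.
have hu' : t%:~R *: u = commx e (commx f u).
  rewrite -(commx_h_homdeg hu) -(triple_ef gt).
  by rewrite commxJ eu0 linear0 addr0.
have := star_ge0 (triple_weight gt) (commx f u).
rewrite -dot_e -hu' trformZl nmulr_rge0 ?ltrz0 // => le0.
by apply/eqP; rewrite eq_le le0 star_ge0 //; exact: (triple_weight gt).
Qed.

(** The test vector is [star u]: since [star] exchanges e and f, it lies in the kernel of ad f. *)
Lemma centr_nondeg u : u \in z ->
  (forall v, v \in U -> commx f v = 0 -> trform u v = 0) -> u = 0.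
Proof.
rewrite memv_centr => /andP[Uu /eqP eu0] u0; apply: (star_eq0 (triple_weight gt)).
apply: u0; first exact: (triple_starP gt).
have := star_commx (triple_weight gt) u e; rewrite (triple_star gt) => <-.
by rewrite commxC eu0 oppr0 star0.
Qed.

Lemma kerf_nondeg v : v \in U -> commx f v = 0 ->
  (forall u, u \in z -> trform u v = 0) -> v = 0.
Proof.
move=> Uv fv0 v0; apply: (star_eq0 (triple_weight gt)); rewrite trformC.
apply: v0; rewrite memv_centr (triple_starP gt) //=.
have := star_commx (triple_weight gt) v f; rewrite star_f => <-.
by rewrite commxC fv0 oppr0 star0.
Qed.

Lemma homdeg_nondeg t u : u \in U -> homdeg t u ->
  (forall v, v \in U -> homdeg (- t) v -> trform u v = 0) -> u = 0.
Proof.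
move=> Uu hu u0; apply: (star_eq0 (triple_weight gt)).
by apply: u0; [exact: (triple_starP gt) | exact: star_homdeg].
Qed.

Lemma slice_nonpos X : slice U e f X -> supp_le 0 (X - e).
Proof. by case/sliceP => _ /kerf_nonpos. Qed.

Variable l : {vspace 'M[K]_k}.
Hypothesis lagr : lagrangian U e h l.

Lemma lagrangian_homdeg u : u \in l -> u \in U /\ homdeg (- 1) u.
Proof.
case: lagr => le_l _ lu; apply/memv_grade.
by rewrite rmorphN1; exact: (subvP le_l).
Qed.

Definition lower (i : nat) : {vspace 'M[K]_k} :=
  (\sum_(i <= j < k.*2) grade U h (- j%:R))%VS.

Lemma nilmE : nilm U h l = (lower 2 + l)%VS. Proof. by []. Qed.

Lemma lower_homdeg (i j : nat) u :
  (i <= j)%N -> u \in U -> homdeg (- j%:Z) u -> u \in lower i.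
Proof.
move=> le_ij Uu hu; have [lt_j|ge_j] := ltnP j k.*2; last first.
  suff -> : u = 0 by exact: mem0v.
  apply/matrixP => a b; rewrite [RHS]mxE; apply/eqP; apply: contraT => /hu.
  by have := triple_bound gt a b; lia.
have gu : u \in grade U h (- j%:R).
  by rewrite -[- j%:R]/(- (j%:Z)%:~R) -rmorphN /=; apply/memv_grade.
rewrite /lower big_geq_mkord; apply: subvP gu.
exact: (@sumv_sup _ _ _ (Ordinal lt_j)).
Qed.

Lemma memv_lower (i : nat) u : u \in lower i -> u \in U /\ supp_le (- i%:Z) u.
Proof.
rewrite /lower big_geq_mkord => /memv_sumP[w hw ->]; split.
  by apply: memv_suml => j /hw; rewrite memv_cap => /andP[].
apply: supp_le_sum => j le_ij; have := hw j le_ij.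
rewrite -[- j%:R]/(- (j%:Z)%:~R) -rmorphN /= => /memv_grade[_ hj].
by apply: supp_leW (homdeg_le hj); lia.
Qed.

(** Stability of [U] under [comp] is what allows an entrywise degree bound to be converted into a
    sum of graded pieces of [U]. *)
Lemma lower_supp (i : nat) u : u \in U -> supp_le (- i%:Z) u -> u \in lower i.
Proof.
move=> Uu su; rewrite (@comp_sum _ _ hh k.*2 u); last first.
  by move=> a b; apply/ltW/(triple_bound gt).
apply: memv_suml => j _; pose t := k.*2%:Z - j%:Z.
have [le_t|gt_t] := leP t (- i%:Z).
  apply: (@lower_homdeg _ (absz t)); [lia | exact: (triple_comp gt)|].
  rewrite (_ : - _ = t); last by lia.
  exact: comp_homdeg.
rewrite -/t (_ : comp t u = 0) ?mem0v //; apply/matrixP => a b; rewrite !mxE.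
have [->|/su le_ab] := eqVneq (u a b) 0; first by rewrite mul0rn.
by rewrite (_ : (_ == _) = false) //; apply/negP => /eqP; lia.
Qed.

Lemma memv_nilm u : u \in nilm U h l -> u \in U /\ supp_le (- 1) u.
Proof.
rewrite nilmE => /memv_addP[v /memv_lower[Uv sv] [w lw ->]].
have [Uw hw] := lagrangian_homdeg lw; split; first exact: memvD.
by apply: supp_leD (homdeg_le hw); apply: supp_leW sv.
Qed.

Lemma lower_nilm u : u \in lower 2 -> u \in nilm U h l.
Proof. by rewrite nilmE; apply: subvP; apply: addvSl. Qed.

Lemma lagr_nilm u : u \in l -> u \in nilm U h l.
Proof. by rewrite nilmE; apply: subvP; apply: addvSr. Qed.

(* Only the top component of xi and the point e of the slice contribute. *)
Lemma top_commx X t xi eta : slice U e f X -> supp_le t xi ->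
  homdeg (- (t + 2)) eta -> trform X (commx eta xi) = trform e (commx eta (comp t xi)).
Proof.
move=> SX sx he; have E : X = e + (X - e) by rewrite addrC subrK.
rewrite {1}E trformDl (trform_supp (slice_nonpos SX) (supp_le_commx (homdeg_le he) sx)).
  rewrite addr0; apply/eqP; rewrite -subr_eq0 -trformNr -trformDr -linearB /=.
  apply/eqP; apply: (trform_supp (homdeg_le (triple_deg gt))).
    apply: (supp_le_commx (homdeg_le he) (_ : supp_le (t - 1) (xi - comp t xi))).
    move=> i j; rewrite !mxE; have [E'|ne_t] := eqVneq (hh i - hh j) t.
      by rewrite mulr1n subrr eqxx.
    by rewrite subr0 => /sx; lia.
  lia.
lia.
Qed.

(* The conormal directions to the slice along which every function from m is
   preserved lie in m. *)
Lemma nilm_char X xi : slice U e f X -> xi \in U ->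
  (forall v, v \in U -> commx f v = 0 -> trform xi v = 0) ->
  (forall eta, eta \in nilm U h l -> trform X (commx eta xi) = 0) ->
  xi \in nilm U h l.
Proof.
move=> SX Uxi xi0 xiX.
(* The top component is orthogonal to ker ad f, and if every eta of degree -(t + 2) lies in m it
   also commutes with e. An element of the centralizer orthogonal to ker ad f is zero. *)
have top (t : int) : supp_le t xi ->
    (forall eta, eta \in U -> homdeg (- (t + 2)) eta -> eta \in nilm U h l) ->
    comp t xi = 0.
  move=> st sub_m; have Uu : comp t xi \in U by exact: (triple_comp gt).
  apply: centr_nondeg => [|v Uv fv0]; last first.
    rewrite trform_comp xi0 ?(triple_comp gt) //.
    by rewrite -(comp_commx _ _ triple_degf) fv0 linear0.
  rewrite memv_centr Uu; apply/eqP; apply: (@homdeg_nondeg (t + 2)).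
  - exact: (lieU (triple_mem gt)).
  - by have := homdeg_commx (triple_deg gt) (@comp_homdeg _ _ hh t xi); rewrite addrC.
  move=> eta Ueta he; rewrite trform_commx commxC trformNr -(top_commx SX st he).
  by rewrite xiX ?oppr0 // sub_m.
(* Descent from the largest possible degree: as long as the top degree t is at least 0, the degree
   -(t + 2) is at most -2, hence entirely contained in m. *)
have sup (N : nat) : supp_le (- 1 + (k.*2 - N)%:Z) xi.
  elim: N => [|N IHN].
    by move=> i j _; have := triple_bound gt i j; lia.
  have [le_kN|lt_Nk] := leqP k.*2 N; first by apply: supp_leW IHN; lia.
  have c0 : comp (- 1 + (k.*2 - N)%:Z) xi = 0.
    apply: top => // eta Ueta he; apply: lower_nilm.
    apply: (@lower_homdeg _ (k.*2 - N + 1)) => //; first by lia.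
    by move=> i j /he ->; lia.
  move=> i j nz; have := IHN i j nz.
  rewrite le_eqVlt => /orP[/eqP E|]; last by lia.
  have /matrixP/(_ i j) := c0; rewrite !mxE E eqxx mulr1n => /eqP.
  by rewrite (negbTE nz).
have {}sup : supp_le (- 1) xi by apply: supp_leW (sup k.*2); lia.
have Uu : comp (- 1) xi \in U by exact: (triple_comp gt).
(* In degree -1 only the eta in l are available as tests; orthogonality to l means membership in l,
   because l is Lagrangian. *)
have lu : comp (- 1) xi \in l.
  have gu : comp (- 1) xi \in grade U h (- 1).
    by apply/(@memv_grade (- 1)); split=> //; apply: comp_homdeg.
  case: lagr => _ /(_ _ gu) ->.
  move=> v lv; have [Uv hv] := lagrangian_homdeg lv.
  by rewrite commxC trformNr -(top_commx SX sup) ?xiX ?oppr0 // lagr_nilm.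
rewrite -[xi](subrK (comp (- 1) xi)); apply: memvD (lagr_nilm lu).
apply: lower_nilm.
apply: lower_supp => [|i j]; first exact: memvB.
rewrite !mxE; have [E'|ne_t] := eqVneq (hh i - hh j) (- 1).
  by rewrite mulr1n subrr eqxx.
by rewrite subr0 => /sup; lia.
Qed.

End Triple.
(** Leibniz step for the derivative of a power of y when the derivative of y is - x; below, y = - s
    and x = {w, s}. *)
Lemma derivX_step (R : comNzRingType) (x y : R) i :
  - x * y ^+ i.+1 + y * - (x * y ^+ i *+ i.+1) = - (x * y ^+ i.+1 *+ i.+2).
Proof.
by rewrite mulNr mulrN -opprD mulrnAr [_ *+ i.+2]mulrS exprS [y * (x * _)]mulrCA.
Qed.

(** One step of the telescoping in [liftable_add], with x = {eta, s} and y = - s: differentiating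
    the (i+1)-st term of the corrected sum gives a difference of consecutive terms, up to a multiple
    of x - 1. *)
Lemma dixmier_step (K : numFieldType) (S : comAlgType K)
    (x y B B' : S) (i : nat) :
  ((i.+1)`!%:R^-1 : K) *: (- (x * y ^+ i *+ i.+1) * B + y ^+ i.+1 * B') -
     ((i.+1)`!%:R^-1 *: (y ^+ i.+1 * B') - (i`!%:R^-1 : K) *: (y ^+ i * B)) =
  (- (i`!%:R^-1 : K)) *: (y ^+ i * B) * (x - 1).
Proof.
have nz : (i.+1%:R : K) != 0 by rewrite pnatr_eq0.
have E : ((i.+1)`!%:R^-1 : K) *: (- (x * y ^+ i *+ i.+1) * B) =
   - (i`!%:R^-1 *: (y ^+ i * B)) * x.
  rewrite mulNr scalerN mulrnAl -scaler_nat scalerA factS natrM invfM.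
  rewrite mulrAC mulVf // mul1r mulNr -scalerAl; congr (- (_ *: _)).
  by rewrite -mulrA mulrC.
by rewrite scalerDr E opprB addrACA subrr addr0 mulrBr mulr1 scaleNr opprK.
Qed.

Lemma commxDr (K : fieldType) k (A B C : 'M[K]_k) :
  commx A (B + C) = commx A B + commx A C.
Proof. exact: (raddfD (commx A)). Qed.

(** * Invariant extensions of functions on the slice *)

Section InvariantLift.
Variables (K : numClosedFieldType) (k : nat) (U : {vspace 'M[K]_k}).
Variables (e h f : 'M[K]_k) (hh : 'I_k -> int) (d : 'I_k -> K).
Hypothesis gt : graded_triple U e h f hh d.
Variable l : {vspace 'M[K]_k}.
Hypothesis lagr : lagrangian U e h l.
Local Notation S := (Sym (subvs_of U)).
Local Notation I := (@in_ideal K k U e h l).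
Local Notation D := (fun eta : subvs_of U => liebr (symg eta)).
Implicit Types (a b eta w s : subvs_of U) (F G : S) (X : 'M[K]_k).

Let lieU := triple_lie gt.

Lemma in_ideal0 : I 0.
Proof. by exists [::]; split=> //; rewrite big_nil. Qed.

Lemma in_idealD F G : I F -> I G -> I (F + G).
Proof.
move=> [r [hr ->]] [r' [hr' ->]]; exists (r ++ r'); split; last by rewrite big_cat.
by move=> p; rewrite mem_cat => /orP[/hr|/hr'].
Qed.

Lemma in_idealM F G : I G -> I (F * G).
Proof.
move=> [r [hr ->]]; exists [seq (F * p.1, p.2) | p <- r]; split.
  by move=> _ /mapP[p /hr hp ->].
by rewrite big_map mulr_sumr; apply: eq_bigr => p _; rewrite mulrA.
Qed.

Lemma in_idealN F : I F -> I (- F).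
Proof. by rewrite -mulN1r; apply: in_idealM. Qed.

Lemma in_idealMl F G : I F -> I (F * G).
Proof. by rewrite mulrC; apply: in_idealM. Qed.

Lemma in_ideal_sum (J : Type) (r : seq J) (P : pred J) (F : J -> S) :
  (forall j, P j -> I (F j)) -> I (\sum_(j <- r | P j) F j).
Proof. by move=> hF; apply: big_ind => //; [exact: in_ideal0 | exact: in_idealD]. Qed.

Lemma in_ideal_gen eta : vsval eta \in nilm U h l ->
  I (symg eta - (trform e (vsval eta))%:MP).
Proof.
move=> m_eta; exists [:: (1, eta)]; split; last by rewrite big_seq1 mul1r.
by move=> p; rewrite inE => /eqP ->.
Qed.

Lemma in_ideal_lower2 eta : vsval eta \in U -> supp_le hh (- 2) (vsval eta) ->
  I (symg eta - (trform e (vsval eta))%:MP).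
Proof. by move=> Ueta s2; apply/in_ideal_gen/(lower_nilm l)/(lower_supp gt). Qed.

(** On the slice X - e has degrees at most 0 and m has degrees at most -1, so an element of m takes
    at X the value that it takes at e. *)
Lemma in_ideal_fval F X : I F -> slice U e f X -> fval F X = 0.
Proof.
move=> [r [hr ->]] SX; rewrite fval_sum big_seq big1 // => p /hr/(memv_nilm gt lagr)[_ s1].
have XE : X = e + (X - e) by rewrite addrC subrK.
rewrite fvalM fvalB fval_symg fvalC [in X in _ * (X - _)]XE trformDr.
rewrite (trform_supp s1 (slice_nonpos gt SX)) // addr0 trformC subrr mulr0 //.
Qed.

Lemma nilm_lie a b : vsval a \in nilm U h l -> vsval b \in nilm U h l ->
  vsval (lie a b) \in lower U h 2.
Proof.
move=> /(memv_nilm gt lagr)[_ sa] /(memv_nilm gt lagr)[_ sb].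
apply: (lower_supp gt); first exact: subvsP.
by rewrite (vsval_lie lieU); apply: (supp_le_commx sa sb).
Qed.

(* The character (e, .) vanishes on [m, m]: either the degree of the bracket is
   less than - 2, or both arguments are in the Lagrangian. *)
Lemma nilm_char_lie a b : vsval a \in nilm U h l -> vsval b \in nilm U h l ->
  trform e (vsval (lie a b)) = 0.
Proof.
rewrite (vsval_lie lieU) nilmE.
case/memv_addP => u /(memv_lower gt)[Uu su] [v lv ->].
case/memv_addP => u' /(memv_lower gt)[Uu' su'] [v' lv' ->].
have [Uv hv] := lagrangian_homdeg gt lagr lv.
have [Uv' hv'] := lagrangian_homdeg gt lagr lv'.
have he := homdeg_le (triple_deg gt).
have gv : v \in grade U h (- 1) by apply/(memv_grade gt (- 1)).
rewrite commxDl trformDr !commxDr (trformDr _ (commx u u')) (trformDr _ (commx v u')).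
rewrite (trform_supp he (supp_le_commx su su')) //.
rewrite (trform_supp he (supp_le_commx su (homdeg_le hv'))) //.
rewrite (trform_supp he (supp_le_commx (homdeg_le hv) su')) //.
by case: lagr => _ /(_ v gv)[/(_ lv) -> //]; rewrite !addr0.
Qed.

(** The ideal is stable under ad m because the character defining it vanishes on [m, m]. *)
Lemma in_ideal_liebr eta F : vsval eta \in nilm U h l -> I F -> I (D eta F).
Proof.
move=> m_eta [r [hr ->]]; rewrite raddf_sum big_seq; apply: in_ideal_sum => p /hr hp.
rewrite /= /liebr symbrM; apply: in_idealD; first exact/in_idealM/in_ideal_gen.
apply: in_idealM; rewrite raddfB /= symbrC subr0 -/(liebr _ _) (liebr_symg lieU).
rewrite -[symg _]subr0 -mpolyC0 -(nilm_char_lie m_eta hp).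
exact/in_ideal_gen/lower_nilm/nilm_lie.
Qed.

Lemma liebrM F G G' : liebr F (G * G') = liebr F G * G' + G * liebr F G'.
Proof. exact: symbrM. Qed.

Lemma liebr_symgD a b F : D (a + b) F = D a F + D b F.
Proof.
rewrite /= /liebr /symbr -big_split; apply: eq_bigr => i _ /=.
rewrite -big_split; apply: eq_bigr => j _ /=.
by rewrite linearD /= mderivD mulrDr mulrDl.
Qed.

Lemma liebr_symgZ t a F : D (t *: a) F = t *: D a F.
Proof.
rewrite /= /liebr /symbr scaler_sumr; apply: eq_bigr => i _ /=.
rewrite scaler_sumr; apply: eq_bigr => j _ /=.
by rewrite linearZ /= mderivZ -scalerAr -scalerAl.
Qed.

Lemma iter_liebr0 eta n : iter n (D eta) 0 = 0.
Proof. by elim: n => //= n ->; rewrite raddf0. Qed.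

Lemma iter_liebrD eta n F G :
  iter n (D eta) (F + G) = iter n (D eta) F + iter n (D eta) G.
Proof. by elim: n => //= n ->; rewrite raddfD. Qed.

Lemma iter_liebr_le eta n n' F : (n <= n')%N ->
  iter n (D eta) F = 0 -> iter n' (D eta) F = 0.
Proof. by move=> le_n F0; rewrite -(subnK le_n) iterD F0 iter_liebr0. Qed.

Lemma iter_liebrM eta n n' F G : iter n (D eta) F = 0 -> iter n' (D eta) G = 0 ->
  iter (n + n') (D eta) (F * G) = 0.
Proof.
have [N le_N] := ubnP (n + n')%N.
elim: N n n' F G le_N => // N IHN [|n] [|n'] F G le_N.
- by move=> /= -> _; rewrite mul0r.
- by move=> F0 _; rewrite (F0 : F = 0) mul0r iter_liebr0.
- by move=> _ G0; rewrite (G0 : G = 0) mulr0 iter_liebr0.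
move=> F0 G0; rewrite addSn iterSr liebrM iter_liebrD.
have F0' := F0; have G0' := G0; rewrite !iterSr in F0' G0'.
have -> : iter (n + n'.+1) (D eta) (D eta F * G) = 0 by apply: IHN => //; lia.
by rewrite add0r addnS -addSn; apply: IHN => //; lia.
Qed.

(** On linear functions ad eta lowers the degree by at least 1, hence is nilpotent; the Leibniz rule
    extends this to each polynomial, with an exponent depending on it. *)
Lemma iter_liebr_nil eta F : vsval eta \in nilm U h l ->
  exists n, iter n (D eta) F = 0.
Proof.
move=> /(memv_nilm gt lagr)[_ s1].
have nilX i : exists n, iter n (D eta) ('X_i : S) = 0.
  have supp n : exists2 u : subvs_of U, iter n (D eta) ('X_i) = symg u
      & supp_le hh (k.*2%:Z - n%:Z) (vsval u).
    elim: n => [|n [u /= -> su]].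
      exists (symb i); first by rewrite symg_symb.
      by move=> a b _; have := triple_bound gt a b; lia.
    exists (lie eta u); first by rewrite (liebr_symg lieU).
    by rewrite (vsval_lie lieU); apply: supp_leW (supp_le_commx s1 su); lia.
  (* Degrees lie strictly between -2k and 2k, so 4k steps leave nothing. *)
  have [u Eu su] := supp (4 * k)%N; exists (4 * k)%N; rewrite Eu.
  rewrite (_ : u = 0) ?raddf0 //; apply: vsval_inj; rewrite raddf0.
  apply/matrixP => a b; rewrite [RHS]mxE; apply/eqP; apply: contraT => /su.
  by have := triple_bound gt a b; lia.
pose P F := exists n, iter n (D eta) F = 0.
have PC c : P c%:MP by exists 1%N; rewrite /= /liebr symbrC.
have PM F' G : P F' -> P G -> P (F' * G).
  by move=> [n Fn] [n' Gn]; exists (n + n')%N; apply: iter_liebrM.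
elim/mpolyind: F => [|c m F _ _ [n PF]]; first by rewrite -mpolyC0; apply: (PC).
have [n' Pm] : P (c *: 'X_[m]).
  rewrite -mul_mpolyC; apply: (PM) => //; rewrite mpolyXE_id.
  apply: (big_ind P) => [|a b|i _]; [by rewrite -mpolyC1 | exact: (PM) |].
  elim: (m i) => [|t IHt]; first by rewrite expr0 -mpolyC1.
  by rewrite exprS; apply: (PM) => //; exact: nilX.
exists (maxn n n'); rewrite iter_liebrD (iter_liebr_le _ PF) ?leq_maxl //.
by rewrite (iter_liebr_le _ Pm) ?leq_maxr // addr0.
Qed.

(* Every function on the slice extends to an element of S(g) invariant under W
   modulo the ideal of m. *)
Definition liftable (W : {vspace 'M[K]_k}) : Prop := forall F : S, exists F' : S,
  (forall X, slice U e f X -> fval F' X = fval F X) /\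
  (forall w, vsval w \in W -> I (D w F')).

(** The device of Dixmier for a derivation with a slice: s behaves as a coordinate along eta, and
    sum_i (-s)^i / i! (ad eta)^i F is annihilated by eta modulo the ideal. Values on the slice do
    not change, since s vanishes there; the invariance under [W] survives because {w, s} is in the
    ideal and [w, eta] stays in [W]. *)
Lemma liftable_add (W : {vspace 'M[K]_k}) eta s :
  liftable W -> (W <= nilm U h l)%VS -> vsval eta \in nilm U h l ->
  (forall X, slice U e f X -> trform (vsval s) X = 0) ->
  I (symg (lie eta s) - 1) ->
  (forall w, vsval w \in W -> I (symg (lie w s))) ->
  (forall w, vsval w \in W -> vsval (lie w eta) \in W) ->
  liftable (W + <[vsval eta]>).
Proof.
move=> liftW Wm m_eta s_slice eta_s W_s W_eta F.
have [F1 [F1_F F1_W]] := liftW F; have [N DN] := iter_liebr_nil F1 m_eta.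
(* The iterates remain invariant under [W]: exchange w and eta by the Jacobi identity; the
   correction term [w, eta] is again in [W]. *)
have DW i w : vsval w \in W -> I (D w (iter i (D eta) F1)).
  elim: i w => [|i IHi] w Ww /=; first exact: F1_W.
  have -> : liebr (symg w) (liebr (symg eta) (iter i (D eta) F1)) =
      D eta (D w (iter i (D eta) F1)) + D (lie w eta) (iter i (D eta) F1).
    by rewrite /= (liebr_jacobi lieU) addrC subrK.
  apply: in_idealD; first by apply: in_ideal_liebr => //; exact: IHi.
  exact/IHi/W_eta.
pose T (i : nat) := (i`!%:R^-1 : K) *: ((- symg s) ^+ i * iter i (D eta) F1).
pose A (i : nat) := (i`!%:R^-1 : K) *: ((- symg s) ^+ i * iter i.+1 (D eta) F1).
have idealZ (t : K) G : I G -> I (t *: G).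
  by move=> IG; rewrite -mul_mpolyC; apply: in_idealM.
have DX w i : D w ((- symg s) ^+ i.+1) =
    - (symg (lie w s) * (- symg s) ^+ i *+ i.+1).
  elim: i => [|i IHi].
    by rewrite expr1 expr0 mulr1 /= raddfN /= (liebr_symg lieU).
  rewrite exprS /= liebrM -/(D w _) IHi raddfN /= (liebr_symg lieU).
  exact: derivX_step.
exists (\sum_(i < N) T i); split=> [X SX|v].
  case: N DN => [F10|N _]; first by rewrite big_ord0 -F1_F // -F10.
  rewrite big_ord_recl fvalD {1}/T fact0 invr1 scale1r expr0 mul1r /= F1_F //.
  rewrite fval_sum big1 ?addr0 // => i _; rewrite /T fvalZ fvalM.
  rewrite /bump add1n exprS !fvalM -scaleN1r fvalZ fval_symg s_slice //.
  by rewrite !(mulr0, mul0r).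
case/memv_addP => w Ww [_ /vlineP[t ->] def_v].
have {def_v} -> : v = vsproj U w + t *: eta.
  apply: vsval_inj; rewrite linearD linearZ /= vsprojK //.
  by have := subvP Wm _ Ww => /(memv_nilm gt lagr)[].
have UW : vsval (vsproj U w) = w.
  by rewrite vsprojK //; have := subvP Wm _ Ww => /(memv_nilm gt lagr)[].
rewrite -UW in Ww; move: (vsproj U w) Ww => {UW v}w Ww.
rewrite -/(D _ _) liebr_symgD liebr_symgZ; apply: in_idealD.
  rewrite /= raddf_sum; apply: in_ideal_sum => i _; rewrite /T /= linearZ /=.
  apply: idealZ; rewrite liebrM; apply: in_idealD; last first.
    exact/in_idealM/DW.
  case: (nat_of_ord i) => [|j].
    by rewrite expr0 -mpolyC1 /liebr symbrC mul0r; apply: in_ideal0.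
  rewrite -/(D w _) DX mulNr; apply: in_idealN; rewrite -mulr_natr -!mulrA.
  by apply: in_idealMl; apply: W_s.
apply: idealZ; rewrite /= raddf_sum /=.
have step (i : nat) :
    I (D eta (T i) - (A i - (if i is j.+1 then A j else 0))).
  rewrite /T /A /= linearZ /= liebrM -/(D eta _).
  case: i => [|i].
    rewrite expr0 -mpolyC1 /= /liebr symbrC mul0r add0r subr0 subrr.
    exact: in_ideal0.
  rewrite -/(D eta _) DX.
  by rewrite /= dixmier_step; apply: in_idealM.
(* The subtracted terms telescope to the last [A], which contains the vanishing iterate of order
   [N]. *)
have -> : \sum_(i < N) liebr (symg eta) (T i) =
    \sum_(i < N) (D eta (T i) - (A i - (if i : nat is j.+1 then A j else 0))).
  rewrite sumrB (_ : \sum_(i < N) (A i - _) = 0) ?subr0 //.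
  case: N DN => [|N] DN; first by rewrite big_ord0.
  have -> // : \sum_(i < N.+1) (A i - (if i : nat is j.+1 then A j else 0)) = A N.
    elim: N {DN} => [|N IHN]; first by rewrite big_ord_recl big_ord0 subr0 addr0.
    by rewrite big_ord_recr /= IHN addrC subrK.
  by rewrite /A DN mulr0 scaler0.
by apply: in_ideal_sum => i _; apply: step.
Qed.

End InvariantLift.

(** * The partners s, and the induction over the degrees of m *)

Section LiftExists.
Variables (K : numClosedFieldType) (k : nat) (U : {vspace 'M[K]_k}).
Variables (e h f : 'M[K]_k) (hh : 'I_k -> int) (d : 'I_k -> K).
Hypothesis gt : graded_triple U e h f hh d.
Variable l : {vspace 'M[K]_k}.
Hypothesis lagr : lagrangian U e h l.
Local Notation liftable := (@liftable K k U e h f l).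
Local Notation lower := (lower U h).
Local Notation homdeg := (homdeg hh).
Local Notation supp_le := (supp_le hh).

Let lieU := triple_lie gt.
Let Ue := triple_mem gt.
Let Uf : f \in U. Proof. by rewrite -(triple_star gt) (triple_starP gt). Qed.

(** By invariance of the trace form the pairing equals - ([f, [e, v]], w). It is nondegenerate in v
    because ad f ad e is injective in negative degrees and opposite degrees are dual to each other.
    The vector [f, w] is the partner s. *)
Lemma dual_vector (V : {vspace 'M[K]_k}) (tau : nat) (phi : 'M[K]_k -> K) :
  (0 < tau)%N -> (forall v, v \in V -> v \in U /\ homdeg (- tau%:Z) v) ->
  scalar phi ->
  exists w, [/\ w \in U, homdeg tau%:Z w
    & forall v, v \in V -> trform e (commx v (commx f w)) = phi v].
Proof.
move=> tau_gt0 hV phil; pose G := grade U h (tau%:Z)%:~R.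
pose B (v : subvs_of V) (w : subvs_of G) :=
  trform e (commx (vsval v) (commx f (vsval w))).
have [||||w hw] := @pairing_repr _ _ _ B (fun v => phi (vsval v)).
- move=> w t u v; rewrite /B linearP /= commxDl commxZl.
  by rewrite trformDr trformZr.
- by move=> w t u v; rewrite /B !linearP /= trformDr trformZr.
- by move=> t u v; rewrite linearP /= phil.
- move=> v v0; apply: vsval_inj; rewrite raddf0.
  have [Uv hv] := hV _ (subvsP v).
  apply: (neg_inj gt _ hv); first by lia.
  have deg : homdeg (- tau%:Z) (commx f (commx e (vsval v))).
    have := homdeg_commx (triple_degf gt) (homdeg_commx (triple_deg gt) hv).
    by move=> H i j /H ->; lia.
  apply: (homdeg_nondeg gt _ deg); first by apply/lieU/lieU.
  move=> u Uu hu; have gu : u \in G.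
    by apply/(memv_grade gt); split=> // i j /hu ->; lia.
  have := v0 (vsproj G u); rewrite /B vsprojK // -trform_commx => E.
  by rewrite commxC trformNl trform_commx E oppr0.
have [Uw hw'] : vsval w \in U /\ homdeg tau%:Z (vsval w).
  exact/(memv_grade gt)/subvsP.
exists (vsval w); split=> // v Vv.
by have := hw (vsproj V v); rewrite /B vsprojK.
Qed.

(** A basis of [V] is adjoined vector by vector. The partner of the j-th one is dual to the j-th
    coordinate, so its bracket has character 1 with that vector and 0 with the preceding ones; with
    [W] the character is 0 by degree. *)
Lemma liftable_level (W V : {vspace 'M[K]_k}) (tau : nat) :
  (0 < tau)%N -> liftable W -> (W <= nilm U h l)%VS -> (V <= nilm U h l)%VS ->
  (forall v, v \in V -> homdeg (- tau%:Z) v) ->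
  (forall w, w \in W -> supp_le (- tau%:Z - 1) w) ->
  (forall u v, u \in V -> v \in V -> commx u v \in W) ->
  (forall w v, w \in W -> v \in V -> commx w v \in W) ->
  liftable (W + V).
Proof.
move=> tau_gt0 liftW Wm Vm hV sW VV_W WV_W.
have deg1 : 2 + (- tau%:Z - 1 + (tau%:Z - 2)) < 0 by lia.
have deg2 : - tau%:Z - 1 <= - tau%:Z by lia.
have UV v : v \in V -> v \in U by move=> /(subvP Vm)/(memv_nilm gt lagr)[].
have UW v : v \in W -> v \in U by move=> /(subvP Wm)/(memv_nilm gt lagr)[].
have /span_basis <- := vbasisP V.
rewrite -[X in <<X>>%VS]take_size.
suff: forall j, (j <= size (vbasis V))%N -> liftable (W + <<take j (vbasis V)>>).
  exact.
elim=> [|j IHj] lt_j; first by rewrite take0 span_nil addv0.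
rewrite (take_nth 0) // -cats1 span_cat span_seq1 addvA.
set b := (vbasis V)`_j; have Vb : b \in V by apply: vbasis_mem; rewrite mem_nth.
have {}lt_j' : (j < \dim V)%N by rewrite -(size_tuple (vbasis V)).
pose phi : {linear 'M[K]_k -> K^o} := coord (vbasis V) (Ordinal lt_j').
have phib : phi b = 1.
  have := @coord_free _ _ _ (vbasis V) (Ordinal lt_j') (Ordinal lt_j').
  by rewrite eqxx; apply; apply/basis_free/vbasisP.
have le_takeV : (<<take j (vbasis V)>> <= V)%VS.
  by apply/span_subvP => v /mem_take /vbasis_mem.
have phi0 v : v \in <<take j (vbasis V)>>%VS -> phi v = 0.
  suff /subvP le0 : (<<take j (vbasis V)>> <= lker (linfun phi))%VS.
    by move/le0; rewrite memv_ker lfunE => /eqP.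
  apply/span_subvP => u tu; rewrite -(nth_index 0 tu).
  move: tu; rewrite -index_mem size_takel ?(ltnW lt_j) //; move: (index _ _) => i lt_ij.
  rewrite nth_take // memv_ker lfunE /=; apply/eqP.
  have := @coord_free _ _ _ (vbasis V) (Ordinal (ltn_trans lt_ij lt_j')) (Ordinal lt_j').
  by rewrite -val_eqE /= (ltn_eqF lt_ij); apply; apply/basis_free/vbasisP.
have phil : scalar phi by move=> t u v; rewrite linearP.
have [w [Uw hw Ew]] :=
  dual_vector tau_gt0 (fun v Vv => conj (UV v Vv) (hV v Vv)) phil.
have Us : commx f w \in U by apply: lieU.
have hs : homdeg (tau%:Z - 2) (commx f w).
  by have := homdeg_commx (triple_degf gt) hw; rewrite addrC.
have Ub := UV _ Vb; have hb := hV _ Vb.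
have [sE bE] : vsval (vsproj U (commx f w)) = commx f w /\ vsval (vsproj U b) = b.
  by rewrite !vsprojK.
have supp2 v : supp_le (- tau%:Z) v -> supp_le (- 2) (commx v (commx f w)).
  move=> sv; have -> : (- 2 = - tau%:Z + (tau%:Z - 2))%R by rewrite addrA addNr add0r.
  exact: supp_le_commx sv (homdeg_le hs).
rewrite -bE; apply: (@liftable_add K k U e h f hh d gt l lagr _ _ (vsproj U (commx f w))).
- by apply: IHj; apply: ltnW.
- by rewrite subv_add Wm (subv_trans le_takeV).
- by rewrite bE (subvP Vm).
(* The value at X is ([f, w], X - e) + ([f, w], e): the first term vanishes as X - e commutes with
   f, the second is (w, h), zero since w has positive degree. *)
- move=> X SX; have [_ fX] := (sliceP U e f X).1 SX.
  rewrite sE -[X](subrK e) trformDr commxC !trformNl !trform_commx fX trform0r.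
  rewrite commxC trformNr (triple_ef gt) opprK oppr0 add0r.
  have h0 : homdeg 0 h.
    move=> a c; rewrite (triple_h gt); have [->|_] := eqVneq a c.
      by rewrite subrr.
    by rewrite mulr0n eqxx.
  by apply: (trform_homdeg hw h0); rewrite addr0 -lt0n.
(* The bracket of b with s has degree -2, so modulo the ideal it equals its character, the
   coordinate of b. *)
- have E1 : trform e (vsval (lie (vsproj U b) (vsproj U (commx f w)))) = 1.
    by rewrite (vsval_lie lieU) bE sE Ew.
  rewrite -mpolyC1 -E1.
  apply: (in_ideal_lower2 gt); first exact: subvsP.
  by rewrite (vsval_lie lieU) bE sE; apply/supp2/homdeg_le.
- move=> x /memv_addP[u Wu [v tv Ex]].
  have Vv := subvP le_takeV _ tv.
  have E0 : trform e (vsval (lie x (vsproj U (commx f w)))) = 0.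
    rewrite (vsval_lie lieU) sE Ex commxDl trformDr (Ew v Vv) phi0 // addr0.
    apply: (trform_supp (homdeg_le (triple_deg gt)) (supp_le_commx (sW _ Wu) (homdeg_le hs))).
    exact: deg1.
  rewrite -[symg _]subr0 -mpolyC0 -E0; apply: (in_ideal_lower2 gt).
    exact: subvsP.
  rewrite (vsval_lie lieU) sE; apply: supp2; rewrite Ex; apply: supp_leD.
    exact: supp_leW deg2 (sW _ Wu).
  exact/homdeg_le/hV.
move=> x /memv_addP[u Wu [v tv Ex]].
rewrite (vsval_lie lieU) bE Ex commxDl; apply: (subvP (addvSl _ _)).
by apply: memvD; [exact: WV_W | apply: VV_W => //; exact: (subvP le_takeV)].
Qed.

(** Downward induction on i: the lowest degrees come first because the space already treated has to
    be normalized by the degree added to it. *)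
Lemma liftable_lower (i : nat) : (1 < i)%N -> liftable (lower i).
Proof.
have [n le_n] : exists n, (k.*2 - i <= n)%N by exists (k.*2 - i)%N.
elim: n i le_n => [|n IHn] i le_n i_gt1.
  rewrite /lower big_geq; last by lia.
  move=> F; exists F; split=> // w; rewrite memv0 => /eqP w0.
  have -> : w = 0 by apply: vsval_inj; rewrite w0 raddf0.
  by rewrite -(scale0r w) liebr_symgZ scale0r; apply: in_ideal0.
have [ge_i|lt_i] := leqP k.*2 i; first by apply: IHn => //; lia.
have -> : lower i = (lower i.+1 + grade U h (- i%:R))%VS.
  by rewrite /lower big_ltn // addvC.
have gE v : v \in grade U h (- i%:R) -> v \in U /\ homdeg (- i%:Z) v.
  by move=> gv; apply/(memv_grade gt); rewrite rmorphN.
have low2 j v : (1 < j)%N -> v \in lower j -> v \in nilm U h l.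
  move=> j_gt1 /(memv_lower gt)[Uv sv]; apply: lower_nilm.
  by apply: (lower_supp gt) => //; apply: supp_leW sv; lia.
apply: (@liftable_level _ _ i).
- by lia.
- by apply: IHn; lia.
- by apply/subvP => v; apply: low2; lia.
- apply/subvP => v /gE[Uv hv]; apply: (low2 i) => //.
  exact: (lower_homdeg gt _ Uv hv).
- by move=> v /gE[].
- by move=> w /(memv_lower gt)[_ sw]; apply: supp_leW sw; lia.
- move=> u v /gE[Uu hu] /gE[Uv hv]; apply: (lower_supp gt); first exact: lieU.
  by apply: supp_leW (supp_le_commx (homdeg_le hu) (homdeg_le hv)); lia.
move=> u v /(memv_lower gt)[Uu su] /gE[Uv hv]; apply: (lower_supp gt).
  exact: lieU.
by apply: supp_leW (supp_le_commx su (homdeg_le hv)); lia.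
Qed.

(** The Lagrangian l is the last level, with tau = 1; brackets of its elements fall into degree -2,
    already treated. *)
Lemma invariant_lift (F : Sym (subvs_of U)) : exists F' : Sym (subvs_of U),
  ad_invariant e h l F' /\ (forall X, slice U e f X -> fval F' X = fval F X).
Proof.
have hl v : v \in l -> v \in U /\ homdeg (- 1) v := lagrangian_homdeg gt lagr (u := v).
have : liftable (lower 2 + l).
  apply: (@liftable_level _ _ 1) => //.
  - exact: liftable_lower.
  - by apply/subvP => v; apply: lower_nilm.
  - by apply/subvP => v; apply: lagr_nilm.
  - by move=> v /hl[].
  - by move=> w /(memv_lower gt)[_ sw]; apply: supp_leW sw; lia.
  - move=> u v /hl[Uu hu] /hl[Uv hv]; apply: (lower_supp gt); first exact: lieU.
    exact: (supp_le_commx (homdeg_le hu) (homdeg_le hv)).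
  move=> u v /(memv_lower gt)[Uu su] /hl[Uv hv]; apply: (lower_supp gt).
    exact: lieU.
  by apply: supp_leW (supp_le_commx su (homdeg_le hv)).
by move=> /(_ F)[F' [F'F F'inv]]; exists F'; split.
Qed.

End LiftExists.
Section CommutatorRight.
Variables (K : fieldType) (k : nat).
Implicit Types A B C : 'M[K]_k.

Lemma commx0r A : commx A 0 = 0.
Proof. exact: (raddf0 (commx A)). Qed.

Lemma commxZr a A B : commx A (a *: B) = a *: commx A B.
Proof. by rewrite -[commx A _]/((commx A : {linear _ -> _}) _) linearZ. Qed.

Lemma commxBr A B C : commx A (B - C) = commx A B - commx A C.
Proof. exact: (raddfB (commx A)). Qed.

Lemma commx_sumr I (s : seq I) (P : pred I) (F : I -> 'M[K]_k) A :
  commx A (\sum_(i <- s | P i) F i) = \sum_(i <- s | P i) commx A (F i).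
Proof. exact: (raddf_sum (commx A)). Qed.

Lemma trformBr A B C : trform A (B - C) = trform A B - trform A C.
Proof. by rewrite trformDr trformNr. Qed.

Lemma trformBl A B C : trform (A - B) C = trform A C - trform B C.
Proof. by rewrite trformDl trformNl. Qed.

End CommutatorRight.

Lemma trform_vsval_sum (K : fieldType) k (U : {vspace 'M[K]_k}) I (r : seq I)
    (P : pred I) (a : I -> K) (u : I -> subvs_of U) v :
  trform (vsval (\sum_(i <- r | P i) a i *: u i)) v =
  \sum_(i <- r | P i) a i * trform (vsval (u i)) v.
Proof.
rewrite [vsval _]linear_sum trform_suml /=; apply: eq_bigr => i _.
by rewrite trformZl.
Qed.

Lemma trform_grad (K : fieldType) k (U : {vspace 'M[K]_k}) (F : Sym (subvs_of U)) X v :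
  trform (vsval (grad X F)) v =
  \sum_i fval F^`M(i) X * trform (vsval (symb i : subvs_of U)) v.
Proof. exact: trform_vsval_sum. Qed.

(** * The Poisson bracket of the slice *)

Section SliceFunctions.
Variables (K : numClosedFieldType) (k : nat) (U : {vspace 'M[K]_k}).
Variables (e h f : 'M[K]_k) (hh : 'I_k -> int) (d : 'I_k -> K).
Hypothesis gt : graded_triple U e h f hh d.
Local Notation z := (centr U e).
Local Notation T := (subvs_of z).
Local Notation S := (Sym T).
Local Notation N := (\dim {:T}).

Let lieU := triple_lie gt.

Lemma kerf_dual_basis : exists v : 'I_N -> 'M[K]_k,
  (forall i, v i \in U /\ commx f (v i) = 0) /\
  (forall i j, trform (vsval (symb j : T)) (v i) = (j == i)%:R).
Proof.
pose G := (U :&: lker (linfun (commx f)))%VS.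
have GP u : u \in G -> u \in U /\ commx f u = 0.
  by rewrite memv_cap memv_ker lfunE => /andP[-> /eqP].
have dual i : exists w : 'M[K]_k, (w \in U /\ commx f w = 0) /\
    forall j, trform (vsval (symb j : T)) w = (j == i)%:R.
  pose B (u : T) (w : subvs_of G) := trform (vsval u) (vsval w).
  have [||||w hw] := @pairing_repr _ _ _ B (coord (vbasis {:T}) i).
  - by move=> w t u u'; rewrite /B linearP /= trformDl trformZl.
  - by move=> u t w w'; rewrite /B linearP /= trformDr trformZr.
  - by move=> t u u'; rewrite linearP.
  - move=> u u0; apply: vsval_inj; rewrite raddf0.
    apply: (centr_nondeg gt (subvsP u)) => w Uw fw0.
    have Gw : w \in G by rewrite memv_cap Uw memv_ker lfunE; apply/eqP.
    by have := u0 (vsproj G w); rewrite /B vsprojK.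
  exists (vsval w); split; first exact/GP/subvsP.
  by move=> j; have := hw (symb j); rewrite /B coord_symb eq_sym.
have [v hv] := fin_all_exists dual.
by exists v; split=> [i|i j]; have [h1 h2] := hv i.
Qed.

Lemma mem_slice X v : slice U e f X -> v \in U -> commx f v = 0 ->
  slice U e f (X + v).
Proof.
move=> /sliceP[UX fX] Uv fv; apply/sliceP; rewrite addrAC memvD //.
by rewrite commxDr fX fv addr0.
Qed.

Lemma slice_e : slice U e f e.
Proof. by apply/sliceP; rewrite subrr mem0v commx0r. Qed.

(** The coordinates given by a basis of the centralizer take arbitrary values on the slice, thanks
    to the dual basis of ker ad f. So equality on the slice is equality of polynomial functions. *)
Lemma slice_fun_inj (p q : S) :
  (forall X, slice U e f X -> fval p X = fval q X) -> p = q.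
Proof.
move=> pq; apply/eqP; rewrite -subr_eq0; apply/eqP/mpoly_fun_eq0 => phi.
have [v [kerv dualv]] := kerf_dual_basis.
pose c i := phi i - trform (vsval (symb i : T)) e.
pose X := e + \sum_i c i *: v i.
have SX : slice U e f X.
  apply: mem_slice slice_e _ _.
    by apply: memv_suml => i _; apply: memvZ; case: (kerv i).
  rewrite commx_sumr big1 // => i _; rewrite commxZr.
  by have [_ ->] := kerv i; rewrite scaler0.
have Xphi i : trform (vsval (symb i : T)) X = phi i.
  rewrite trformDr trform_sumr (bigD1 i) //= trformZr dualv eqxx mulr1.
  rewrite big1 ?addr0 => [|j ne_j]; first by rewrite addrC subrK.
  by rewrite trformZr dualv eq_sym (negbTE ne_j) mulr0.
have := pq X SX => /eqP; rewrite -subr_eq0 -fvalB => /eqP <-.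
by apply: meval_eq => i; rewrite Xphi.
Qed.

(* The tautological point of the slice with values in its coordinate ring. *)
Lemma universal_point : exists Y : 'M[S]_k,
  (forall X, slice U e f X -> forall a b, fval (Y a b) X = X a b) /\
  (forall X v, v \in U -> commx f v = 0 -> forall a b,
    \sum_i fval (Y a b)^`M(i) X * trform (vsval (symb i : T)) v = v a b).
Proof.
have [v [kerv dualv]] := kerf_dual_basis.
(* The coordinates of X - e with respect to the dual basis [v]; the constant is the value at the
   base point e. *)
pose c i : S := 'X_i - (trform (vsval (symb i : T)) e)%:MP.
exists (\matrix_(a, b) ((e a b)%:MP + \sum_i v i a b *: c i)).
have expand w : w \in U -> commx f w = 0 ->
    \sum_i trform (vsval (symb i : T)) w *: v i = w.
  move=> Uw fw0; apply/eqP; rewrite eq_sym -subr_eq0; apply/eqP.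
  have Uv i : v i \in U by case: (kerv i).
  apply: (kerf_nondeg gt).
  - by apply: memvB => //; apply: memv_suml => i _; apply: memvZ.
  - rewrite commxBr fw0 commx_sumr big1 ?subr0 // => i _.
    by rewrite commxZr; have [_ ->] := kerv i; rewrite scaler0.
  move=> u zu; have -> : u = vsval (vsproj z u) by rewrite vsprojK.
  rewrite (coord_vbasis (memvf (vsproj z u))) raddf_sum trform_suml big1 //= => j _.
  rewrite trformZl -/(symb j) trformBr trform_sumr.
  rewrite (bigD1 j) //= trformZr dualv eqxx mulr1 big1 ?addr0 ?subrr ?mulr0 //.
  by move=> i ne_i; rewrite trformZr dualv eq_sym (negbTE ne_i) mulr0.
split=> [X SX a b|X w Uw fw0 a b].
  have [UX fX] := (sliceP U e f X).1 SX.
  have := expand _ UX fX => /matrixP/(_ a b); rewrite summxE !mxE => E.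
  rewrite fvalD fvalC fval_sum -[X a b](subrK (e a b)) [RHS]addrC; congr (_ + _).
  rewrite -[RHS]E; apply: eq_bigr => i _; rewrite mxE mulrC fvalZ; congr (_ * _).
  by rewrite fvalB fvalC -symg_symb fval_symg trformBr.
have /matrixP/(_ a b) := expand w Uw fw0; rewrite summxE => <-.
apply: eq_bigr => i _; rewrite !mxE mulrC; congr (_ * _).
rewrite mderivD mderivC add0r raddf_sum /= (bigD1 i) //= big1 => [|j ne_j].
  rewrite mderivZ /c mderivB mderivC subr0 -symg_symb mderiv_symg coord_symb eqxx.
  by rewrite addr0 fvalZ fvalC mulr1.
rewrite mderivZ /c mderivB mderivC subr0 -symg_symb mderiv_symg coord_symb.
by rewrite eq_sym (negbTE ne_j) mpolyC0 scaler0.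
Qed.

(** Replaces calculus: two functions agreeing along a line have the same polynomial on it, hence
    gradients with the same pairing against the direction. *)
Lemma fval_line (U' : {vspace 'M[K]_k}) (F : Sym (subvs_of U')) (X v : 'M[K]_k) :
  exists2 q : {poly K}, (forall t, q.[t] = fval F (X + t *: v))
    & q^`().[0] = trform (vsval (grad X F)) v.
Proof.
pose w i : {poly K} := (trform (vsval (symb i : subvs_of U')) X)%:P +
  trform (vsval (symb i : subvs_of U')) v *: 'X.
pose phi : {rmorphism {mpoly K[\dim {:subvs_of U'}]} -> {poly K}} := mmap polyC w.
have phiE (t : K) a : (phi a).[t] = fval (a : Sym (subvs_of U')) (X + t *: v).
  rewrite /phi /mmap /fval /symev mevalE -[_.[t]]/(horner_eval t _) rmorph_sum /=.
  apply: eq_bigr => m _; rewrite rmorphM /= /horner_eval hornerC; congr (_ * _).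
  rewrite /mmap1 -/(horner_eval _ _) rmorph_prod /=; apply: eq_bigr => j _.
  rewrite rmorphXn /= /horner_eval /w hornerD hornerC hornerZ hornerX.
  by rewrite trformDr trformZr mulrC.
exists (phi F); first by move=> t; rewrite phiE.
have := @derivation_mpoly K {poly K} _ (@deriv K) phi (@derivM K) _ F.
move=> ->; last by move=> c; rewrite /phi /= mmapC derivC.
rewrite trform_grad -[_.[0]]/(horner_eval 0 _) rmorph_sum.
apply: eq_bigr => i _; rewrite rmorphM /= /horner_eval -/(phi _) phiE scale0r addr0; congr (_ * _).
rewrite mmapX mmap1U /w derivD derivC derivZ derivX add0r hornerZ hornerC.
by rewrite mulr1.
Qed.

Lemma restricts_grad (F : Sym (subvs_of U)) (p : S) X v :
  restricts U e f F p -> slice U e f X -> v \in U -> commx f v = 0 ->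
  trform (vsval (grad X F)) v = trform (vsval (grad X p)) v.
Proof.
move=> Fp SX Uv fv0.
have [q qE <-] := fval_line F X v; have [q' q'E <-] := fval_line p X v.
suff -> : q = q' by [].
apply/eqP; rewrite -subr_eq0; apply/eqP/poly_fun_eq0 => t.
rewrite hornerD hornerN qE q'E Fp ?subrr //; apply: mem_slice => //.
  exact: memvZ.
by rewrite commxZr fv0 scaler0.
Qed.

(** From [p, q] = [p - p', q] - [q - q', p'] + [p', q']: the first two brackets have one argument in
    [W] and are killed by X. *)
Lemma commx_nilm (W : {vspace 'M[K]_k}) X p q p' q' :
  (forall eta, eta \in W -> trform X (commx eta q) = 0) ->
  (forall eta, eta \in W -> trform X (commx eta p') = 0) ->
  p - p' \in W -> q - q' \in W ->
  trform (commx p q) X = trform (commx p' q') X.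
Proof.
move=> Wq Wp' Wp Wq'.
have -> : commx p q = commx (p - p') q - commx (q - q') p' + commx p' q'.
  by rewrite /commx !mulmxBl !mulmxBr; apply/matrixP => i j; rewrite !mxE; ring.
rewrite trformDl trformBl [trform (commx (p - p') q) X]trformC Wq //.
by rewrite [trform (commx (q - q') p') X]trformC Wp' // subr0 add0r.
Qed.

Section PoissonIso.
Variables (V : vectType K) (c : V -> V -> Sym V).
Variable Theta : {lrmorphism Sym V -> S}.

(* A family of Hamiltonian vectors of the functions Theta u at the point X. *)
Definition hamiltonians (X : 'M[K]_k) (xi : V -> 'M[K]_k) : Prop :=
  [/\ forall u, xi u \in U,
      forall u v, v \in U -> commx f v = 0 ->
        trform (xi u) v = trform (vsval (grad X (Theta (symg u)))) v,
      forall u eta, eta \in U -> supp_le hh (- 1) eta ->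
        trform X (commx eta (xi u)) = 0
    & forall u w, trform (commx (xi u) (xi w)) X = fval (Theta (c u w)) X].

Hypothesis ham : forall X, slice U e f X -> exists xi, hamiltonians X xi.

Variable l : {vspace 'M[K]_k}.
Hypothesis lagr : lagrangian U e h l.

Lemma ThetaC t : Theta t%:MP = t%:MP.
Proof.
have TZ p : Theta (t *: p) = t *: Theta p by exact: linearZ.
by rewrite -[LHS]/(Theta _) -[t%:MP in LHS]mulr1 mul_mpolyC TZ rmorph1 -mul_mpolyC mulr1.
Qed.

Lemma grad_Theta (a : Sym V) X : grad X (Theta a) =
  \sum_i fval (Theta a^`M(i)) X *: grad X (Theta (symg (symb i))).
Proof.
rewrite {1}/grad /sgrad; under eq_bigr => j _.
  have DM p q : mderiv j (p * q) = mderiv j p * q + p * mderiv j q :> S.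
    exact: mderivM.
  rewrite (@derivation_mpoly _ _ _ (mderiv j) Theta DM) => [|t]; last first.
    by rewrite /= ThetaC mderivC.
  rewrite -/(fval _ X) fval_sum scaler_suml.
  under eq_bigr => i _ do rewrite fvalM -scalerA -[in 'X_i]symg_symb.
  over.
rewrite exchange_big /=; apply: eq_bigr => i _.
by rewrite /grad /sgrad scaler_sumr symg_symb.
Qed.

(** By [nilm_char] the gradient of a lift and the combination of Hamiltonian vectors given by the
    chain rule differ by an element of m, and [commx_nilm] permits the exchange in the Lie-Poisson
    formula. *)
Lemma invariant_bracket (a b : Sym V) (F G : Sym (subvs_of U)) X :
  slice U e f X -> ad_invariant e h l F -> ad_invariant e h l G ->
  restricts U e f F (Theta a) -> restricts U e f G (Theta b) ->
  fval (liebr F G) X = fval (Theta (symbr c a b)) X.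
Proof.
move=> SX Finv Ginv Fa Gb; have [xi [Uxi xi_grad xi_neg xi_c]] := ham SX.
pose Xi a' := \sum_i fval (Theta a'^`M(i)) X *: xi (symb i).
(* Invariance puts {eta, H} in the ideal, so its value (X, [eta, dH]) on the slice is zero. *)
have inv_grad (H : Sym (subvs_of U)) eta : ad_invariant e h l H -> eta \in nilm U h l ->
    trform X (commx eta (vsval (grad X H))) = 0.
  move=> Hinv m_eta; have [Ueta _] := memv_nilm gt lagr m_eta.
  have etaE : vsval (vsproj U eta) = eta by rewrite vsprojK.
  have := Hinv (vsproj U eta); rewrite etaE => /(_ m_eta).
  move=> /(in_ideal_fval gt lagr)/(_ SX).
  by rewrite (fval_liebr lieU) /grad sgrad_symg etaE trformC.
have Xi_neg a' eta : eta \in nilm U h l -> trform X (commx eta (Xi a')) = 0.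
  move=> /(memv_nilm gt lagr)[Ueta s1]; rewrite /Xi commx_sumr trform_sumr big1 // => i _.
  by rewrite commxZr trformZr xi_neg ?mulr0.
have lift a' (H : Sym (subvs_of U)) : ad_invariant e h l H -> restricts U e f H (Theta a') ->
    vsval (grad X H) - Xi a' \in nilm U h l.
  move=> Hinv Ha; apply: (nilm_char gt lagr SX).
  - rewrite memvB ?subvsP //; apply: memv_suml => i _; exact: memvZ.
  - move=> v Uv fv0; rewrite trformBl (restricts_grad Ha SX Uv fv0).
    rewrite grad_Theta trform_vsval_sum /Xi trform_suml -sumrB big1 // => i _.
    by rewrite trformZl xi_grad // subrr.
  - move=> eta m_eta; rewrite commxBr trformBr inv_grad // Xi_neg //.
    by rewrite subr0.
have -> : fval (liebr F G) X = trform (commx (Xi a) (Xi b)) X.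
  rewrite (fval_liebr lieU); apply: commx_nilm (lift _ _ Finv Fa) (lift _ _ Ginv Gb).
    by move=> eta; apply: inv_grad.
  by move=> eta; apply: Xi_neg.
have ThetaM p q : Theta (p * q) = Theta p * Theta q by exact: rmorphM.
have Theta_sum n (p : 'I_n -> Sym V) : Theta (\sum_i p i) = \sum_i Theta (p i).
  exact: raddf_sum.
rewrite /symbr Theta_sum fval_sum /Xi commx_suml trform_suml.
apply: eq_bigr => i _; rewrite Theta_sum fval_sum commx_sumr trform_suml.
apply: eq_bigr => j _; rewrite commxZl commxZr !trformZl xi_c.
by rewrite !ThetaM !fvalM mulrA mulrC mulrA.
Qed.

Lemma slice_bracketP (a b : Sym V) (r : S) :
  slice_bracket U e h f l (Theta a) (Theta b) r <-> r = Theta (symbr c a b).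
Proof.
split=> [[F [G [Finv Ginv Fa Gb FGr]]]|->].
  apply: slice_fun_inj => X SX; rewrite -FGr //.
  exact: (@invariant_bracket _ _ F G).
(* An element of S(z) is first read in S(g) through the inclusion of z, which has the right values
   on the slice; then it is made invariant. *)
have lift (a' : Sym V) : exists F, ad_invariant e h l F /\
    restricts U e f F (Theta a').
  have sub_zU : (z <= U)%VS by exact: capvSl.
  have [F [Finv FE]] := invariant_lift gt lagr
    (symmap (fun u : T => vsproj U (vsval u)) (Theta a')).
  exists F; split=> // X SX; rewrite FE // /fval /symmap /symev comp_mpoly_meval.
  apply: meval_eq => i; rewrite tnth_mktuple -[LHS]/(fval _ X) fval_symg.
  by rewrite vsprojK // (subvP sub_zU) ?subvsP.
have [F [Finv Fa]] := lift a; have [G [Ginv Gb]] := lift b.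
exists F, G; split=> // X SX; exact: (@invariant_bracket _ _ F G).
Qed.

End PoissonIso.
End SliceFunctions.
(** * Characteristic polynomials of slice matrices *)

Section Jacobi.
Variables (S : comNzRingType) (D : {additive S -> S}).
Hypothesis DM : forall a b, D (a * b) = D a * b + a * D b.

Lemma derivation1 : D 1 = 0.
Proof.
have := DM 1 1; rewrite !mulr1 mul1r => /eqP.
by rewrite -subr_eq0 opprD addrA subrr sub0r oppr_eq0 => /eqP.
Qed.

Lemma derivation_sign s a : D ((-1) ^+ s * a) = (-1) ^+ s * D a.
Proof. by elim: s => [|s IHs]; rewrite ?mul1r // exprS !mulN1r !mulNr raddfN IHs. Qed.

Lemma derivation_prod n (F : 'I_n -> S) :
  D (\prod_i F i) = \sum_i \prod_j (if j == i then D (F i) else F j).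
Proof.
elim: n F => [|n IHn] F; first by rewrite !big_ord0 derivation1.
rewrite big_ord_recl DM IHn big_ord_recl big_ord_recl eqxx; congr (_ + _).
rewrite mulr_sumr; apply: eq_bigr => i _; rewrite [in RHS]big_ord_recl.
by congr (_ * _); apply: eq_bigr => j _; rewrite (inj_eq lift_inj).
Qed.

(** Jacobi's formula for an arbitrary derivation: differentiate one row at a time and expand along
    that row. *)
Lemma derivation_det n (M : 'M[S]_n) :
  D (\det M) = \tr (\adj M *m map_mx D M).
Proof.
rewrite {1}/determinant raddf_sum /=.
transitivity (\sum_i \det (\matrix_(a, b) (if a == i then D (M i b) else M a b))).
  rewrite [RHS]exchange_big /=; apply: eq_bigr => s _.
  rewrite derivation_sign derivation_prod mulr_sumr; apply: eq_bigr => i _.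
  congr (_ * _); apply: eq_bigr => j _; rewrite mxE.
  by case: eqP => [->|].
rewrite mxtrace_mulC; apply: eq_bigr => i _; rewrite (expand_det_row _ i) mxE.
apply: eq_bigr => j _; rewrite !mxE eqxx; congr (_ * _).
rewrite /cofactor; congr (_ * \det _); apply/matrixP => a b; rewrite !mxE.
by rewrite eq_sym (negbTE (neq_lift _ _)).
Qed.

End Jacobi.

Lemma map_poly_derivation (S : comNzRingType) (D : {additive S -> S}) :
  (forall a b, D (a * b) = D a * b + a * D b) ->
  exists D' : {additive {poly S} -> {poly S}},
    (forall p q, D' (p * q) = D' p * q + p * D' q) /\
    (forall p i, (D' p)`_i = D p`_i).
Proof.
move=> DM.
have addD : zmod_morphism (map_poly D).
  by move=> p q; apply/polyP => i; rewrite !(coef_map, coefB) raddfB.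
pose D' : {additive {poly S} -> {poly S}} :=
  HB.pack (map_poly D) (GRing.isZmodMorphism.Build _ _ _ addD).
exists D'; split=> [p q|p i]; last by rewrite /D' /= coef_map.
apply/polyP => i; rewrite /D' /= coef_map coefD !coefM raddf_sum -big_split /=.
by apply: eq_bigr => j _; rewrite !coef_map DM.
Qed.

Lemma derivation_det1D (S : comNzRingType) (D : {additive S -> S}) n (M : 'M[S]_n) j :
  (forall a b, D (a * b) = D a * b + a * D b) ->
  D (det1D M)`_j.+1 =
  \sum_a \sum_b (\adj (1%:M + 'X *: map_mx polyC M) a b)`_j * D (M b a).
Proof.
move=> DM; have [D' [D'M D'E]] := map_poly_derivation DM.
rewrite -D'E /det1D (derivation_det D'M) /mxtrace coef_sum; apply: eq_bigr => a _.
rewrite mxE coef_sum; apply: eq_bigr => b _; rewrite !mxE.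
have -> : D' ((b == a)%:R + 'X * (M b a)%:P) = 'X * (D (M b a))%:P.
  apply/polyP => i; rewrite D'E coefD !coefXM coefC; case: i => [|i] /=.
    rewrite addr0 -polyC1 -polyCMn coefC /=.
    by case: (b == a); rewrite ?(derivation1 DM) ?raddf0.
  rewrite -polyC1 -polyCMn coefC /= add0r coefC.
  by case: i => //=; rewrite raddf0.
by rewrite mulrCA coefXM /= coefMC.
Qed.

(** * Perturbation of determinants *)

Section DetExpansion.
Variable R : comNzRingType.

Lemma det_first_order n (N C : 'M[R]_n) (t : R) :
  exists c, \det (N + t *: C) = \det N + t * \tr (\adj N *m C) + t ^+ 2 * c.
Proof.
pose M := map_mx polyC N + 'X *: map_mx polyC C; pose q := \det M.
have Mev (u : R) : map_mx (horner_eval u) M = N + u *: C.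
  apply/matrixP => i j; rewrite !mxE rmorphD rmorphM /= /horner_eval.
  by rewrite !hornerC hornerX.
have qev u : q.[u] = \det (N + u *: C).
  by rewrite -[q.[u]]/(horner_eval u q) /q -det_map_mx Mev.
have q0 : q`_0 = \det N by rewrite -horner_coef0 qev scale0r addr0.
have q1 : q`_1 = \tr (\adj N *m C).
  have -> : q`_1 = q^`().[0] by rewrite horner_coef0 coef_deriv.
  rewrite /q (@derivation_det {poly R} (@deriv R) (@derivM R)).
  rewrite -[_.[0]]/(horner_eval 0 _) -trace_map_mx map_mxM map_mx_adj Mev.
  rewrite scale0r addr0; congr (\tr (_ *m _)); apply/matrixP => i j.
  rewrite /M !mxE /= derivD derivC derivM derivX derivC mulr0 addr0 add0r mul1r.
  by rewrite /horner_eval hornerC.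
exists (drop_poly 2 q).[t].
rewrite -qev -{1}[q](poly_take_drop 2) hornerD hornerM hornerXn mulrC.
congr (_ + _); rewrite (_ : take_poly 2 q = (q`_0)%:P + q`_1 *: 'X).
  by rewrite hornerD hornerC hornerZ hornerX q0 q1 mulrC [t * _]mulrC.
apply/polyP => i; rewrite coef_take_poly coefD coefC coefZ coefX.
by case: i => [|[|i]] //=; rewrite ?mulr0 ?mulr1 ?addr0 ?add0r.
Qed.

End DetExpansion.

Section DetWeights.
Variable R : comNzRingType.

Lemma polyXn_lreg n (p q : {poly R}) : 'X^n * p = 'X^n * q -> p = q.
Proof. by apply: monic_lreg; apply: monicXn. Qed.

Section Weights.
Variables (k : nat) (w : 'I_k -> nat).
Implicit Types M : 'M[R]_k.

(** Guarantees that the natural number subtractions in the exponents of [weight_mx] are not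
    truncated at a nonzero entry. *)
Definition weighted M := forall i j, M i j != 0 -> (w j <= (w i).+1)%N.

(* The conjugate of 1 - tau M by diag(tau ^ w_i). *)
Definition weight_mx M : 'M[{poly R}]_k :=
  \matrix_(i, j) ((i == j)%:R - 'X^((w i).+1 - w j) * (M i j)%:P).

Lemma det_weight_mx M : weighted M -> \det (weight_mx M) = det1B M.
Proof.
move=> wM; pose D : 'M[{poly R}]_k := diag_mx (\row_i 'X^(w i)).
have E : weight_mx M *m D = D *m (1%:M - 'X *: map_mx polyC M).
  apply/matrixP => i j; rewrite mul_mx_diag mul_diag_mx !mxE mulrBl mulrBr.
  congr (_ - _).
    by have [->|_] := eqVneq i j; rewrite ?mul1r ?mulr1 ?mul0r ?mulr0.
  have [->|/wM le_ji] := eqVneq (M i j) 0; first by rewrite !(mulr0, mul0r).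
  by rewrite mulrAC -exprD subnK // exprSr mulrA.
have /(congr1 determinant) := E; rewrite !det_mulmx mulrC.
have -> : \det D = 'X^(\sum_i w i).
  rewrite det_diag expr_sum; apply: eq_bigr => i _; by rewrite mxE.
exact: polyXn_lreg.
Qed.

(** After conjugation by the weights the changed entries carry at least tau^r, so the determinants
    agree below tau^r. The coefficient of tau^r is the first-order term at tau = 0, where only
    entries of exponent 0, respectively exactly r, remain. *)
Lemma det1B_weight M M' r : (0 < r)%N -> weighted M -> weighted M' ->
  (forall i j, M' i j != M i j -> (r + w j <= (w i).+1)%N) ->
  (forall l, (l < r)%N -> (det1B M')`_l = (det1B M)`_l) /\
  (det1B M')`_r = (det1B M)`_r -
    \tr (\adj (\matrix_(i, j) ((i == j)%:R - M i j *+ (w j == (w i).+1))) *m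
         \matrix_(i, j) ((M' i j - M i j) *+ (r + w j == (w i).+1)%N)).
Proof.
move=> r_gt0 wM wM' diff.
pose C : 'M[{poly R}]_k :=
  \matrix_(i, j) (- ('X^((w i).+1 - w j - r) * (M' i j - M i j)%:P)).
have E : weight_mx M' = weight_mx M + 'X^r *: C.
  apply/matrixP => i j; rewrite !mxE -addrA mulrN mulrA -exprD -opprD.
  congr (_ - _); have [->|/diff le_r] := eqVneq (M' i j) (M i j).
    by rewrite subrr mulr0 addr0.
  rewrite subnKC; last by lia.
  by rewrite -mulrDr -polyCD addrC subrK.
have [c] := det_first_order (weight_mx M) C 'X^r.
rewrite -E !det_weight_mx // => ->.
split=> [l lt_l|].
  rewrite !coefD coefXnM lt_l addr0 -exprM coefXnM ifT ?addr0 //; lia.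
rewrite !coefD coefXnM ltnn subnn -exprM coefXnM ifT; last by lia.
rewrite addr0; congr (_ + _).
rewrite -horner_coef0 -[_.[0]]/(horner_eval 0 _) -trace_map_mx map_mxM map_mx_adj.
rewrite -raddfN -mulmxN /=; congr (\tr (\adj _ *m _)); apply/matrixP => i j.
  rewrite !mxE rmorphB rmorphM rmorph_nat /= /horner_eval hornerXn hornerC expr0n.
  congr (_ - _); have [->|/wM le_ji] := eqVneq (M i j) 0.
    by rewrite mulr0 mul0rn.
  rewrite subn_eq0 mulr_natl; congr (_ *+ _); lia.
rewrite !mxE rmorphN rmorphM /= /horner_eval hornerXn hornerC expr0n.
congr (- _); have [->|/diff le_r] := eqVneq (M' i j) (M i j).
  by rewrite subrr mulr0 mul0rn.
by rewrite -subnDA subn_eq0 mulr_natl; congr (_ *+ _); lia.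
Qed.

End Weights.

End DetWeights.

Section Sylvester.
Variable R : comNzRingType.

Lemma det_sylvester p q (U : 'M[R]_(p, q)) (V : 'M[R]_(q, p)) :
  \det (1%:M - U *m V) = \det (1%:M - V *m U).
Proof.
pose B := block_mx 1%:M U V 1%:M.
have d0 : \det (block_mx 1%:M 0 (- V) 1%:M : 'M[R]_(p + q)) = 1.
  by rewrite det_lblock !det1 mulr1.
have d1 : \det B = \det (1%:M - U *m V).
  have := det_mulmx B (block_mx 1%:M 0 (- V) 1%:M).
  rewrite d0 mulr1 => <-; rewrite mulmx_block !mulmx1 !mulmx0 !mul1mx addrC.
  by rewrite !add0r mulmxN [X in block_mx _ _ X]subrr det_ublock det1 mulr1 addrC.
have := det_mulmx (block_mx 1%:M 0 (- V) 1%:M) B.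
rewrite d0 mul1r d1 => <-; rewrite mulmx_block !mul0mx !mul1mx !mulmx1 !addr0.
by rewrite addNr det_ublock det1 mul1r mulNmx addrC.
Qed.

End Sylvester.

Lemma det1B_embed (R : comNzRingType) p q (P : 'M[R]_(p, q)) (P' : 'M[R]_(q, p)) (A : 'M[R]_q) :
  P' *m P = 1%:M -> det1B (P *m A *m P') = det1B A.
Proof.
move=> P'P; rewrite /det1B !map_mxM /= -mulmxA scalemxAr det_sylvester.
by rewrite -scalemxAl -mulmxA -map_mxM P'P map_mx1 mulmx1.
Qed.

(** * Block matrices of the shape of the slice *)

Section BlockModel.
Variable R : comNzRingType.

Definition eps1 r : 'cV[R]_r := \col_i (i == 0%N :> nat)%:R.
Definition epsr r : 'cV[R]_r := \col_i (i.+1 == r)%:R.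
Definition hessenberg r (E : 'M[R]_r) : Prop :=
  forall i j : 'I_r, (i < j)%N -> E i j = (j == i.+1 :> nat)%:R.
Definition slice_mx p r (A : 'M[R]_p) (b : 'cV[R]_p) (c : 'rV[R]_p) (E : 'M[R]_r) :
    'M[R]_(p + r) :=
  block_mx A (b *m (eps1 r)^T) (epsr r *m c) E.

Lemma mul_colrow m n (u : 'cV[R]_m) (v : 'rV[R]_n) i j : (u *m v) i j = u i 0 * v 0 j.
Proof. by rewrite mxE big_ord1. Qed.

Lemma eps1E r (j : 'I_r) : (eps1 r)^T 0 j = (j == 0%N :> nat)%:R.
Proof. by rewrite !mxE. Qed.

Lemma epsrE r (i : 'I_r) : epsr r i 0 = (i.+1 == r)%:R.
Proof. by rewrite mxE. Qed.

Lemma bool_neq0 (b : bool) : (b%:R : R) != 0 -> b.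
Proof. by case: b; rewrite ?eqxx. Qed.

Lemma mulf_bool_neq0 (b : bool) (x : R) : x * b%:R != 0 -> b.
Proof. by case: b; rewrite ?mulr0 ?eqxx. Qed.

(** Middle index number x, counted from 0, has weight x + 1 and corner indices have weight s. The
    choice s = 0 pushes c to a high order in tau; s = 1 makes the block b disappear at tau = 0. *)
Lemma slice_mx_weighted p r s A b c E : hessenberg E -> (s <= 1)%N ->
  weighted (fun i : 'I_(p + r) => maxn s (i.+1 - p)) (slice_mx A b c E).
Proof.
move=> hE s1 i j; case: (split_ordP i) => i' ->; case: (split_ordP j) => j' ->.
- by rewrite block_mxEul /= => _; have := ltn_ord j'; lia.
- by rewrite block_mxEur mul_colrow eps1E => /mulf_bool_neq0 /eqP /=; lia.
- by rewrite block_mxEdl /= => _; have := ltn_ord j'; lia.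
rewrite block_mxEdr /= => nz.
have [/hE E0|] := ltnP i' j'; last by lia.
by move: nz; rewrite E0 => /bool_neq0 /eqP; lia.
Qed.

(** With s = 0 the entries of c carry tau^(r+1), so below that order c may be set to 0, and the
    matrix becomes block triangular. *)
Lemma det1B_slice p r (A : 'M[R]_p) b c (E : 'M[R]_r) l : hessenberg E ->
  (l <= r)%N -> (det1B (slice_mx A b c E))`_l = (det1B A * det1B E)`_l.
Proof.
move=> hE le_l; have hw c' := @slice_mx_weighted p r 0 A b c' E hE isT.
have diff (i j : 'I_(p + r)) : slice_mx A b c E i j != slice_mx A b 0 E i j ->
    (r.+1 + maxn 0 (j.+1 - p) <= (maxn 0 (i.+1 - p)).+1)%N.
  case: (split_ordP i) => i' ->; case: (split_ordP j) => j' ->.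
  - by rewrite !block_mxEul eqxx.
  - by rewrite !block_mxEur eqxx.
  - rewrite !block_mxEdl mulmx0 mul_colrow epsrE [X in _ != X]mxE mulrC.
    by move=> /mulf_bool_neq0 /eqP /=; have := ltn_ord j'; lia.
  by rewrite !block_mxEdr eqxx.
have [/(_ l le_l) -> _] := det1B_weight (ltn0Sn r) (hw 0) (hw c) diff.
rewrite {1}/det1B (_ : _ - _ = block_mx (1%:M - 'X *: map_mx polyC A)
   (- ('X *: map_mx polyC (b *m (eps1 r)^T))) 0 (1%:M - 'X *: map_mx polyC E)).
  by rewrite det_ublock.
rewrite /slice_mx mulmx0 map_block_mx scale_block_mx (scalar_mx_block p r 1).
by rewrite opp_block_mx add_block_mx map_mx0 scaler0 subr0 sub0r.
Qed.

Lemma hessenberg_exp r (E : 'M[R]_r) : hessenberg E ->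
  forall l (i j : 'I_r), (i + l <= j)%N -> (E ^+ l) i j = (j == i + l :> nat)%N%:R.
Proof.
move=> hE; elim=> [|l IHl] i j le_j.
  by rewrite expr0 mxE addn0 -val_eqE eq_sym.
rewrite exprS mxE.
case: (ltnP i.+1 r) => [lt_i|]; last by have := ltn_ord j; lia.
rewrite (bigD1 (Ordinal lt_i)) //= big1 ?addr0 => [|a ne_a].
  rewrite hE //= eqxx mul1r IHl /=; last by lia.
  by rewrite addSnnS.
have [lt_ia|le_ai] := ltnP i a; last first.
  rewrite IHl; last by lia.
  by rewrite (_ : (j == _ :> nat) = false) ?mulr0 //; lia.
rewrite hE // (_ : (a == i.+1 :> nat) = false) ?mul0r //.
by apply/negP => /eqP E'; case/negP: ne_a; apply/eqP/val_inj.
Qed.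

Lemma size_det_linear n (M : 'M[{poly R}]_n) :
  (forall i j, (size (M i j) <= 2)%N) -> (size (\det M) <= n.+1)%N.
Proof.
move=> sM; apply: leq_trans (size_sum _ _ _) _; apply/bigmax_leqP => s _.
rewrite size_Msign; apply: leq_trans (size_poly_prod_leq _ _) _.
rewrite leq_subLR card_ord.
apply: (@leq_ltn_trans (\sum_(i < n) 2)); first by apply: leq_sum => i _; apply: sM.
by rewrite sum_nat_const card_ord; lia.
Qed.

Section Resolvent.
Variables (r : nat) (E : 'M[R]_r).

(* The coefficient of tau^k in det (1 - tau E) (1 - tau E)^-1. *)
Definition adj_coef (k : nat) : 'M[R]_r := \sum_(l < k.+1) (det1B E)`_(k - l) *: E ^+ l.

Lemma adj_coefS k : adj_coef k.+1 = (det1B E)`_k.+1 *: 1%:M + adj_coef k *m E.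
Proof.
rewrite /adj_coef big_ord_recl expr0 subn0; congr (_ + _).
rewrite mulmx_suml; apply: eq_bigr => l _.
by rewrite -scalemxAl lift0 subSS exprSr.
Qed.

Lemma adj_coef0 : adj_coef 0 = 1%:M.
Proof. by rewrite /adj_coef big_ord_recl big_ord0 addr0 subnn det1B_0 scale1r. Qed.

(** Both sides satisfy the recursion G_(k+1) = D_(k+1) + G_k E, which for the adjugate is the
    identity adj (1 - tau E) (1 - tau E) = D. *)
Lemma adj_coefE k i j :
  (\adj (1%:M - 'X *: map_mx polyC E) i j)`_k = adj_coef k i j.
Proof.
have := mul_adj_mx (1%:M - 'X *: map_mx polyC E).
rewrite mulmxBr mulmx1 -scalemxAr; move: (\adj _) => G GE.
have GEk l a b : (G a b)`_l - (if l is l'.+1 then \sum_c (G a c)`_l' * E c b else 0)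
    = (det1B E)`_l *+ (a == b).
  have /matrixP/(_ a b) := GE; rewrite !mxE => /(congr1 (fun q : {poly R} => q`_l)).
  rewrite coefB coefMn => <-; congr (_ - _); rewrite coefXM; case: l => //= l.
  by rewrite coef_sum; apply: eq_bigr => c _; rewrite mxE coefMC.
elim: k i j => [|k IHk] i j.
  have := GEk 0%N i j; rewrite subr0 => ->.
  by rewrite adj_coef0 det1B_0 mxE.
rewrite adj_coefS !mxE.
have := GEk k.+1 i j => /eqP; rewrite subr_eq => /eqP ->.
by congr (_ + _); [rewrite mulr_natr | apply: eq_bigr => c _; rewrite IHk].
Qed.

(* The Cayley-Hamilton theorem. *)
Lemma adj_coef_top : adj_coef r = 0.
Proof.
apply/matrixP => i j; rewrite -adj_coefE [RHS]mxE nth_default //.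
rewrite mxE /cofactor size_Msign.
have le_r : (size (\det (row' j (col' i (1%:M - 'X *: map_mx polyC E)))) <= r)%N.
  have r_gt0 : (0 < r)%N := leq_ltn_trans (leq0n _) (ltn_ord i).
  have := @size_det_linear r.-1 (row' j (col' i (1%:M - 'X *: map_mx polyC E))).
  rewrite prednK //; apply => a b; rewrite !mxE.
  apply: leq_trans (size_polyD _ _) _; rewrite size_polyN geq_max; apply/andP; split.
    by rewrite -polyC1 -polyCMn (leq_trans (size_polyC_leq1 _)).
  apply: leq_trans (size_polyMleq _ _) _; rewrite size_polyX /=.
  exact: size_polyC_leq1.
exact: le_r.
Qed.

Hypothesis hE : hessenberg E.

(** The upper right entry of E^l is 0 for l < r - 1 and 1 for l = r - 1, by the Hessenberg form. *)
Lemma adj_coef_corner k : (k < r)%N ->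
  (eps1 r)^T *m adj_coef k *m epsr r = (k == r.-1)%:R%:M.
Proof.
move=> lt_k; have r_gt0 : (0 < r)%N by lia.
have lt_r1 : (r.-1 < r)%N by lia.
have corner (M : 'M[R]_r) : (eps1 r)^T *m M *m epsr r =
    (M (Ordinal r_gt0) (Ordinal lt_r1))%:M.
  apply/matrixP => a b; rewrite !ord1 [RHS]mxE [LHS]mxE (bigD1 (Ordinal lt_r1)) //= epsrE.
  rewrite big1 ?addr0 => [|j ne_j]; last first.
    rewrite epsrE (_ : (_ == _) = false) ?mulr0 //.
    by move: ne_j; rewrite -val_eqE /=; have := ltn_ord j; lia.
  rewrite prednK // eqxx mulr1 mxE (bigD1 (Ordinal r_gt0)) //= eps1E eqxx mul1r.
  rewrite big1 ?addr0 // => j ne_j.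
  rewrite eps1E (_ : (_ == _) = false) ?mul0r //.
  by move: ne_j; rewrite -val_eqE /=; lia.
rewrite corner /adj_coef summxE; congr (_ %:M).
rewrite big_ord_recr /= subnn det1B_0 scale1r hessenberg_exp //=; last by lia.
rewrite big1 ?add0r => [|l _]; first by rewrite add0n eq_sym.
rewrite mxE hessenberg_exp //=; last by have := ltn_ord l; lia.
rewrite (_ : (_ == _) = false) ?mulr0 //; by have := ltn_ord l; lia.
Qed.

Variables (p : nat) (A : 'M[R]_p) (y : 'cV[R]_p).

Definition ham_mx (v : 'rV[R]_r) : 'M[R]_(p, r) :=
  \sum_(i < r) A ^+ i *m y *m (v *m adj_coef (r.-1 - i)).
Definition ham_vec : 'cV[R]_p :=
  \sum_(i < r.+1) (det1B E)`_(r - i) *: (A ^+ i *m y).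

(** Substituting G_(k+1) - D_(k+1) for G_k E makes the two products telescope; the ends are G_0 = 1
    and G_r = 0, the latter by Cayley-Hamilton. *)
Lemma ham_mxE v : A *m ham_mx v - ham_mx v *m E = ham_vec *m v.
Proof.
have [r0|r_gt0] := posnP r.
  by apply/matrixP => i j; have := ltn_ord j; rewrite {2}r0.
pose u i := A ^+ i *m y *m v.
have AE : A *m ham_mx v = \sum_(i < r) u i.+1 *m adj_coef (r - i.+1).
  rewrite /ham_mx mulmx_sumr; apply: eq_bigr => i _.
  by rewrite /u exprS !mulmxA (_ : r.-1 - i = r - i.+1)%N //; lia.
have EE : ham_mx v *m E = \sum_(i < r) u i *m adj_coef (r - i) -
    \sum_(i < r) (det1B E)`_(r - i) *: u i.
  rewrite /ham_mx mulmx_suml -sumrB; apply: eq_bigr => i _.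
  have -> : (r - i = (r.-1 - i).+1)%N by have := ltn_ord i; lia.
  rewrite adj_coefS mulmxDr -scalemxAr mulmx1 addrC addrA addNr add0r /u.
  by rewrite !mulmxA.
rewrite AE EE opprB addrCA.
rewrite -[RHS]addr0 -[X in _ = _ + X](subrr (\sum_(i < r.+1) u i *m adj_coef (r - i))).
rewrite [in X in _ = _ + (X - _)]big_ord_recl [in X in _ = _ + (_ - X)]big_ord_recr /=.
rewrite subn0 adj_coef_top mulmx0 add0r subnn adj_coef0 mulmx1.
rewrite /ham_vec big_ord_recr /= subnn det1B_0 scale1r mulmxDl mulmx_suml.
under [X in _ = X + _ + _]eq_bigr => i _ do rewrite -scalemxAl.
rewrite -/(u r); under [X in _ = _ + (X - _)]eq_bigr => i _ do rewrite /bump add1n.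
rewrite opprD -!addrA; congr (_ + _); rewrite [RHS]addrCA; congr (_ + _).
by rewrite addrCA subrr addr0.
Qed.

Lemma ham_mx_epsr : (0 < r)%N -> ham_mx (eps1 r)^T *m epsr r = y.
Proof.
move=> r_gt0; rewrite /ham_mx mulmx_suml (bigD1 (Ordinal r_gt0)) //=.
rewrite big1 ?addr0 => [|i ne_i]; last first.
  rewrite -mulmxA adj_coef_corner; last by lia.
  rewrite (_ : (_ == _) = false) ?scalemx0 ?raddf0 ?mulmx0 //.
  by move: ne_i; rewrite -val_eqE /=; have := ltn_ord i; lia.
rewrite -mulmxA adj_coef_corner; last by lia.
by rewrite subn0 eqxx mulmx1 expr0 mul1mx.
Qed.

Lemma ham_vecE (x : 'rV[R]_p) :
  (x *m ham_vec) 0 0 = \sum_(i < r.+1) (det1B E)`_(r - i) * (x *m A ^+ i *m y) 0 0.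
Proof.
rewrite /ham_vec mulmx_sumr summxE; apply: eq_bigr => i _.
by rewrite -scalemxAr mulmxA mxE.
Qed.

(* The factor det (1 - tau A) of det (1 - tau X) cancels against the denominator
   of the generating function of the alpha_j. *)
Lemma psmul_det1B (X : {poly R}) (a : nat -> R) :
  (forall l, (l <= r)%N -> X`_l = (det1B A * det1B E)`_l) ->
  \sum_(i < r.+1) (det1B E)`_(r - i) * a i =
  \sum_(j < r.+1) X`_(r - j) * psmul a (psinv (det1B A)) j.
Proof.
move=> hX.
(* The power series are truncated at tau^r to be able to compute with products of polynomials; only
   coefficients up to r enter. *)
pose ah := \poly_(i < r.+1) a i; pose Ih := \poly_(i < r.+1) psinv (det1B A) i.
have congM (P P' Q Q' : {poly R}) l : (l <= r)%N ->
    (forall i, (i <= r)%N -> P`_i = P'`_i) -> (forall i, (i <= r)%N -> Q`_i = Q'`_i) ->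
    (P * Q)`_l = (P' * Q')`_l.
  move=> le_l hP hQ; rewrite !coefM; apply: eq_bigr => i _.
  by rewrite hP ?hQ //; have := ltn_ord i; lia.
have lt_sub (l i : nat) : (l <= r)%N -> (l - i < r.+1)%N.
  by move=> le_l; rewrite ltnS (leq_trans (leq_subr _ _)).
have alphaE (l : nat) :
    (l <= r)%N -> psmul a (psinv (det1B A)) l = (ah * Ih)`_l.
  move=> le_l; rewrite coefM; apply: eq_bigr => i _; rewrite !coef_poly lt_sub //.
  by rewrite (leq_trans (ltn_ord i)) // ltnS.
have invE l : (l <= r)%N -> (det1B A * Ih)`_l = (1 : {poly R})`_l.
  move=> le_l; rewrite coef1 -(psinvP l (det1B_0 A)) coefM; apply: eq_bigr => i _.
  by rewrite coef_poly lt_sub.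
rewrite [RHS](_ : _ = (X * (ah * Ih))`_r); last first.
  rewrite coefMr; apply: eq_bigr => j _; rewrite alphaE //.
  by rewrite -ltnS.
rewrite (congM X _ _ (ah * Ih) _ (leqnn r) hX) // [ah * Ih]mulrC mulrACA.
rewrite (congM _ 1 _ (det1B E * ah) _ (leqnn r) invE) // mul1r coefMr.
by apply: eq_bigr => i _; rewrite coef_poly ltn_ord.
Qed.

End Resolvent.

Lemma det1B_tr r (E : 'M[R]_r) : det1B E^T = det1B E.
Proof.
rewrite /det1B -[RHS]det_tr; congr (\det _); apply/matrixP => i j.
by rewrite !mxE eq_sym.
Qed.

Lemma trmx_exp r (E : 'M[R]_r) l : (E ^+ l)^T = E^T ^+ l.
Proof.
elim: l => [|l IHl]; first by rewrite !expr0 trmx1.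
by rewrite exprS exprSr trmx_mul IHl.
Qed.

Lemma adj_coef_tr r (E : 'M[R]_r) k : adj_coef E^T k = (adj_coef E k)^T.
Proof.
rewrite /adj_coef raddf_sum; apply: eq_bigr => l _.
by rewrite det1B_tr -trmx_exp; apply/matrixP => i j; rewrite !mxE.
Qed.

(** The weights with s = 1: at tau = 0 the matrix is the identity on the corner and 1 - shift in the
    middle. The inverse of the latter has all entries 1 on and above the diagonal, so the
    first-order trace adds up the changes on the j0-th subdiagonal. *)
Lemma det1B_slope p r (A : 'M[R]_p) b c (E E' : 'M[R]_r) j0 :
  hessenberg E -> hessenberg E' ->
  (forall i l : 'I_r, E' i l != E i l -> (l + j0 <= i)%N) ->
  (forall t, (t <= j0)%N ->
    (det1B (slice_mx A b c E'))`_t = (det1B (slice_mx A b c E))`_t) /\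
  (det1B (slice_mx A b c E'))`_j0.+1 = (det1B (slice_mx A b c E))`_j0.+1 -
    \sum_(l < r) \sum_(i < r | i == (l + j0)%N :> nat) (E' i l - E i l).
Proof.
move=> hE hE' diff.
have w1 E1 hE1 := @slice_mx_weighted p r 1 A b c E1 hE1 isT.
have diffw (i j : 'I_(p + r)) : slice_mx A b c E' i j != slice_mx A b c E i j ->
    (j0.+1 + maxn 1 (j.+1 - p) <= (maxn 1 (i.+1 - p)).+1)%N.
  case: (split_ordP i) => i' ->; case: (split_ordP j) => j' ->.
  - by rewrite !block_mxEul eqxx.
  - by rewrite !block_mxEur eqxx.
  - by rewrite !block_mxEdl eqxx.
  by rewrite !block_mxEdr => /diff /=; lia.
have [cong ->] := det1B_weight (ltn0Sn j0) (w1 _ hE) (w1 _ hE') diffw.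
split; first exact: cong.
congr (_ - _); set N := \matrix_(i, j) _; set F := \matrix_(i, j) _.
pose e : 'M[R]_r := \matrix_(i, j) (j == i.+1 :> nat)%:R.
pose up : 'M[R]_r := \matrix_(i, j) (i <= j)%N%:R.
have NE : N = block_mx 1%:M 0 0 (1%:M - e).
  apply/matrixP => i j; rewrite mxE.
  case: (split_ordP i) => i' ->; case: (split_ordP j) => j' ->.
  - rewrite !block_mxEul mxE (inj_eq (@lshift_inj _ _)) (_ : (_ == _.+1) = false) ?subr0 //=.
    by have := ltn_ord i'; have := ltn_ord j'; lia.
  - rewrite !block_mxEur mul_colrow eps1E mxE -val_eqE /=.
    rewrite (_ : (_ == _ :> nat) = false); last by have := ltn_ord i'; lia.
    have [->|ne0] := eqVneq (j' : nat) 0%N; last by rewrite mulr0 mul0rn subrr.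
    by rewrite (_ : (_ == _ :> nat) = false) ?mulr0n ?subrr //; have := ltn_ord i'; lia.
  - rewrite !block_mxEdl [RHS]mxE -val_eqE /=.
    rewrite (_ : (_ == _ :> nat) = false); last by have := ltn_ord j'; lia.
    by rewrite (_ : (_ == _ :> nat) = false) ?mulr0n ?subrr //; have := ltn_ord j'; lia.
  rewrite !block_mxEdr !mxE (inj_eq (@rshift_inj _ _)); congr (_ - _).
  rewrite /= (_ : (_ == _.+1) = (j' == i'.+1 :> nat)); last by lia.
  by have [ji|_] := eqVneq (j' : nat) i'.+1; rewrite ?mulr0n // mulr1n hE ji ?eqxx.
have FE : F = block_mx 0 0 0 (\matrix_(i, l) ((E' i l - E i l) *+ (i == (l + j0)%N :> nat))).
  apply/matrixP => i j; rewrite mxE.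
  case: (split_ordP i) => i' ->; case: (split_ordP j) => j' ->.
  - by rewrite !block_mxEul mxE subrr mul0rn.
  - by rewrite !block_mxEur [RHS]mxE subrr mul0rn.
  - by rewrite !block_mxEdl [RHS]mxE subrr mul0rn.
  by rewrite !block_mxEdr mxE /=; congr (_ *+ _); lia.
have up1 : (1%:M - e) *m up = 1%:M.
  apply/matrixP => i j; rewrite mulmxBl mul1mx !mxE.
  case: (ltnP i.+1 r) => [lt_i|ge_i].
    rewrite (bigD1 (Ordinal lt_i)) //= !mxE /= eqxx mul1r big1 ?addr0 => [|l ne_l].
      rewrite -val_eqE /=; case: (ltngtP i j) => // _; rewrite ?subrr ?subr0 //.
    rewrite !mxE (_ : (_ == _) = false) ?mul0r //.
    by move: ne_l; rewrite -val_eqE /= => /negbTE.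
  rewrite big1 ?subr0 => [|l _].
    by rewrite -val_eqE /=; congr (_%:R); have := ltn_ord j; have := ltn_ord i; lia.
  by rewrite !mxE (_ : (_ == _) = false) ?mul0r //; have := ltn_ord l; lia.
have det_e : \det (1%:M - e) = 1.
  rewrite -det_tr det_trig; last first.
    apply/is_trig_mxP => i j lt_ij; rewrite !mxE -val_eqE /=.
    rewrite (_ : (_ == _ :> nat) = false); last by lia.
    by rewrite (_ : (_ == _ :> nat) = false) ?subrr //; lia.
  rewrite big1 // => i _; rewrite !mxE eqxx (_ : (_ == _ :> nat) = false) ?subr0 //.
  by lia.
have adjN : \adj N = block_mx 1%:M 0 0 up.
  have N1 : N *m block_mx 1%:M 0 0 up = 1%:M.
    rewrite NE mulmx_block !mulmx0 !mul0mx !mulmx1 !addr0 !add0r up1.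
    by rewrite -scalar_mx_block.
  have detN : \det N = 1 by rewrite NE det_ublock det1 mul1r det_e.
  by rewrite -[\adj N]mulmx1 -N1 mulmxA mul_adj_mx detN mul1mx.
rewrite adjN FE mulmx_block !mulmx0 !mul0mx !addr0 !add0r mxtrace_block.
rewrite mxtrace0 add0r; apply: eq_bigr => l _; rewrite mxE [RHS]big_mkcond.
apply: eq_bigr => i _; rewrite !mxE; case: ifP => [/eqP ->|_].
  by rewrite leq_addr mul1r mulr1n.
by rewrite mulr0n mulr0.
Qed.

End BlockModel.

(** * Polynomials in the lowering operator, recovered from the determinant *)

Section Toeplitz.
Variables (K : numFieldType) (S : comAlgType K) (r : nat).

(* The entry of f below the diagonal in row x. *)
Definition fcoef (x : nat) : K := (x * (r - x))%:R.

(** The entry of f^(x - y) in row x and column y, numbered from 0. *)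
Definition fprod (x y : nat) : K := \prod_(y.+1 <= t < x.+1) fcoef t.

(* The polynomial sum_j a_j f^j in the lowering operator of 'M_r. *)
Definition toep (a : nat -> S) : 'M[S]_r :=
  \matrix_(x, y) (if (y <= x)%N then fprod x y *: a (x - y)%N else 0).

Definition shift_mx : 'M[S]_r := \matrix_(x, y) (y == x.+1 :> nat)%:R.

Lemma fcoef_gt0 x : (0 < x < r)%N -> 0 < fcoef x.
Proof. by move=> lt_x; rewrite ltr0n muln_gt0; lia. Qed.

Lemma fprod_gt0 x y : (x < r)%N -> 0 < fprod x y.
Proof.
move=> lt_x; rewrite /fprod big_nat; apply: prodr_gt0 => t lt_t.
by apply: fcoef_gt0; lia.
Qed.

Lemma hessenberg_toep a : hessenberg (shift_mx + toep a).
Proof. by move=> x y lt_xy; rewrite !mxE leqNgt lt_xy addr0. Qed.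

(** The sum of all entries of f^j, positive for j < r. *)
Definition slope j : K := \sum_(l < r) \sum_(i < r | i == (l + j)%N :> nat) fprod i l.

Lemma slope_neq0 j : (j < r)%N -> slope j != 0.
Proof.
move=> lt_j; have r_gt0 : (0 < r)%N by lia.
rewrite gt_eqF // /slope (bigD1 (Ordinal r_gt0)) //= ltr_wpDr //.
  rewrite sumr_ge0 // => l _; rewrite sumr_ge0 // => i _.
  exact/ltW/fprod_gt0.
rewrite (bigD1 (Ordinal lt_j)) //= ltr_wpDr ?fprod_gt0 //.
rewrite sumr_ge0 // => i _; exact/ltW/fprod_gt0.
Qed.

Variables (p : nat) (A : 'M[S]_p) (b : 'cV[S]_p) (c : 'rV[S]_p).

Definition toep_mx (a : nat -> S) : 'M[S]_(p + r) :=
  slice_mx A b c (shift_mx + toep a).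

Lemma det1B_toep a a' j : (forall i, (i < j)%N -> a' i = a i) ->
  (forall t, (t <= j)%N -> (det1B (toep_mx a'))`_t = (det1B (toep_mx a))`_t) /\
  (det1B (toep_mx a'))`_j.+1 = (det1B (toep_mx a))`_j.+1 - slope j *: (a' j - a j).
Proof.
move=> aa'; have diff (i l : 'I_r) :
    (shift_mx + toep a') i l != (shift_mx + toep a) i l -> (l + j <= i)%N.
  rewrite !mxE; case: leqP => [le_li|_]; last by rewrite eqxx.
  have [lt_j|] := ltnP (i - l) j; last by lia.
  by rewrite aa' // eqxx.
have [cong top] := @det1B_slope S p r A b c _ _ j (hessenberg_toep a) (hessenberg_toep a') diff.
split; [exact: cong | apply: etrans top _]; congr (_ - _); rewrite /slope scaler_suml; apply: eq_bigr => l _.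
rewrite scaler_suml; apply: eq_bigr => i /eqP il.
rewrite !mxE opprD addrACA subrr add0r il leq_addr addKn.
by rewrite scalerBr.
Qed.

(** A triangular system solved by increasing j. [P] selects the a_j to be solved for; the others are
    prescribed by the Lie algebra: a_0 by the trace for sl, the even ones, equal to 0, for sp. *)
Lemma toep_exists (P : pred nat) (a0 t : nat -> S) : exists a : nat -> S,
  (forall j, ~~ P j -> a j = a0 j) /\
  (forall j, (j < r)%N -> P j -> (det1B (toep_mx a))`_j.+1 = t j).
Proof.
suff: forall J, (J <= r)%N -> exists a : nat -> S,
    (forall j, ~~ P j -> a j = a0 j) /\
    (forall j, (j < J)%N -> P j -> (det1B (toep_mx a))`_j.+1 = t j).
  by move/(_ r (leqnn r)).
elim=> [|J IHJ] lt_J; first by exists a0.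
have [a [aP at_]] := IHJ (ltnW lt_J).
have [PJ|nPJ] := boolP (P J); last first.
  exists a; split=> // j; rewrite ltnS leq_eqVlt => /orP[/eqP -> PJ|].
    by rewrite PJ in nPJ.
  exact: at_.
pose u := (slope J)^-1 *: ((det1B (toep_mx a))`_J.+1 - t J).
pose a' j := a j + u *+ (j == J).
have aa' i : (i < J)%N -> a' i = a i.
  by move=> lt_i; rewrite /a' (ltn_eqF lt_i) mulr0n addr0.
have [cong top] := det1B_toep aa'.
exists a'; split=> [j nPj|j].
  rewrite /a' (_ : (j == J) = false) ?mulr0n ?addr0 ?aP //.
  by apply: contraNF nPj => /eqP ->.
rewrite ltnS leq_eqVlt => /orP[/eqP -> _|lt_j Pj]; last by rewrite cong ?at_.
have uE : a' J - a J = u by rewrite /a' eqxx mulr1n addrC addKr.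
by rewrite top uE scalerA mulfV ?slope_neq0 // scale1r opprB addrC subrK.
Qed.

Lemma toep_unique (P : pred nat) a a' :
  (forall j, ~~ P j -> a j = a' j) ->
  (forall j, (j < r)%N -> P j ->
     (det1B (toep_mx a))`_j.+1 = (det1B (toep_mx a'))`_j.+1) ->
  forall j, (j < r)%N -> a j = a' j.
Proof.
move=> aa' det_eq j; have [N le_N] := ubnP j.
elim: N j le_N => // N IHN j; rewrite ltnS => le_N lt_j.
have [Pj|/aa' //] := boolP (P j).
have below i : (i < j)%N -> a' i = a i by move=> lt_i; rewrite IHN //; lia.
have [_ top] := det1B_toep below; have := etrans (det_eq j lt_j Pj) top.
move/eqP; rewrite addrC -subr_eq subrr eq_sym oppr_eq0 scaler_eq0.
by rewrite (negbTE (slope_neq0 lt_j)) subr_eq0 => /eqP.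
Qed.

End Toeplitz.
(** * The block form of the slice *)

Section OffsetTriple.
Variables (K : numClosedFieldType) (k n r : nat).
Hypothesis le_nr : (n + r <= k)%N.

Definition off_e : 'M[K]_k := \sum_(1 <= j < r) Emx (n + j) (n + j.+1).
Definition off_h : 'M[K]_k :=
  \sum_(1 <= j < r.+1) ((r.+1)%:R - (2 * j)%:R) *: Emx (n + j) (n + j).
Definition off_f : 'M[K]_k :=
  \sum_(1 <= j < r) (j * (r - j))%:R *: Emx (n + j.+1) (n + j).

Definition off_wt (i : 'I_k) : int :=
  if (n <= i < n + r)%N then r%:Z - 1 - 2 * (i - n)%N%:Z else 0.

(* off_f = D e^T D^-1 for D the diagonal matrix of the off_d. *)
Definition off_d (i : 'I_k) : K := \prod_(1 <= t < (minn (i - n) r.-1).+1) fcoef K r t.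

Lemma off_eE (i j : 'I_k) :
  off_e i j = [&& (n <= i)%N, (j < n + r)%N & j == i.+1 :> nat]%:R.
Proof.
rewrite summxE; case: and3P => [[le_i lt_j /eqP ji]|out].
  rewrite (bigD1_seq (i.+1 - n)%N) ?mem_index_iota ?iota_uniq //=; last by lia.
  rewrite !mxE (_ : _ && _ = true); last by lia.
  rewrite big1 ?addr0 // => l ne_l; rewrite !mxE.
  by rewrite (_ : (i.+1 == _) = false) //; lia.
rewrite big_nat big1 // => l lt_l; rewrite !mxE.
rewrite (_ : _ && _ = false) //; apply/negbTE/negP => ?; apply: out; split; lia.
Qed.

Lemma off_fE (i j : 'I_k) :
  off_f i j = if [&& (n <= j)%N, (i < n + r)%N & i == j.+1 :> nat]
              then fcoef K r (j.+1 - n) else 0.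
Proof.
rewrite summxE; case: and3P => [[le_i lt_j /eqP ji]|out].
  rewrite (bigD1_seq (j.+1 - n)%N) ?mem_index_iota ?iota_uniq //=; last by lia.
  rewrite !mxE (_ : _ && _ = true); last by lia.
  rewrite mulr1 big1 ?addr0 // => l ne_l; rewrite !mxE.
  by rewrite (_ : (j.+1 == _) = false) ?andbF ?mulr0 //; lia.
rewrite big_nat big1 // => l lt_l; rewrite !mxE.
rewrite (_ : _ && _ = false) ?mulr0 //.
by apply/negbTE/negP => ?; apply: out; split; lia.
Qed.

Lemma off_hE (i j : 'I_k) : off_h i j = (off_wt i)%:~R *+ (i == j).
Proof.
rewrite summxE /off_wt.
case: ifP => [in_i|out].
  rewrite (bigD1_seq (i.+1 - n)%N) ?mem_index_iota ?iota_uniq //=; last by lia.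
  rewrite !mxE big1 ?addr0 => [|l ne_l]; last first.
    by rewrite !mxE (_ : (i.+1 == _) = false) ?mulr0 //; lia.
  have [<-|ne_ij] := eqVneq i j.
    rewrite (_ : _ && _ = true); last by lia.
    rewrite mulr1 mulr1n !intrB intrM -!pmulrn -natrM.
    have -> : (2 * (i.+1 - n) = 2 * (i - n) + 2)%N by lia.
    by rewrite natrD -[r.+1]addn1 natrD; ring.
  rewrite (_ : _ && _ = false) ?mulr0 ?mulr0n //.
  by apply/negP => E; case/negP: ne_ij; apply/eqP/val_inj => /=; lia.
rewrite mul0rn big_nat big1 // => l lt_l; rewrite !mxE.
by rewrite (_ : _ && _ = false) ?mulr0 //; lia.
Qed.

Lemma off_d_gt0 i : 0 < off_d i.
Proof.
rewrite /off_d big_nat; apply: prodr_gt0 => t lt_t; apply: fcoef_gt0.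
by move: lt_t; case: r => [|r'] /=; lia.
Qed.

Lemma off_d_succ (i j : 'I_k) : (n <= j)%N -> (i < n + r)%N -> i = j.+1 :> nat ->
  off_d i = off_d j * fcoef K r (j.+1 - n).
Proof.
move=> le_j lt_i ij; rewrite /off_d.
have -> : minn (i - n) r.-1 = (minn (j - n) r.-1).+1 by lia.
rewrite big_nat_recr //=; congr (_ * fcoef _ _ _); lia.
Qed.

Lemma off_starE : star off_d off_e = off_f.
Proof.
apply/matrixP => i j; rewrite mxE off_eE off_fE.
case: and3P => [[le_j lt_i /eqP ij]|_]; last by rewrite conjC0 mulr0.
rewrite conjC1 mulr1 (off_d_succ le_j lt_i ij) mulrC mulKf //.
by rewrite gt_eqF ?off_d_gt0.
Qed.

Lemma off_deg : homdeg off_wt 2 off_e.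
Proof.
move=> i j; rewrite off_eE => nz.
have /and3P[le_i lt_j /eqP ji] : [&& (n <= i)%N, (j < n + r)%N & j == i.+1 :> nat].
  by move: nz; case: and3P => // _; rewrite eqxx.
by rewrite /off_wt !ifT; lia.
Qed.

Lemma off_bound (i j : 'I_k) : `|off_wt i - off_wt j| < k.*2%:Z.
Proof.
have k_gt0 : (0 < k)%N by have := ltn_ord i; lia.
by rewrite /off_wt; do 2!case: ifP => ?; lia.
Qed.

(** Both products are diagonal, and j (r - j) grows by r - 1 - 2 i when j goes from i to i + 1. *)
Lemma off_ef : commx off_e off_f = off_h.
Proof.
pose c (x : 'I_k) : K :=
  if (n <= x < n + r)%N then fcoef K r (x.+1 - n) else 0.
pose c' (x : 'I_k) : K :=
  if (n <= x < n + r)%N then fcoef K r (x - n) else 0.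
have ef (i j : 'I_k) : (off_e *m off_f) i j = c i *+ (i == j).
  rewrite mxE /c; have [/andP[le_i lt_i]|out] := boolP (n <= i < n + r)%N; last first.
    rewrite mul0rn big1 // => l _; rewrite off_eE.
    by case: and3P => [[? ? /eqP ?]|_]; rewrite ?mul0r //; lia.
  have [lt_i1|ge_i1] := ltnP i.+1 (n + r); last first.
    rewrite (_ : fcoef _ _ _ = 0) ?mul0rn; last by rewrite /fcoef (_ : r - _ = 0)%N ?muln0 //; lia.
    rewrite big1 // => l _; rewrite off_eE.
    by case: and3P => [[? ? /eqP ?]|_]; rewrite ?mul0r //; lia.
  have lt_k : (i.+1 < k)%N by lia.
  rewrite (bigD1 (Ordinal lt_k)) //= big1 ?addr0 => [|l ne_l]; last first.
    rewrite off_eE; case: and3P => [[_ _ /eqP li]|_]; last by rewrite mul0r.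
    by case/negP: ne_l; apply/eqP/val_inj.
  rewrite off_eE off_fE /= le_i lt_i1 eqxx mul1r /= -val_eqE /=.
  have [<-|ne_ij] := eqVneq (i : nat) j; first by rewrite le_i eqxx.
  by rewrite mulr0n ifF // eqSS (negbTE ne_ij) andbF.
have fe (i j : 'I_k) : (off_f *m off_e) i j = c' i *+ (i == j).
  rewrite mxE /c'; have [/andP[le_i lt_i]|out] := boolP (n <= i < n + r)%N; last first.
    rewrite mul0rn big1 // => l _; rewrite off_fE.
    by case: and3P => [[? ? /eqP ?]|_]; rewrite ?mul0r //; lia.
  have [gt_i1|le_i1] := ltnP n i; last first.
    rewrite (_ : fcoef _ _ _ = 0) ?mul0rn; last by rewrite /fcoef (_ : i - _ = 0)%N ?mul0n //; lia.
    rewrite big1 // => l _; rewrite off_fE.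
    by case: and3P => [[? ? /eqP ?]|_]; rewrite ?mul0r //; lia.
  have lt_k : (i.-1 < k)%N by lia.
  rewrite (bigD1 (Ordinal lt_k)) //= big1 ?addr0 => [|l ne_l]; last first.
    rewrite off_fE; case: and3P => [[_ _ /eqP li]|_]; last by rewrite mul0r.
    by case/negP: ne_l; apply/eqP/val_inj => /=; lia.
  rewrite off_eE off_fE /= prednK ?eqxx; last by lia.
  rewrite lt_i !andbT ifT; last by lia.
  rewrite -val_eqE /= [j == i :> nat]eq_sym.
  have [<-|ne_ij] := eqVneq (i : nat) j; last by rewrite !andbF mulr0 mulr0n.
  by rewrite (_ : _ && _ = true) ?mulr1 ?mulr1n //; lia.
apply/matrixP => i j; rewrite mxE [X in _ + X]mxE ef fe off_hE -mulrnBl.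
congr (_ *+ _); rewrite /c /c' /off_wt; case: ifP => [/andP[le_i lt_i]|_]; last first.
  by rewrite subr0.
rewrite /fcoef !intrB intrM -!pmulrn.
have -> : (i.+1 - n = (i - n).+1)%N by lia.
have -> : r%:R = (i - n)%:R + (r - (i - n).+1)%:R + 1 :> K.
  by rewrite -natrD natr1; congr (1 *+ _); lia.
have -> : (r - (i - n) = (r - (i - n).+1).+1)%N by lia.
rewrite !natrM -![_.+1%:R]natr1; ring.
Qed.

Lemma off_triple (U : {vspace 'M[K]_k}) : off_e \in U ->
  (forall a b, a \in U -> b \in U -> commx a b \in U) ->
  (forall a, a \in U -> star off_d a \in U) ->
  (forall t a, a \in U -> comp off_wt t a \in U) ->
  graded_triple U off_e off_h off_f off_wt off_d.
Proof.
move=> Ue lieU starU compU; split=> //.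
- exact: off_d_gt0.
- exact: off_hE.
- exact: off_ef.
- exact: off_starE.
- exact: off_deg.
- exact: off_bound.
Qed.

End OffsetTriple.

(** * Hamiltonian vectors and their brackets in block form *)

Section ModelBracket.
Variables (K : fieldType) (p r : nat) (A : 'M[K]_p) (b : 'cV[K]_p) (c : 'rV[K]_p).
Variable E : 'M[K]_r.
Hypotheses (hE : hessenberg E) (r_gt0 : (0 < r)%N).
Local Notation X := (slice_mx A b c E).
Local Notation e1 := (eps1 K r).
Local Notation er := (epsr K r).
Implicit Types (M : 'M[K]_p) (y : 'cV[K]_p) (x : 'rV[K]_p).

Lemma tr11 (M : 'M[K]_1) : M^T 0 0 = M 0 0.
Proof. by rewrite mxE. Qed.

Lemma scalar_tr n (u : 'cV[K]_n) (v : 'rV[K]_n) : \tr (u *m v) = (v *m u) 0 0.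
Proof. by rewrite mxtrace_mulC /mxtrace big_ord1. Qed.

Definition ham_right y : 'M[K]_(p, r) := ham_mx E A y e1^T.
(** The construction of [ham_right] for the transposed data, which exchanges the first and the last
    basis vector of the middle block. *)
Definition ham_left x : 'M[K]_(r, p) := (ham_mx E^T A^T x^T er^T)^T.

(* The Hamiltonian vector of the linear function of A, c, b given by M, y, x. *)
Definition ham_block M y x : 'M[K]_(p + r) :=
  block_mx M (ham_right y) (ham_left x) 0.

Lemma ham_right_epsr y : ham_right y *m er = y.
Proof. exact: ham_mx_epsr. Qed.

Lemma eps1_ham_left x : e1^T *m ham_left x = x.
Proof.
have hr i : (i < r)%N -> er^T *m adj_coef E^T i *m e1 = (i == r.-1)%:R%:M.
  move=> lt_i; rewrite adj_coef_tr; apply: (can_inj (@trmxK _ _ _)).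
  by rewrite !trmx_mul !trmxK mulmxA adj_coef_corner // tr_scalar_mx.
apply: (can_inj (@trmxK _ _ _)); rewrite trmx_mul !trmxK /ham_mx mulmx_suml.
rewrite (bigD1 (Ordinal r_gt0)) //= big1 ?addr0 => [|i ne_i]; last first.
  rewrite -(mulmxA _ _ e1) hr; last by lia.
  rewrite (_ : (_ == _) = false) ?scalemx0 ?raddf0 ?mulmx0 //.
  by move: ne_i; rewrite -val_eqE /=; have := ltn_ord i; lia.
rewrite -(mulmxA _ _ e1) hr; last by lia.
by rewrite subn0 eqxx mulmx1 expr0 mul1mx.
Qed.

Lemma ham_vec_tr x y : (x *m ham_vec E A y) 0 0 = ((ham_vec E^T A^T x^T)^T *m y) 0 0.
Proof.
rewrite ham_vecE -[RHS]tr11 trmx_mul trmxK ham_vecE.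
apply: eq_bigr => i _; rewrite det1B_tr; congr (_ * _).
by rewrite -trmx_exp -[RHS]tr11 !trmx_mul !trmxK mulmxA.
Qed.

(** Outside the corner block, the commutator lives in the first column and the last row of the
    middle, the same places as b and c; these are entries of degree at most 0. *)
Lemma commx_ham_block M y x : commx X (ham_block M y x) =
  block_mx (commx A M - y *m c + b *m x) ((ham_vec E A y - M *m b) *m e1^T)
    (er *m (c *m M - (ham_vec E^T A^T x^T)^T))
    (er *m c *m ham_right y - ham_left x *m b *m e1^T).
Proof.
have hr : A *m ham_right y - ham_right y *m E = ham_vec E A y *m e1^T.
  exact: ham_mxE.
have hl : E *m ham_left x - ham_left x *m A = - (er *m (ham_vec E^T A^T x^T)^T).
  have := ham_mxE E^T A^T x^T er^T => /(congr1 trmx).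
  rewrite raddfB /= !trmx_mul !trmxK => <-.
  by rewrite opprB.
rewrite /commx /slice_mx /ham_block !mulmx_block opp_block_mx add_block_mx.
rewrite !mulmx0 !mul0mx !addr0; congr block_mx.
- rewrite -[b *m _ *m _]mulmxA eps1_ham_left mulmxA ham_right_epsr.
  by rewrite opprD addrACA [b *m x - _]addrC addrA.
- rewrite mulmxBl opprD addrCA [RHS]addrC mulmxA; congr (_ + _); exact: hr.
- by rewrite addrAC mulmxBr -mulmxA -addrA; congr (_ + _); rewrite addrC hl.
by rewrite mulmxA.
Qed.

Lemma trform_ham_block M y x v11 v12 v21 v22 :
  trform (ham_block M y x) (block_mx v11 (v12 *m e1^T) (er *m v21) v22) =
  trform M v11 + (v21 *m y) 0 0 + (x *m v12) 0 0.
Proof.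
rewrite /trform mulmx_block mxtrace_block mul0mx addr0 raddfD /=.
rewrite mulmxA ham_right_epsr scalar_tr; congr (_ + _).
by rewrite mulmxA mxtrace_mulC mulmxA eps1_ham_left /mxtrace big_ord1.
Qed.

Lemma model_bracket M y x M' y' x' :
  trform (commx X (ham_block M y x)) (ham_block M' y' x') =
  trform A (commx M M') + (c *m (M *m y' - M' *m y)) 0 0
  + ((x *m M' - x' *m M) *m b) 0 0
  + (x' *m ham_vec E A y) 0 0 - (x *m ham_vec E A y') 0 0.
Proof.
rewrite trformC commx_ham_block trform_ham_block.
rewrite trformDr trformBr [trform M' (commx A M)]trformC trform_commx.
have -> : trform M' (y *m c) = (c *m (M' *m y)) 0 0.
  by rewrite /trform mulmxA scalar_tr.
have -> : trform M' (b *m x) = (x *m M' *m b) 0 0.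
  by rewrite /trform mulmxA scalar_tr mulmxA.
have mxB (P Q : 'M[K]_1) : (P - Q) 0 0 = P 0 0 - Q 0 0 by rewrite !mxE.
rewrite !mulmxBl !mulmxBr !mxB !mulmxA (ham_vec_tr x y').
move: (trform A _) => t; ring.
Qed.

End ModelBracket.

(** * Morphisms of symmetric algebras, gradients of determinants, bijectivity *)

Section SymMorphism.
Variables (K : fieldType) (V W : vectType K) (theta : {linear V -> Sym W}).

Definition sym_morph : {lrmorphism Sym V -> Sym W} :=
  comp_mpoly [tuple theta (symb i) | i < \dim {:V}].

Lemma sym_morph_symg u : sym_morph (symg u) = theta u.
Proof.
rewrite /sym_morph /= /symg raddf_sum /= [in RHS](coord_vbasis (memvf u)) linear_sum.
apply: eq_bigr => i _; rewrite [in RHS]linearZ comp_mpolyZ comp_mpolyXU.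
by rewrite -tnth_nth tnth_mktuple.
Qed.

End SymMorphism.

Section DetGradient.
Variables (K : fieldType) (k : nat).
Implicit Types X v : 'M[K]_k.

(* The gradient at X of the coefficient of z^(j+1) in det (1 + z X). *)
Definition det_grad X j : 'M[K]_k :=
  \matrix_(a, b) (\adj (1%:M + 'X *: map_mx polyC X) a b)`_j.

(** The adjugate of 1 + z X commutes with 1 + z X, hence with z X, and z can be cancelled. *)
Lemma commx_det_grad X j : commx X (det_grad X j) = 0.
Proof.
set N := 1%:M + 'X *: map_mx polyC X.
have E : \adj N *m map_mx polyC X = map_mx polyC X *m \adj N.
  have EN : \adj N *m N = N *m \adj N by rewrite mul_adj_mx mul_mx_adj.
  move: EN; rewrite {2 3}/N mulmxDr mulmxDl mulmx1 mul1mx.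
  move/addrI; rewrite -scalemxAr -scalemxAl => E.
  apply/matrixP => a b; move/matrixP/(_ a b): E; rewrite [LHS]mxE [RHS]mxE.
  by rewrite -['X]/('X^1); apply: polyXn_lreg.
apply/matrixP => a b; have /matrixP/(_ b) := E.
have /matrixP/(_ a b)/(congr1 (fun q : {poly K} => q`_j)) := E.
rewrite !mxE !coef_sum => EE _.
apply/eqP; rewrite subr_eq0; apply/eqP; apply: etrans (etrans (esym EE) _).
  by apply: eq_bigr => l _; rewrite !mxE coefCM.
by apply: eq_bigr => l _; rewrite !mxE coefMC.
Qed.

End DetGradient.

Section ThetaPoints.
Variables (K : numClosedFieldType) (k : nat) (U : {vspace 'M[K]_k}).
Variables (e h f : 'M[K]_k) (hh : 'I_k -> int) (d : 'I_k -> K).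
Hypothesis gt : graded_triple U e h f hh d.
Local Notation z := (centr U e).
Local Notation T := (subvs_of z).
Local Notation S := (Sym T).

Section UniversalDet.
Variable Y : 'M[S]_k.
Hypothesis YE : forall X, slice U e f X -> forall a b, fval (Y a b) X = X a b.
Hypothesis Y_deriv : forall X v, v \in U -> commx f v = 0 -> forall a b,
  \sum_i fval (Y a b)^`M(i) X * trform (vsval (symb i : T)) v = v a b.

Let ev X : {rmorphism S -> K} := meval (fun i => trform (vsval (symb i : T)) X).

Lemma map_1DX X : slice U e f X ->
  map_mx (map_poly (ev X)) (1%:M + 'X *: map_mx polyC Y) =
  1%:M + 'X *: map_mx polyC X.
Proof.
move=> SX; apply/matrixP => a b; rewrite !mxE rmorphD rmorphM /= rmorph_nat.
by rewrite map_polyX map_polyC /= -[in RHS](YE SX).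
Qed.

Lemma fval_det1D X j : slice U e f X -> fval (det1D Y)`_j X = (det1D X)`_j.
Proof.
move=> SX; rewrite -[LHS]/(ev X _) -coef_map /det1D -det_map_mx.
by rewrite map_1DX.
Qed.

Lemma grad_det1D X j v : slice U e f X -> v \in U -> commx f v = 0 ->
  trform (vsval (grad X (det1D Y)`_j.+1)) v = trform (det_grad X j) v.
Proof.
move=> SX Uv fv0; rewrite trform_grad.
under eq_bigr => i _.
  have DM p q : mderiv i (p * q) = mderiv i p * q + p * mderiv i q :> S.
    exact: mderivM.
  rewrite (@derivation_det1D S (mderiv i) _ Y j DM) fval_sum mulr_suml.
  under eq_bigr => a _.
    rewrite fval_sum mulr_suml; under eq_bigr => b _ do rewrite fvalM -mulrA.
    over.
  over.
rewrite exchange_big trformE /=; apply: eq_bigr => a _; rewrite exchange_big /=.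
apply: eq_bigr => b _; rewrite -mulr_sumr Y_deriv //; congr (_ * _).
by rewrite [RHS]mxE -(map_1DX SX) -map_mx_adj [in RHS]mxE coef_map.
Qed.

End UniversalDet.

Section Bijective.
Variables (V : vectType K) (Theta : {lrmorphism Sym V -> S}).

Lemma fval_Theta (q : Sym V) X :
  fval (Theta q) X = q.@[fun i => fval (Theta (symg (symb i))) X].
Proof.
elim/mpolyind: q => [|c m q _ _ IHq].
  by rewrite meval0 [Theta 0]raddf0 /fval /symev meval0.
have -> : Theta (c *: 'X_[m] + q) = c *: Theta 'X_[m] + Theta q.
  by rewrite [Theta (_ + _)]raddfD /= -[Theta (c *: _)]/(Theta _) linearZ.
rewrite mevalD mevalZ fvalD fvalZ IHq; congr (_ * _ + _).
rewrite mevalX mpolyXE_id [Theta _]rmorph_prod.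
rewrite /fval /symev rmorph_prod; apply: eq_bigr => i _.
by rewrite /= rmorphXn rmorphXn symg_symb.
Qed.

Variable XH : 'M[Sym V]_k.
Local Notation pt phi := (map_mx (meval phi) XH).
Hypothesis slice_pt : forall phi : 'I_(\dim {:V}) -> K, slice U e f (pt phi).
Hypothesis coord_pt : forall (phi : 'I_(\dim {:V}) -> K) u,
  fval (Theta (symg u)) (pt phi) = (symg u).@[phi].
Hypothesis coord_inj : forall X X', slice U e f X -> slice U e f X' ->
  (forall u, fval (Theta (symg u)) X = fval (Theta (symg u)) X') -> X = X'.

(** [XH] is a point of the slice with coordinates in S(V); evaluating functions on the slice at it
    gives the inverse. Both composites are compared at points, where [coord_pt] and [coord_inj]
    decide. *)
Lemma Theta_bijective : bijective Theta.
Proof.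
pose t := [tuple \sum_a \sum_b vsval (symb i : T) a b *: XH b a | i < \dim {:T}].
pose Psi (q : S) : Sym V := q \mPo t.
have PsiE q phi : (Psi q).@[phi] = fval q (pt phi).
  rewrite /Psi comp_mpoly_meval /fval /symev; apply: meval_eq => i.
  rewrite tnth_mktuple trformE raddf_sum; apply: eq_bigr => a _.
  by rewrite raddf_sum; apply: eq_bigr => b _; rewrite /= mevalZ mxE.
exists Psi => q.
  apply/eqP; rewrite -subr_eq0; apply/eqP/mpoly_fun_eq0 => phi.
  rewrite mevalB PsiE fval_Theta (meval_eq _ (v2 := phi)) ?subrr // => i.
  by rewrite coord_pt symg_symb mevalXU.
apply: (slice_fun_inj gt) => X SX; rewrite fval_Theta PsiE; congr (fval q _).
by apply: coord_inj => // u; rewrite coord_pt fval_Theta.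
Qed.

End Bijective.
End ThetaPoints.
(* The entries of the slice: the corner indices are numbered by gam and the middle
   ones are n, ..., n + r - 1. *)
Section OffsetSlice.
Variables (K : numClosedFieldType) (k n r p : nat).
Hypothesis le_nr : (n + r <= k)%N.
Variable gam : 'I_p -> 'I_k.
Hypothesis gam_out : forall a, ~~ (n <= gam a < n + r)%N.
Local Notation f := (off_f K k n r).
Implicit Types Y : 'M[K]_k.

Lemma mid_proof (x : 'I_r) : (n + x < k)%N.
Proof. by have := ltn_ord x; lia. Qed.
Definition mid (x : 'I_r) : 'I_k := Ordinal (mid_proof x).

Definition blk_index (i : 'I_(p + r)) : 'I_k :=
  match split i with inl a => gam a | inr x => mid x end.

Lemma blk_indexl a : blk_index (lshift r a) = gam a.
Proof. by rewrite /blk_index (unsplitK (inl a)). Qed.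
Lemma blk_indexr x : blk_index (rshift p x) = mid x.
Proof. by rewrite /blk_index (unsplitK (inr x)). Qed.

Definition blk (S : Type) (X : 'M[S]_k) : 'M[S]_(p + r) :=
  \matrix_(i, j) X (blk_index i) (blk_index j).

Lemma mul_fl (x : 'I_k) Y (i j : 'I_k) : (n <= x)%N -> (i < n + r)%N ->
  i = x.+1 :> nat -> (f *m Y) i j = fcoef K r (i - n) * Y x j.
Proof.
move=> le_x lt_i ix; rewrite mxE (bigD1 x) //= big1 ?addr0 => [|l ne_l].
  by rewrite (off_fE K le_nr) le_x lt_i ix eqxx.
rewrite (off_fE K le_nr); case: and3P => [[_ _ /eqP li]|_]; last by rewrite mul0r.
by case/negP: ne_l; apply/eqP/val_inj => /=; lia.
Qed.

Lemma mul_fl0 Y (i j : 'I_k) : ~~ (n < i < n + r)%N -> (f *m Y) i j = 0.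
Proof.
move=> out; rewrite mxE big1 // => l _; rewrite (off_fE K le_nr).
by case: and3P => [[? ? /eqP ?]|_]; rewrite ?mul0r //; lia.
Qed.

Lemma mul_fr (y : 'I_k) Y (i j : 'I_k) : (n <= j)%N -> (y < n + r)%N ->
  y = j.+1 :> nat -> (Y *m f) i j = Y i y * fcoef K r (y - n).
Proof.
move=> le_j lt_y yj; rewrite mxE (bigD1 y) //= big1 ?addr0 => [|l ne_l].
  by rewrite (off_fE K le_nr) le_j lt_y yj eqxx.
rewrite (off_fE K le_nr); case: and3P => [[_ _ /eqP li]|_]; last by rewrite mulr0.
by case/negP: ne_l; apply/eqP/val_inj => /=; lia.
Qed.

Lemma mul_fr0 Y (i j : 'I_k) : ~~ ((n <= j)%N && (j.+1 < n + r)%N) -> (Y *m f) i j = 0.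
Proof.
move=> out; rewrite mxE big1 // => l _; rewrite (off_fE K le_nr).
by case: and3P => [[? ? /eqP ?]|_]; rewrite ?mulr0 //; lia.
Qed.

Lemma fcoef_neq0 (i : nat) : (0 < i < r)%N -> fcoef K r i != 0.
Proof. by move/(fcoef_gt0 K)/gt_eqF ->. Qed.

Lemma kerf_comm Y : commx f Y = 0 -> f *m Y = Y *m f.
Proof. by move/eqP; rewrite subr_eq0 => /eqP. Qed.

(** In a corner row f Y is zero, while Y f is a nonzero multiple of Y shifted by one column. *)
Lemma kerf_corner_mid Y (i j : 'I_k) : commx f Y = 0 ->
  ~~ (n <= i < n + r)%N -> (n < j < n + r)%N -> Y i j = 0.
Proof.
move=> /kerf_comm/matrixP fY out in_j.
have lt_j : (j.-1 < k)%N by have := ltn_ord j; lia.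
have := fY i (Ordinal lt_j); rewrite mul_fl0; last by lia.
rewrite (@mul_fr j) /=; [|lia|lia|lia].
move/esym/eqP; rewrite mulf_eq0 => /orP[/eqP -> //|].
by rewrite (negbTE (fcoef_neq0 _)) //; lia.
Qed.

Lemma kerf_mid_corner Y (i j : 'I_k) : commx f Y = 0 ->
  ~~ (n <= j < n + r)%N -> (n <= i)%N -> (i.+1 < n + r)%N -> Y i j = 0.
Proof.
move=> /kerf_comm/matrixP fY out le_i lt_i1.
have lt_i : (i.+1 < k)%N by lia.
have := fY (Ordinal lt_i) j; rewrite mul_fr0; last by lia.
rewrite (@mul_fl i) //= => /eqP; rewrite mulf_eq0 => /orP[|/eqP -> //].
by rewrite (negbTE (fcoef_neq0 _)) //; lia.
Qed.

Lemma fprod_shift (x y : nat) : (y < x)%N ->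
  fcoef K r x * fprod K r x.-1 y = fprod K r x y.+1 * fcoef K r y.+1.
Proof.
move=> lt_yx; rewrite mulrC /fprod prednK; last by lia.
transitivity (\prod_(y.+1 <= i < x.+1) fcoef K r i).
  by rewrite [RHS]big_nat_recr.
by rewrite big_ltn 1?mulrC // ltnS.
Qed.

(** Comparing f Y and Y f determines each column of the middle block from the preceding one, so the
    first column, suitably normalized, gives the coefficients of a polynomial in f. *)
Lemma kerf_mid Y : commx f Y = 0 -> exists a : nat -> K^o,
  forall x y : 'I_r, Y (mid x) (mid y) = toep r a x y.
Proof.
move=> /kerf_comm/matrixP fY.
have [r0|r_gt0] := posnP r.
  by exists (fun=> 0) => x; have := ltn_ord x; rewrite {2}r0.
pose o : 'I_r := Ordinal r_gt0.
exists (fun j => if insub j is Some x then Y (mid x) (mid o) / fprod K r x 0 else 0).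
move=> x [y lt_y]; elim: y lt_y x => [|y IHy] lt_y x.
  rewrite mxE /= subn0 insubT ?ltn_ord //= => lt_x.
  rewrite (_ : Sub _ _ = x); last exact: val_inj.
  rewrite (_ : Ordinal _ = o); last exact: val_inj.
  by rewrite /GRing.scale /= mulrC divfK // gt_eqF // fprod_gt0.
have lt_y' : (y < r)%N by lia.
pose y1 : 'I_r := Ordinal lt_y; pose y0 : 'I_r := Ordinal lt_y'.
have rec := fY (mid x) (mid y0).
rewrite (@mul_fr (mid y1)) /= in rec; [|lia|lia|lia].
have nz : fcoef K r (n + y.+1 - n) != 0 by apply: fcoef_neq0; lia.
apply: (mulIf nz); rewrite -rec {rec}.
have [x0|x_gt0] := posnP x.
  rewrite mul_fl0 /=; last by lia.
  by rewrite mxE x0 /= mul0r.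
have lt_x' : (x.-1 < r)%N by have := ltn_ord x; lia.
rewrite (@mul_fl (mid (Ordinal lt_x'))) /=; [|lia|by have := ltn_ord x; lia|lia].
rewrite (IHy lt_y' (Ordinal lt_x')) !mxE /=.
have -> : (y <= x.-1)%N = (y.+1 <= x)%N by lia.
have [lt_yx|_] := ltnP y x; last by rewrite [LHS]mulr0 [RHS]mul0r.
have -> : (x.-1 - y = x - y.+1)%N by lia.
rewrite /GRing.scale /=; move: (match insub _ with Some _ => _ | None => _ end) => t.
rewrite mulrA [RHS]mulrAC; congr (_ * _).
by rewrite !addKn fprod_shift.
Qed.

Lemma kerf_blk Y : commx f Y = 0 -> exists A b c (a : nat -> K^o),
  blk (off_e K k n r + Y) = slice_mx A b c (shift_mx K^o r + toep r a).
Proof.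
move=> fY; have [a aE] := kerf_mid fY.
pose o (j : nat) : 'M[K]_k -> 'I_k -> 'I_k -> K := fun M i j => M i j.
exists (\matrix_(i, j) Y (gam i) (gam j)).
exists (\col_i \sum_(y < r | y == 0%N :> nat) Y (gam i) (mid y)).
exists (\row_j \sum_(x < r | x.+1 == r) Y (mid x) (gam j)).
exists a; apply/matrixP => i j; rewrite mxE [LHS]mxE (off_eE K le_nr).
case: (split_ordP i) => i' ->; case: (split_ordP j) => j' ->.
- rewrite block_mxEul !blk_indexl mxE (_ : [&& _, _ & _] = false) ?add0r //.
  by have := gam_out i'; have := gam_out j'; lia.
- rewrite block_mxEur blk_indexl blk_indexr mul_colrow eps1E mxE.
  rewrite (_ : [&& _, _ & _] = false) ?add0r; last first.
    by have := gam_out i'; rewrite /=; have := ltn_ord j'; lia.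
  have [j0|j_gt0] := posnP j'; rewrite ?mulr1 ?mulr0.
    rewrite (bigD1 j') ?j0 //= big1 ?addr0 // => y /andP[/eqP y0 /eqP []].
    by apply: val_inj; rewrite /= y0 j0.
  by apply: kerf_corner_mid => //=; have := ltn_ord j'; lia.
- rewrite block_mxEdl blk_indexl blk_indexr mul_colrow epsrE mxE.
  rewrite (_ : [&& _, _ & _] = false) ?add0r; last first.
    by have := gam_out j'; rewrite /=; have := ltn_ord i'; lia.
  have [ir|ne_r] := eqVneq i'.+1 r; rewrite ?mul1r ?mul0r.
    rewrite (bigD1 i') ?ir //= big1 ?addr0 // => y /andP[/eqP y0 /eqP []].
    by apply: val_inj; rewrite /=; lia.
  by apply: kerf_mid_corner => //=; have := ltn_ord i'; lia.
rewrite block_mxEdr !blk_indexr mxE aE; congr (_ + _).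
rewrite mxE /=; congr (_%:R); have := ltn_ord j'; lia.
Qed.

Hypothesis blk_index_surj : forall i, exists i', i = blk_index i'.

Lemma blk_inj (S : Type) : injective (@blk S).
Proof.
move=> X X' XX'; apply/matrixP => i j.
have [i' ->] := blk_index_surj i; have [j' ->] := blk_index_surj j.
by move/matrixP/(_ i' j'): XX'; rewrite !mxE.
Qed.

(** The converse of [kerf_blk]. The case distinctions below separate the first middle row and the
    last middle column, where f Y, respectively Y f, has no term. *)
Lemma blk_kerf (X : 'M[K]_k) A b c (a : nat -> K^o) :
  blk X = slice_mx A b c (shift_mx K^o r + toep r a) ->
  commx f (X - off_e K k n r) = 0.
Proof.
move=> XE; set Y := X - _.
have entry i j : Y (blk_index i) (blk_index j) =
    slice_mx A b c (shift_mx K^o r + toep r a) i j - off_e K k n r (blk_index i) (blk_index j).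
  by rewrite -XE !mxE.
have Y_gm i (y : 'I_r) : (0 < y)%N -> Y (gam i) (mid y) = 0.
  move=> y_gt0; rewrite -blk_indexl -blk_indexr entry block_mxEur mul_colrow eps1E.
  rewrite (gtn_eqF y_gt0) mulr0 (off_eE K le_nr) blk_indexl blk_indexr.
  by rewrite (_ : [&& _, _ & _] = false) ?subr0 //; have := gam_out i; have := ltn_ord y; rewrite /=; lia.
have Y_mg (x : 'I_r) j : (x.+1 < r)%N -> Y (mid x) (gam j) = 0.
  move=> lt_x; rewrite -blk_indexl -blk_indexr entry block_mxEdl mul_colrow epsrE.
  rewrite (ltn_eqF lt_x) mul0r (off_eE K le_nr) blk_indexl blk_indexr.
  by rewrite (_ : [&& _, _ & _] = false) ?subr0 //; have := gam_out j; rewrite /=; lia.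
have Y_mm (x y : 'I_r) : Y (mid x) (mid y) = toep r a x y.
  have eqm : (shift_mx K^o r + toep r a) x y = (y == x.+1 :> nat)%:R + toep r a x y.
    by rewrite mxE; congr (_ + _); rewrite mxE.
  rewrite -!blk_indexr entry block_mxEdr (off_eE K le_nr) !blk_indexr eqm.
  rewrite (_ : [&& _, _ & _] = (y == x.+1 :> nat)); last first.
    by rewrite /=; have := ltn_ord y; lia.
  by rewrite addrAC subrr add0r.
have mid_lt (x : 'I_r) : (mid x < n + r)%N by rewrite /= ltn_add2l.
apply/eqP; rewrite subr_eq0; apply/eqP/matrixP => i j.
have [i' ->] := blk_index_surj i; have [j' ->] := blk_index_surj j.
case: (split_ordP i') => {}i' ->; rewrite ?blk_indexl ?blk_indexr.
  rewrite mul_fl0; last by have := gam_out i'; lia.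
  have [/andP[le_j lt_j]|out] := boolP ((n <= blk_index j') && ((blk_index j').+1 < n + r))%N;
    last by rewrite mul_fr0.
  have lt_r : ((blk_index j').+1 - n < r)%N by lia.
  rewrite (@mul_fr (mid (Ordinal lt_r))) ?Y_gm ?mul0r //=; lia.
have fl_pos (x : 'I_r) (j0 : 'I_k) : (0 < x)%N -> exists x' : 'I_r, x = x'.+1 :> nat /\
    (f *m Y) (mid x) j0 = fcoef K r x * Y (mid x') j0.
  move=> x_gt0; have lt_x' : (x.-1 < r)%N by have := ltn_ord x; lia.
  exists (Ordinal lt_x'); split=> /=; first by rewrite prednK.
  have E : (f *m Y) (mid x) j0 = fcoef K r (mid x - n) * Y (mid (Ordinal lt_x')) j0.
    by have lt_x := ltn_ord x; apply: mul_fl; rewrite /=; lia.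
  by rewrite E /= addKn.
have fl0 (x : 'I_r) (j0 : 'I_k) : x = 0%N :> nat -> (f *m Y) (mid x) j0 = 0.
  by move=> x0; rewrite mul_fl0 //= x0; lia.
case: (split_ordP j') => {}j' ->; rewrite ?blk_indexl ?blk_indexr.
  rewrite mul_fr0; last by have := gam_out j'; lia.
  have [x0|/(fl_pos _ (gam j'))[x' [xx' ->]]] := posnP i'; first exact: fl0.
  by rewrite Y_mg ?mulr0 // -xx'.
have fr_pos (x y : 'I_r) : (y.+1 < r)%N -> exists y' : 'I_r, y' = y.+1 :> nat /\
    (Y *m f) (mid x) (mid y) = Y (mid x) (mid y') * fcoef K r y.+1.
  move=> lt_y; exists (Ordinal lt_y); split=> //.
  have E : (Y *m f) (mid x) (mid y) =
      Y (mid x) (mid (Ordinal lt_y)) * fcoef K r (mid (Ordinal lt_y) - n).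
    by apply: mul_fr; rewrite /=; lia.
  by rewrite E /= addKn.
have fr0 (x y : 'I_r) : (r <= y.+1)%N -> (Y *m f) (mid x) (mid y) = 0.
  by move=> ge_y; rewrite mul_fr0 //=; lia.
have [x0|x_gt0] := posnP i'.
  rewrite fl0 //; have [lt_y|ge_y] := ltnP j'.+1 r; last by rewrite fr0.
  have [y' [yy' ->]] := fr_pos i' j' lt_y.
  by rewrite Y_mm mxE x0 yy' /= mul0r.
have [x' [xx' ->]] := fl_pos i' (mid j') x_gt0.
have [lt_y|ge_y] := ltnP j'.+1 r; last first.
  rewrite fr0 // Y_mm mxE leqNgt (_ : (x' < j')%N) ?mulr0 //.
  by have := ltn_ord i'; have := ltn_ord j'; lia.
have [y' [yy' ->]] := fr_pos i' j' lt_y.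
rewrite !Y_mm !mxE yy' xx' ltnS subSS; case: leqP => [le_ji|_]; last by rewrite mulr0 mul0r.
rewrite /GRing.scale /= mulrA [RHS]mulrAC; congr (_ * _).
by rewrite -fprod_shift // ltnS.
Qed.

End OffsetSlice.
Lemma eps1_dot (S : comNzRingType) r : (0 < r)%N -> (eps1 S r)^T *m eps1 S r = 1%:M.
Proof.
move=> r_gt0; apply/matrixP => i j.
rewrite !ord1 mxE (bigD1 (Ordinal r_gt0)) //= big1 => [|l ne_l].
  by rewrite !mxE eqxx mulr1 addr0.
by rewrite !mxE (_ : (l == 0%N :> nat) = false) ?mul0r //; apply/negbTE.
Qed.

Lemma epsr_dot (S : comNzRingType) r : (0 < r)%N -> (epsr S r)^T *m epsr S r = 1%:M.
Proof.
move=> r_gt0; have lt_r : (r.-1 < r)%N by lia.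
apply/matrixP => i j; rewrite !ord1 mxE (bigD1 (Ordinal lt_r)) //= big1 => [|l ne_l].
  by rewrite !mxE /= prednK // eqxx mulr1 addr0.
rewrite !mxE (_ : (l.+1 == r) = false) ?mul0r //; apply: contraNF ne_l => /eqP lr.
by apply/eqP/val_inj => /=; lia.
Qed.

(** * From block matrices back to the Lie algebra *)

Section BlockTransport.
Variables (K : numClosedFieldType) (k n r p : nat).
Hypotheses (le_nr : (n + r <= k)%N) (r_gt0 : (0 < r)%N).
Variable gam : 'I_p -> 'I_k.
Hypothesis gam_out : forall a, ~~ (n <= gam a < n + r)%N.
Local Notation bi := (blk_index le_nr gam).
Hypothesis bi_bij : bijective bi.
Local Notation blk := (blk le_nr gam).
Local Notation f := (off_f K k n r).
Local Notation e := (off_e K k n r).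

Lemma bi_surj i : exists i', i = bi i'.
Proof. by have [g _ gK] := bi_bij; exists (g i). Qed.

Definition unblk_mx (S : comNzRingType) : 'M[S]_(k, p + r) :=
  \matrix_(i, j) (i == bi j)%:R.

Definition unblk (S : comNzRingType) (M : 'M[S]_(p + r)) : 'M[S]_k :=
  unblk_mx S *m M *m (unblk_mx S)^T.

Lemma unblk_mx_left (S : comNzRingType) : (unblk_mx S)^T *m unblk_mx S = 1%:M.
Proof.
apply/matrixP => i j; rewrite !mxE (bigD1 (bi i)) //= big1 ?addr0 => [|l ne_l].
  by rewrite !mxE eqxx mul1r (bij_eq bi_bij).
by rewrite !mxE (negbTE ne_l) mul0r.
Qed.

Lemma blkE (S : comNzRingType) (X : 'M[S]_k) : blk X = (unblk_mx S)^T *m X *m unblk_mx S.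
Proof.
apply/matrixP => i j; rewrite !mxE (bigD1 (bi j)) //= big1 ?addr0 => [|l ne_l].
  rewrite !mxE eqxx mulr1 (bigD1 (bi i)) //= big1 ?addr0 => [|l ne_l].
    by rewrite !mxE eqxx mul1r.
  by rewrite !mxE (negbTE ne_l) mul0r.
by rewrite [X in _ * X]mxE (negbTE ne_l) mulr0.
Qed.

Lemma unblkK (S : comNzRingType) : cancel (@unblk S) (@blk S).
Proof.
move=> M; rewrite blkE /unblk !mulmxA unblk_mx_left mul1mx.
by rewrite -mulmxA unblk_mx_left mulmx1.
Qed.

Lemma blkK (S : comNzRingType) : cancel (@blk S) (@unblk S).
Proof. by move=> X; apply: (blk_inj bi_surj); rewrite unblkK. Qed.

Lemma blkM (S : comNzRingType) (X Y : 'M[S]_k) : blk (X *m Y) = blk X *m blk Y.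
Proof.
apply/matrixP => i j; rewrite !mxE (reindex bi) /=; last exact: onW_bij.
by apply: eq_bigr => l _; rewrite !mxE.
Qed.

Lemma blk_tr (S : comNzRingType) (X : 'M[S]_k) : \tr (blk X) = \tr X.
Proof.
rewrite /mxtrace [RHS](reindex bi) /=; last exact: onW_bij.
by apply: eq_bigr => l _; rewrite !mxE.
Qed.

Lemma blk_trform (X Y : 'M[K]_k) : trform X Y = trform (blk X) (blk Y).
Proof. by rewrite /trform -blkM blk_tr. Qed.

Lemma blkB (S : comNzRingType) (X Y : 'M[S]_k) : blk (X - Y) = blk X - blk Y.
Proof. by apply/matrixP => i j; rewrite !mxE. Qed.

Lemma blk_commx (X Y : 'M[K]_k) : blk (commx X Y) = commx (blk X) (blk Y).
Proof. by rewrite /commx blkB !blkM. Qed.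

Lemma blk_det1B (S : comNzRingType) (X : 'M[S]_k) : det1B (blk X) = det1B X.
Proof.
rewrite -[in RHS](blkK X) /unblk; apply/esym/det1B_embed.
exact: unblk_mx_left.
Qed.

Lemma unblk_trform (M : 'M[K]_(p + r)) X : trform (unblk M) X = trform M (blk X).
Proof. by rewrite blk_trform unblkK. Qed.

Fact unblk_is_linear : linear (@unblk K).
Proof. by move=> t M M'; rewrite /unblk mulmxDr mulmxDl -scalemxAr -scalemxAl. Qed.

Implicit Types (M : 'M[K]_p) (y : 'cV[K]_p) (x : 'rV[K]_p).

(** y goes to the last middle column and x to the first middle row, the places that the trace form
    pairs with c and b. *)
Definition iota M y x : 'M[K]_k :=
  unblk (block_mx M (y *m (epsr K r)^T) (eps1 K r *m x) 0).

Lemma unblk_iota M y x v11 v12 v21 v22 :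
  trform (block_mx M (y *m (epsr K r)^T) (eps1 K r *m x) 0)
    (block_mx v11 (v12 *m (eps1 K r)^T) (epsr K r *m v21) v22) =
  trform M v11 + (v21 *m y) 0 0 + (x *m v12) 0 0.
Proof.
have e11 := eps1_dot K r_gt0; have err := epsr_dot K r_gt0.
rewrite /trform mulmx_block mxtrace_block mul0mx addr0 raddfD /=.
rewrite mulmxA -(mulmxA y) err mulmx1 scalar_tr; congr (_ + _ + _).
by rewrite mulmxA mxtrace_mulC !mulmxA e11 mul1mx /mxtrace big_ord1.
Qed.

Lemma iota_val M y x X A b c E : blk X = slice_mx A b c E ->
  trform (iota M y x) X = trform M A + (c *m y) 0 0 + (x *m b) 0 0.
Proof. by move=> XE; rewrite unblk_trform XE unblk_iota. Qed.

Section Hamiltonian.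
Variables (X : 'M[K]_k) (A : 'M[K]_p) (b : 'cV[K]_p) (c : 'rV[K]_p) (E : 'M[K]_r).
Hypotheses (XE : blk X = slice_mx A b c E) (hE : hessenberg E).

Definition hamU M y x : 'M[K]_k := unblk (ham_block A E M y x).

(** The block form describes points e + v of the affine slice, not tangent vectors: the two pairings
    agree at e + v and at e, and the difference is taken. *)
Lemma hamU_pair M y x v : commx f v = 0 ->
  trform (hamU M y x) v = trform (iota M y x) v.
Proof.
have eqY Y : commx f Y = 0 ->
    trform (hamU M y x) (e + Y) = trform (iota M y x) (e + Y).
  move=> /(kerf_blk le_nr gam_out)[A' [b' [c' [a YE]]]].
  rewrite !unblk_trform YE unblk_iota; exact: trform_ham_block.
move=> fv; have := eqY _ fv; have := eqY 0 (commx0r _); rewrite addr0 => e0.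
by rewrite !trformDr e0 => /addrI.
Qed.

Lemma hamU_supp M y x : supp_le (off_wt n r) 0 (commx X (hamU M y x)).
Proof.
move=> i j; have [i' ->] := bi_surj i; have [j' ->] := bi_surj j.
have -> : commx X (hamU M y x) (bi i') (bi j') = blk (commx X (hamU M y x)) i' j'.
  by rewrite [RHS]mxE.
rewrite blk_commx XE unblkK (commx_ham_block _ _ _ hE r_gt0).
have wt_gam a : off_wt n r (gam a) = 0 by rewrite /off_wt (negbTE (gam_out a)).
have wt_mid (a : 'I_r) : off_wt n r (mid le_nr a) = r%:Z - 1 - 2 * a%:Z.
  by rewrite /off_wt /= leq_addr ltn_add2l ltn_ord /= addKn.
case: (split_ordP i') => a ->; case: (split_ordP j') => a' ->.
- by rewrite !blk_indexl !wt_gam.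
- rewrite block_mxEur mul_colrow eps1E blk_indexl blk_indexr wt_gam wt_mid.
  by move/mulf_bool_neq0 => /eqP ->; lia.
- rewrite block_mxEdl mul_colrow epsrE blk_indexl blk_indexr wt_gam wt_mid.
  by rewrite mulrC; move/mulf_bool_neq0 => /eqP; lia.
rewrite block_mxEdr -[epsr K r *m c *m _]mulmxA !blk_indexr !wt_mid.
rewrite [(_ - _ : 'M_r) _ _]mxE [(- _ : 'M_r) _ _]mxE !mul_colrow epsrE eps1E.
have lt_a' := ltn_ord a'; have lt_a := ltn_ord a.
have [ar|_] := eqVneq a.+1 r; first by move=> _; lia.
have [a'0|_] := eqVneq (a' : nat) 0%N; first by move=> _; lia.
by rewrite mul0r mulr0 subr0 eqxx.
Qed.

Lemma hamU_bracket M y x M' y' x' :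
  trform (commx X (hamU M y x)) (hamU M' y' x') =
  trform A (commx M M') + (c *m (M *m y' - M' *m y)) 0 0
  + ((x *m M' - x' *m M) *m b) 0 0
  + (x' *m ham_vec E A y) 0 0 - (x *m ham_vec E A y') 0 0.
Proof.
rewrite blk_trform blk_commx !unblkK XE.
exact: model_bracket.
Qed.

End Hamiltonian.
End BlockTransport.

Lemma blk_index_bij (k n r p : nat) (le_nr : (n + r <= k)%N) (gam : 'I_p -> 'I_k) :
  (forall a, ~~ (n <= gam a < n + r)%N) -> injective gam -> k = (p + r)%N ->
  bijective (blk_index le_nr gam).
Proof.
move=> out inj kE; apply: inj_card_bij; last by rewrite !card_ord kE.
move=> i j; case: (split_ordP i) => i' ->; case: (split_ordP j) => j' ->;
  rewrite ?blk_indexl ?blk_indexr.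
- by move/inj ->.
- move=> E; have := out i'; rewrite E /=; have := ltn_ord j'; lia.
- move=> E; have := out j'; rewrite -E /=; have := ltn_ord i'; lia.
by move/(congr1 val) => /= /addnI E; congr rshift; apply: val_inj.
Qed.
Lemma det1B_D (R : comNzRingType) k (X : 'M[R]_k) j :
  (det1B X)`_j = (-1) ^+ j * (det1D X)`_j.
Proof.
have -> : det1B X = det1D X \Po (- 'X).
  rewrite /det1D -[RHS](det_map_mx (comp_poly (- 'X))) /det1B; congr (\det _).
  apply/matrixP => a b; rewrite !mxE rmorphD rmorphM rmorph_nat /=.
  by rewrite comp_polyX comp_polyC mulNr.
rewrite comp_polyE coef_sum.
have sgnC i : (-1) ^+ i = ((-1) ^+ i)%:P :> {poly R} by rewrite rmorphXn rmorphN rmorph1.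
under eq_bigr => i _ do rewrite coefZ exprNn sgnC coefCM coefXn.
have [lt_j|ge_j] := ltnP j (size (det1D X)).
  rewrite (bigD1 (Ordinal lt_j)) //= eqxx mulr1 big1 ?addr0 1?mulrC // => i ne_i.
  by rewrite (_ : (j == i) = false) ?mulr0 //; apply/negbTE; rewrite eq_sym.
rewrite (nth_default 0 ge_j) mulr0 big1 // => i _.
by rewrite gtn_eqF ?mulr0 // (leq_trans (ltn_ord i)).
Qed.

Lemma det1D_B (R : comNzRingType) k (X : 'M[R]_k) j :
  (det1D X)`_j = (-1) ^+ j * (det1B X)`_j.
Proof. by rewrite det1B_D mulrA -exprD addnn -signr_odd odd_double mul1r. Qed.

Lemma det1B_map (R S : comNzRingType) (g : {rmorphism R -> S}) k (X : 'M[R]_k) j :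
  (det1B (map_mx g X))`_j = g (det1B X)`_j.
Proof.
rewrite -coef_map /det1B -det_map_mx; congr (nth _ (polyseq (\det _)) j).
apply/matrixP => a b; rewrite !mxE rmorphB rmorphM /= rmorph_nat.
by rewrite map_polyX map_polyC.
Qed.

(** * Reduction to block computations *)

Section Reduction.
Variables (K : numClosedFieldType) (k n r p : nat).
Hypotheses (le_nr : (n + r <= k)%N) (r_gt0 : (0 < r)%N).
Variable gam : 'I_p -> 'I_k.
Hypothesis gam_out : forall a, ~~ (n <= gam a < n + r)%N.
Hypothesis bi_bij : bijective (blk_index le_nr gam).
Local Notation blk := (blk le_nr gam).
Local Notation f := (off_f K k n r).
Local Notation e := (off_e K k n r).
Local Notation h := (off_h K k n r).
Local Notation iota := (iota le_nr gam).
Local Notation hamU := (hamU le_nr gam).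

Variable U : {vspace 'M[K]_k}.
Hypothesis gt : graded_triple U e h f (off_wt n r) (off_d K n r).
Local Notation T := (subvs_of (centr U e)).

(* The orthogonal projection onto U. *)
Variable prj : {linear 'M[K]_k -> 'M[K]_k}.
Hypothesis prj_mem : forall a, prj a \in U.
Hypothesis prj_id : forall a, a \in U -> prj a = a.
Hypothesis prj_adj : forall a b, trform (prj a) b = trform a (prj b).
Hypothesis prj_commx : forall X a, X \in U -> commx X (prj a) = prj (commx X a).

Variables (V : vectType K) (q : nat).
Variables (uM : {linear V -> 'M[K]_p}) (uy : {linear V -> 'cV[K]_p}).
Variables (ux : {linear V -> 'rV[K]_p}) (uz : {linear V -> 'rV[K]_q}).
(** The j-th central generator goes to [sg j] times the coefficient of z^(dg j + 1) in det (1 + z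
    X); the shift by one matches the indexing of [det_grad]. *)
Variables (sg : 'I_q -> K) (dg : 'I_q -> nat).
Local Notation uiota u := (prj (iota (uM u) (uy u) (ux u))).
Hypothesis uiota_centr : forall u, uiota u \in centr U e.

Lemma slice_blk X : slice U e f X -> X \in U /\
  exists A b c (a : nat -> K^o), blk X = slice_mx A b c (shift_mx K^o r + toep r a).
Proof.
case/sliceP => UX fX; split; first by rewrite -(subrK e X) memvD ?(triple_mem gt).
by have := kerf_blk le_nr gam_out fX; rewrite addrC subrK.
Qed.

Lemma iotaP (t : K) (M M' : 'M[K]_p) (y y' : 'cV[K]_p) (x x' : 'rV[K]_p) :
  iota (t *: M + M') (t *: y + y') (t *: x + x') = t *: iota M y x + iota M' y' x'.
Proof.
rewrite -unblk_is_linear; congr unblk.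
rewrite scale_block_mx add_block_mx scaler0 addr0 mulmxDl mulmxDr.
by rewrite -scalemxAl -scalemxAr.
Qed.

Section Theta.
Variable Y : 'M[Sym T]_k.
Hypothesis YE : forall X, slice U e f X -> forall a b, fval (Y a b) X = X a b.
Hypothesis Y_deriv : forall X v, v \in U -> commx f v = 0 -> forall a b,
  \sum_i fval (Y a b)^`M(i) X * trform (vsval (symb i : T)) v = v a b.

Definition lin_theta (u : V) : Sym T :=
  symg (vsproj (centr U e) (uiota u)) +
  \sum_j (uz u 0 j * sg j) *: (det1D Y)`_(dg j).+1.

Fact lin_theta_is_linear : linear lin_theta.
Proof.
move=> t u v; rewrite /lin_theta !linearP /= scalerDr addrACA; congr (_ + _).
  by rewrite iotaP !linearP.
rewrite scaler_sumr -big_split; apply: eq_bigr => j _ /=.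
by rewrite scalerA -scalerDl !mxE mulrDl mulrA.
Qed.
HB.instance Definition _ :=
  GRing.isLinear.Build K V (Sym T) _ lin_theta lin_theta_is_linear.

Let Theta := sym_morph lin_theta.

Lemma Theta_symg u : Theta (symg u) = lin_theta u.
Proof. exact: sym_morph_symg. Qed.

Lemma fval_lin_theta X A b c E u : slice U e f X -> blk X = slice_mx A b c E ->
  fval (lin_theta u) X = trform (uM u) A + (c *m uy u) 0 0 + (ux u *m b) 0 0 +
    \sum_j uz u 0 j * sg j * (det1D X)`_(dg j).+1.
Proof.
move=> SX XE; have [UX _] := slice_blk SX.
rewrite fvalD fval_symg vsprojK // prj_adj prj_id // (iota_val r_gt0 bi_bij _ _ _ XE).
congr (_ + _); rewrite fval_sum; apply: eq_bigr => j _.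
by rewrite fvalZ (fval_det1D YE).
Qed.

Variable c : V -> V -> Sym V.
Hypothesis br : forall X A b c' E, slice U e f X -> hessenberg E ->
  blk X = slice_mx A b c' E -> forall u w,
  trform (commx X (hamU A E (uM u) (uy u) (ux u)))
    (prj (hamU A E (uM w) (uy w) (ux w))) = fval (Theta (c u w)) X.

(** The projection is self-adjoint and commutes with ad X for X in [U], so the conditions reduce to
    block computations; the gradients of the determinant drop out of the bracket because they
    commute with X. *)
Lemma Theta_hamiltonians X : slice U e f X ->
  exists xi, hamiltonians f (off_wt n r) c Theta X xi.
Proof.
move=> SX; have [UX [A [b [c' [a XE]]]]] := slice_blk SX.
have hE := @hessenberg_toep K K^o r a.
set E := _ + _ in XE hE.
pose H u := hamU A E (uM u) (uy u) (ux u).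
pose D u := \sum_j (uz u 0 j * sg j) *: det_grad X (dg j).
have XD u : commx X (D u) = 0.
  rewrite commx_sumr big1 // => j _; by rewrite commxZr commx_det_grad scaler0.
exists (fun u => prj (H u + D u)).
have Xxi u : commx X (prj (H u + D u)) = prj (commx X (H u)).
  by rewrite prj_commx // commxDr XD addr0.
split=> [u|u v Uv fv|u eta Ueta neg|u w].
- exact: prj_mem.
- rewrite Theta_symg /lin_theta /grad sgradD -/(grad _ _).
  rewrite prj_adj (prj_id Uv) trformDl raddfD /= trformDl; congr (_ + _).
    rewrite /grad sgrad_symg vsprojK // prj_adj prj_id //.
    exact: (hamU_pair r_gt0 gam_out bi_bij).
  rewrite /D trform_suml -/(grad _ _).
  have -> : grad X (\sum_j (uz u 0 j * sg j) *: (det1D Y)`_(dg j).+1) =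
      \sum_j (uz u 0 j * sg j) *: grad X (det1D Y)`_(dg j).+1.
    rewrite /grad; elim/big_rec2: _ => [|j x y _ <-]; last by rewrite sgradD sgradZ.
    exact: sgradC.
  rewrite trform_vsval_sum; apply: eq_bigr => j _.
  by rewrite trformZl (grad_det1D YE Y_deriv).
(* Up to sign this is the pairing of eta with [X, xi], and the degrees, at most -1 and at most 0,
   cannot add up to 0. *)
- rewrite -trform_commx trformC -trform_commx.
  rewrite commxC Xxi trformNl prj_adj prj_id //.
  have HS : supp_le (off_wt n r) 0 (commx X (H u)).
    exact: (hamU_supp r_gt0 gam_out bi_bij XE hE).
  by rewrite (trform_supp HS neg) ?oppr0.
rewrite trformC -trform_commx Xxi prj_adj prj_id ?prj_mem //.
rewrite linearD /= trformDr (br SX hE XE) trform_commx.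
rewrite [commx (H u) _]commxC trformNr -trform_commx prj_commx // XD linear0.
by rewrite trform0l subr0.
Qed.

End Theta.

Section Points.
Variables (XH : 'M[Sym V]_k) (A : 'M[Sym V]_p) (b : 'cV[Sym V]_p) (c' : 'rV[Sym V]_p).
Variable a : nat -> Sym V.
Hypothesis XHE : blk XH = toep_mx r A b c' a.

Lemma map_point (phi : 'I_(\dim {:V}) -> K) : 
  blk (map_mx (meval phi) XH) =
  slice_mx (map_mx (meval phi) A) (map_mx (meval phi) b) (map_mx (meval phi) c')
    (shift_mx K^o r + toep r (fun j => (a j).@[phi] : K^o)).
Proof.
have -> : blk (map_mx (meval phi) XH) = map_mx (meval phi) (blk XH).
  by apply/matrixP => i j; rewrite !mxE.
rewrite /= XHE map_block_mx !map_mxM; congr block_mx.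
- by congr (_ *m _); apply/matrixP => i j; rewrite !mxE rmorph_nat.
- by congr (_ *m _); apply/matrixP => i j; rewrite !mxE rmorph_nat.
apply/matrixP => i j; rewrite !mxE rmorphD rmorph_nat /=; congr (_ + _).
by case: ifP => _; rewrite ?rmorph0 // mevalZ.
Qed.

Lemma det1B_point (phi : 'I_(\dim {:V}) -> K) j :
  (det1B (map_mx (meval phi) XH))`_j = ((det1B (toep_mx r A b c' a))`_j).@[phi].
Proof. by rewrite det1B_map -XHE (blk_det1B bi_bij). Qed.

End Points.

Lemma slice_unique (P : pred nat) (X X' : 'M[K]_k) A b c (a a' : nat -> K^o) :
  blk X = slice_mx A b c (shift_mx K^o r + toep r a) ->
  blk X' = slice_mx A b c (shift_mx K^o r + toep r a') ->
  (forall j, ~~ P j -> a j = a' j) ->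
  (forall j, (j < r)%N -> P j -> (det1D X)`_j.+1 = (det1D X')`_j.+1) -> X = X'.
Proof.
move=> XE X'E aa' det_eq; apply: (blk_inj (bi_surj bi_bij)); rewrite XE X'E.
have aE j : (j < r)%N -> a j = a' j.
  apply: (toep_unique (A := A) (b := b) (c := c) aa') => i lt_i Pi.
  have toB (W : 'M[K]_k) (s : nat -> K^o) : blk W = toep_mx r A b c s ->
      (det1B (toep_mx r A b c s))`_i.+1 = (-1) ^+ i.+1 * (det1D W)`_i.+1.
    by move=> <-; rewrite -det1B_D -(blk_det1B bi_bij).
  by apply: etrans (toB X a XE) (etrans _ (esym (toB X' a' X'E))); rewrite det_eq.
congr (slice_mx _ _ _ (_ + _)); apply/matrixP => i j; rewrite !mxE.
case: ifP => // _; rewrite aE //; have := ltn_ord i; lia.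
Qed.

End Reduction.
Lemma det1B_1 (R : comNzRingType) k (X : 'M[R]_k) : (det1B X)`_1 = - \tr X.
Proof.
have [c detE] := det_first_order (1%:M : 'M[{poly R}]_k) (- map_mx polyC X) 'X.
rewrite /det1B -scalerN detE det1 adj1 mul1mx exprS expr1 -mulrA !coefD !coefXM /=.
rewrite coef1 add0r addr0 raddfN coefN /mxtrace coef_sum; congr (- _).
by apply: eq_bigr => i _; rewrite mxE coefC.
Qed.

Lemma delta_expand (K : fieldType) a b (W : lmodType K) (g : 'M[K]_(a, b) -> W) M :
  linear g -> g M = \sum_i \sum_j M i j *: g (delta_mx i j).
Proof.
move=> lin; pose gl := HB.pack_for {linear 'M[K]_(a, b) -> W} g
  (GRing.isLinear.Build K _ _ _ g lin).
rewrite {1}(matrix_sum_delta M) -[LHS]/(gl _) linear_sum; apply: eq_bigr => i _.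
by rewrite linear_sum; apply: eq_bigr => j _; rewrite linearZ.
Qed.

Lemma trace_slice (K : numFieldType) (S : comAlgType K) p r (A : 'M[S]_p) b c (a : nat -> S) :
  \tr (slice_mx A b c (shift_mx S r + toep r a)) = \tr A + a 0%N *+ r.
Proof.
rewrite mxtrace_block; congr (_ + _); rewrite /mxtrace -[r in RHS]card_ord -sumr_const.
apply: eq_bigr => x _; rewrite !mxE leqnn subnn (ltn_eqF (leqnn x.+1)) add0r.
by rewrite /fprod big_geq // scale1r.
Qed.

Lemma fval_symmap (K : numClosedFieldType) k (U : {vspace 'M[K]_k}) e (V W : vectType K)
    (Theta : {lrmorphism Sym V -> Sym (subvs_of (centr U e))}) (g : W -> V) F X :
  fval (Theta (symmap g F)) X = symev (fun w => fval (Theta (symg (g w))) X) F.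
Proof.
rewrite fval_Theta /symmap comp_mpoly_meval /symev; apply: meval_eq => i.
by rewrite tnth_mktuple -fval_Theta.
Qed.

(** * The case of sl_(n+m) *)

Section SlCase.
Variables (K : numClosedFieldType) (n m : nat).
Hypotheses (n_gt0 : (0 < n)%N) (m_gt1 : (1 < m)%N).
Local Notation k := (n + m)%N.
Local Notation U := (slv K k).
Local Notation e := (gl_e K n m).
Local Notation f := (gl_f K n m).
Local Notation h := (gl_h K n m).
Local Notation z := (centr U e).
Local Notation gam := (lshift m).
Local Notation bi := (blk_index (leqnn k) gam).

Let m_gt0 : (0 < m)%N. Proof. exact: ltnW. Qed.

Lemma sl_gam_out (a : 'I_n) : ~~ (n <= gam a < k)%N.
Proof. by have := ltn_ord a; rewrite /=; lia. Qed.

Lemma sl_bi_bij : bijective bi.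
Proof. by apply: blk_index_bij => //; [exact: sl_gam_out | exact: lshift_inj]. Qed.

Lemma sl_biE i : bi i = i.
Proof.
case: (split_ordP i) => j ->; rewrite ?blk_indexl ?blk_indexr //.
exact: val_inj.
Qed.

Lemma sl_blk (S : Type) (X : 'M[S]_k) : blk (leqnn k) gam X = X.
Proof. by apply/matrixP => i j; rewrite mxE !sl_biE. Qed.

Lemma sl_triple : graded_triple U e h f (off_wt n m) (off_d K n m).
Proof.
apply: off_triple => //; first exact: gl_e_sl.
- by move=> a b _ _; apply: commx_sl.
- move=> a; rewrite !memv_sl => /eqP tr0; apply/eqP.
  rewrite -[RHS](conjC0 K) -tr0 /mxtrace raddf_sum /=; apply: eq_bigr => i _.
  by rewrite mxE divff ?mul1r // gt_eqF // off_d_gt0.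
move=> t a; rewrite !memv_sl => /eqP tr0; apply/eqP.
rewrite -[RHS](mul0rn _ (0 == t)) -tr0 /mxtrace -sumrMnl.
by apply: eq_bigr => i _; rewrite mxE subrr.
Qed.

Definition sl_prj (a : 'M[K]_k) : 'M[K]_k := a - (\tr a / k%:R)%:M.
Fact sl_prj_is_linear : linear sl_prj.
Proof.
move=> t a b; rewrite /sl_prj linearP /= mulrDl raddfD /= -mulrA -scale_scalar_mx.
by rewrite scalerBr opprD addrACA.
Qed.
HB.instance Definition _ :=
  GRing.isLinear.Build K 'M[K]_k 'M[K]_k _ sl_prj sl_prj_is_linear.

Let nz_k : k%:R != 0 :> K.
Proof. by rewrite pnatr_eq0; lia. Qed.

Lemma sl_prj_mem a : sl_prj a \in U.
Proof.
by rewrite memv_sl /sl_prj linearB /= mxtrace_scalar -[(_ / _) *+ _]mulr_natr divfK // subrr.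
Qed.

Lemma sl_prj_id a : a \in U -> sl_prj a = a.
Proof. by rewrite memv_sl /sl_prj => /eqP ->; rewrite mul0r raddf0 subr0. Qed.

Lemma sl_prj_trform a b : trform (sl_prj a) b = trform a b - \tr a * \tr b / k%:R.
Proof.
rewrite /sl_prj trformBl; congr (_ - _).
by rewrite /trform mul_scalar_mx mxtraceZ mulrAC.
Qed.

Lemma sl_prj_adj a b : trform (sl_prj a) b = trform a (sl_prj b).
Proof. by rewrite [RHS]trformC !sl_prj_trform trformC [\tr a * _]mulrC. Qed.

Lemma sl_prj_commx X a : commx X (sl_prj a) = sl_prj (commx X a).
Proof.
rewrite [RHS]sl_prj_id ?commx_sl // /sl_prj commxBr.
by rewrite [commx X _%:M](_ : _ = 0) ?subr0 // /commx scalar_mxC subrr.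
Qed.

(** The diagonal matrix chosen as image of the identity is diag (1, 0) minus n / (n + m) times the
    identity, so the whole embedding is extension by 0 followed by removal of the trace. *)
Lemma gl_iA_block (A : 'M[K]_n) : gl_iA m A = block_mx A 0 0 0 - (\tr A / k%:R)%:M.
Proof.
have nz_n : n%:R != 0 :> K by rewrite pnatr_eq0; lia.
set t := \tr A / n%:R.
have diagE (g r : nat) (s : K) (a b : 'I_k) :
    (\sum_(1 <= i < r.+1) s *: Emx (g + i) (g + i) : 'M[K]_k) a b
      = if (a == b) && (g <= a < g + r)%N then s else 0.
  rewrite summxE; case: ifP => [/andP[/eqP <- lt_a]|out].
    rewrite (bigD1_seq (a.+1 - g)%N) ?mem_index_iota ?iota_uniq //=; last by lia.
    rewrite !mxE subnKC; last by lia.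
    rewrite eqxx mulr1 big1 ?addr0 // => i ne_i; rewrite !mxE.
    by rewrite (_ : (a.+1 == _) = false) ?mulr0 //; lia.
  rewrite big_nat big1 // => i lt_i; rewrite !mxE.
  rewrite (_ : _ && _ = false) ?mulr0 //.
  by apply/negbTE/negP => /andP[/eqP ea /eqP eb]; move: out; rewrite -val_eqE /=; lia.
have cornE (B : 'M[K]_n) (a b : 'I_k) :
    (\sum_(i < n) \sum_(j < n) B i j *: Emx i.+1 j.+1 : 'M[K]_k) a b = block_mx B 0 0 0 a b.
  rewrite summxE; under eq_bigr => i _.
    rewrite summxE; under eq_bigr => j _ do rewrite !mxE !eqSS.
    over.
  case: (split_ordP a) => a' ->; last first.
    rewrite big1 => [|i _]; last first.
      rewrite big1 // => j _; rewrite (_ : _ && _ = false) ?mulr0 //=.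
      by have := ltn_ord i; lia.
    by case: (split_ordP b) => b' ->; rewrite ?block_mxEdl ?block_mxEdr mxE.
  case: (split_ordP b) => b' ->; last first.
    rewrite big1 => [|i _]; last first.
      rewrite big1 // => j _; rewrite (_ : _ && _ = false) ?mulr0 //=.
      by have := ltn_ord j; lia.
    by rewrite block_mxEur mxE.
  rewrite block_mxEul (bigD1 a') //= [X in _ + X]big1 => [|i ne_i]; last first.
    rewrite big1 // => j _; rewrite (_ : _ && _ = false) ?mulr0 //.
    by move: ne_i; rewrite -val_eqE /=; lia.
  rewrite addr0 (bigD1 b') //= big1 => [|j ne_j]; last first.
    rewrite (_ : _ && _ = false) ?mulr0 //.
    by move: ne_j; rewrite -val_eqE /=; lia.
  by rewrite !eqxx mulr1 addr0.
rewrite /gl_iA -/t; apply/matrixP => a b; rewrite [LHS]mxE cornE.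
rewrite [X in _ + X]mxE [X in t * X]mxE (diagE 0%N n) diagE.
rewrite [RHS]mxE [X in _ = _ + X]mxE [X in _ = _ - X]mxE.
have kE : k%:R = n%:R + m%:R :> K by rewrite natrD.
have nz : n%:R + m%:R != 0 :> K by rewrite -kE.
have tE : \tr A / k%:R = t * (n%:R / k%:R).
  by rewrite /t mulrA divfK.
case: (split_ordP a) => a' ->; case: (split_ordP b) => b' ->.
- have AE : (A - t%:M) a' b' = A a' b' - t *+ (a' == b') by rewrite !mxE.
  rewrite !block_mxEul AE eq_lshift /= [(n <= a')%N]leqNgt ltn_ord /=.
  rewrite andbT andbF addr0.
  case: (a' == b'); rewrite ?mulr1n ?mulr0n ?mulr0 ?subr0 ?addr0 //.
  rewrite tE -addrA; congr (_ + _); rewrite kE; field; exact: nz.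
- by rewrite !block_mxEur !mxE eq_lrshift /= !addr0 mulr0 oppr0.
- by rewrite !block_mxEdl !mxE eq_rlshift /= !addr0 mulr0 oppr0.
rewrite !block_mxEdr !mxE eq_rshift /= leq_addr ltn_add2l ltn_ord.
rewrite !andbF !andbT !add0r.
case: (a' == b'); rewrite ?mulr1n ?mulr0n ?mulr0 ?oppr0 //.
by rewrite tE mulNr mulrN.
Qed.

Lemma sl_prj_iota (M : 'M[K]_n) (y : 'cV[K]_n) (x : 'rV[K]_n) : sl_prj (iota (leqnn k) gam M y x) =
  gl_iA m M + gl_iy m y + gl_ix m x.
Proof.
have -> : iota (leqnn k) gam M y x = block_mx M (y *m (epsr K m)^T) (eps1 K m *m x) 0.
  by rewrite -[LHS]sl_blk (unblkK sl_bi_bij).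
rewrite /sl_prj mxtrace_block mxtrace0 addr0 gl_iA_block.
rewrite -addrA addrAC; congr (_ - _).
have -> : block_mx M (y *m (epsr K m)^T) (eps1 K m *m x) 0 =
    block_mx M 0 0 0 + (block_mx 0 (y *m (epsr K m)^T) 0 0 + block_mx 0 0 (eps1 K m *m x) 0).
  by rewrite !add_block_mx !add0r !addr0.
congr (_ + (_ + _)); apply/matrixP => a b; rewrite summxE.
  under eq_bigr => i _ do rewrite !mxE.
  case: (split_ordP a) => a' ->; case: (split_ordP b) => b' ->.
  - rewrite block_mxEul mxE big1 // => i _; rewrite (_ : _ && _ = false) ?mulr0 //=.
    by have := ltn_ord b'; lia.
  - rewrite block_mxEur mul_colrow (bigD1 a') //= big1 => [|i ne_i].
      rewrite !mxE eqxx addr0 /=; congr (_ * _%:R); lia.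
    by rewrite (_ : _ && _ = false) ?mulr0 //; move: ne_i; rewrite -val_eqE /=; lia.
  - rewrite block_mxEdl mxE big1 // => i _; rewrite (_ : _ && _ = false) ?mulr0 //=.
    by have := ltn_ord i; lia.
  rewrite block_mxEdr mxE big1 // => i _; rewrite (_ : _ && _ = false) ?mulr0 //=.
  by have := ltn_ord i; lia.
under eq_bigr => i _ do rewrite !mxE.
case: (split_ordP a) => a' ->; case: (split_ordP b) => b' ->.
- rewrite block_mxEul mxE big1 // => i _; rewrite (_ : _ && _ = false) ?mulr0 //=.
  by have := ltn_ord a'; lia.
- rewrite block_mxEur mxE big1 // => i _; rewrite (_ : _ && _ = false) ?mulr0 //=.
  by have := ltn_ord i; lia.
- rewrite block_mxEdl mul_colrow (bigD1 b') //= big1 => [|i ne_i].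
    rewrite mulrC mxE eqxx andbT addr0 /=; congr (_ * _%:R); lia.
  by rewrite (_ : _ && _ = false) ?mulr0 //; move: ne_i; rewrite -val_eqE /=; lia.
rewrite block_mxEdr mxE big1 // => i _; rewrite (_ : _ && _ = false) ?mulr0 //=.
by have := ltn_ord i; lia.
Qed.

Local Notation V := (gl_space K n m).
Local Notation uM := ((fst \o fst) \o fst : {linear V -> 'M[K]_n}).
Local Notation uy := ((snd \o fst) \o fst : {linear V -> 'cV[K]_n}).
Local Notation ux := (snd \o fst : {linear V -> 'rV[K]_n}).
Local Notation uz := (snd : {linear V -> 'rV[K]_m.-1}).
(** This sign turns the coefficients of det (1 + z X) into those of det (1 - tau X). *)
Let sg (j : 'I_m.-1) : K := (-1) ^+ (m - j).
Let dg (j : 'I_m.-1) : nat := (m - j).-1.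

Let dgE j : (dg j).+1 = (m - j)%N.
Proof. by rewrite /dg prednK //; have := ltn_ord j; lia. Qed.

Lemma sl_iota_centr (u : V) :
  sl_prj (iota (leqnn k) gam (uM u) (uy u) (ux u)) \in z.
Proof.
rewrite sl_prj_iota; apply: memvD; first apply: memvD.
- by apply: gl_iA_z; rewrite pnatr_eq0; lia.
- exact: gl_iy_z.
exact: gl_ix_z.
Qed.

Lemma sl_slice_tr X : slice U e f X -> \tr X = 0.
Proof.
by case/(slice_blk (leqnn k) sl_gam_out sl_triple); rewrite memv_sl => /eqP.
Qed.

Section SlTheta.
Variable Y : 'M[Sym (subvs_of z)]_k.
Hypothesis YE : forall X, slice U e f X -> forall a b, fval (Y a b) X = X a b.
Hypothesis Y_deriv : forall X v, v \in U -> commx f v = 0 -> forall a b,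
  \sum_i fval (Y a b)^`M(i) X * trform (vsval (symb i : subvs_of z)) v = v a b.
Local Notation Theta :=
  (sym_morph (lin_theta (leqnn k) gam sl_prj uM uy ux uz sg dg Y)).

Lemma sl_val X A b c E (u : V) : slice U e f X -> X = slice_mx A b c E ->
  fval (Theta (symg u)) X =
  trform u.1.1.1 A + (c *m u.1.1.2) 0 0 + (u.1.2 *m b) 0 0 +
  \sum_j u.2 0 j * (det1B X)`_(m - j).
Proof.
move=> SX XE; rewrite sym_morph_symg.
rewrite (fval_lin_theta m_gt0 sl_gam_out sl_bi_bij sl_triple sl_prj_id sl_prj_adj
  uz sg dg sl_iota_centr YE u SX (etrans (sl_blk X) XE)).
congr (_ + _); apply: eq_bigr => j _; by rewrite dgE -mulrA det1B_D.
Qed.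

Lemma sl_val_alpha X A b c E y x j : slice U e f X -> X = slice_mx A b c E ->
  fval (Theta (symmap (@gl_A K n m) (alpha y x j))) X = alpha_at A y x j.
Proof.
move=> SX XE; rewrite fval_symmap -alphaE /symev; apply: meval_eq => i.
rewrite (sl_val _ SX XE) /= mulmx0 mul0mx !mxE !addr0 big1 ?addr0 // => l _.
by rewrite mxE mul0r.
Qed.

Lemma sl_val_zeta X (j : 'I_m.-1) : slice U e f X ->
  fval (Theta (symg (gl_zeta K n j))) X = (det1B X)`_(m - j).
Proof.
move=> SX; have [_ [A [b [c [a]]]]] := slice_blk (leqnn k) sl_gam_out sl_triple SX.
rewrite sl_blk => XE; rewrite (sl_val _ SX XE) /= mulmx0 mul0mx trform0l !mxE !add0r.
rewrite (bigD1 j) //= big1 ?addr0 => [|l ne_l]; first by rewrite mxE !eqxx mul1r.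
by rewrite mxE (negbTE ne_l) andbF mul0r.
Qed.

(** In the sum over j up to m the term j = m has coefficient 1, and the term j = m - 1 has
    coefficient - tr X = 0. This is why the zeta_j stop at m - 2. *)
Lemma sl_val_yx X A b c E y x : slice U e f X -> hessenberg E ->
  X = slice_mx A b c E ->
  fval (Theta (gl_yx m y x)) X = (x *m ham_vec E A y) 0 0.
Proof.
move=> SX hE XE; rewrite ham_vecE.
have detE l : (l <= m)%N -> (det1B X)`_l = (det1B A * det1B E)`_l.
  by rewrite XE; apply: det1B_slice.
rewrite (psmul_det1B (fun i => (x *m A ^+ i *m y) 0 0) detE).
have last_term m' (F : nat -> K) : (0 < m')%N ->
    \sum_(j < m') F j = \sum_(j < m'.-1) F j + F m'.-1.
  by case: m' => // m' _; rewrite big_ord_recr.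
rewrite /gl_yx rmorphD fvalD (sl_val_alpha _ _ _ SX XE) rmorph_sum fval_sum.
rewrite big_ord_recr /= subnn det1B_0 mul1r addrC; congr (_ + _).
rewrite (last_term m (fun j => (det1B X)`_(m - j) * alpha_at A y x j)) //.
rewrite (_ : m - m.-1 = 1)%N ?det1B_1 ?sl_slice_tr //; last by lia.
rewrite oppr0 mul0r addr0; apply: eq_bigr => j _.
by rewrite rmorphM fvalM /= sl_val_zeta // (sl_val_alpha _ _ _ SX XE).
Qed.

Lemma sl_bracket X A b c E : slice U e f X -> hessenberg E ->
  blk (leqnn k) gam X = slice_mx A b c E -> forall u w : V,
  trform (commx X (hamU (leqnn k) gam A E (uM u) (uy u) (ux u)))
    (sl_prj (hamU (leqnn k) gam A E (uM w) (uy w) (ux w))) =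
  fval (Theta (gl_bracket u w)) X.
Proof.
move=> SX hE XE [[[M y] x] zt] [[[M' y'] x'] zt'].
have XE' := XE; rewrite sl_blk in XE'.
have e1 := sl_val_yx y x' SX hE XE'; have e2 := sl_val_yx y' x SX hE XE'.
have e3 := @sl_val _ _ _ _ _
  (commx M M', M *m y' - M' *m y, x *m M' - x' *m M, 0) SX XE'.
move: e1 e2 e3; move: (sym_morph _) => Th e1 e2 e3.
rewrite trformC sl_prj_trform [trform (hamU _ _ _ _ _ _ _) _]trformC.
have /eqP -> : \tr (commx X (hamU (leqnn k) gam A E (uM (M, y, x, zt)) y x)) == 0.
  by rewrite -memv_sl commx_sl.
rewrite mulr0 mul0r subr0 (hamU_bracket m_gt0 sl_bi_bij XE hE) /=.
have -> : fval (Th (gl_bracket (M, y, x, zt) (M', y', x', zt'))) X =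
    fval (Th (symg ((commx M M', M *m y' - M' *m y, x *m M' - x' *m M, 0) : V))) X +
    fval (Th (gl_yx m y x')) X - fval (Th (gl_yx m y' x)) X.
  by rewrite rmorphB rmorphD fvalB fvalD.
apply: etrans (f_equal3 (fun s t u => s + t - u) (esym e3) (esym e1) (esym e2)) => /=.
rewrite [\sum_(j < m.-1) _]big1 ?addr0 => [|j _]; last by rewrite mxE mul0r.
by rewrite [trform A _]trformC.
Qed.

End SlTheta.
Lemma sl_isomorphism :
  exists Theta : {lrmorphism Hgl K n m -> Sym (subvs_of z)},
    [/\ (forall A : 'M[K]_n, Theta (symg (gl_A m A)) = symg (vsproj z (gl_iA m A))),
        (forall y : 'cV[K]_n, Theta (symg (gl_y m y)) = symg (vsproj z (gl_iy m y))),
        (forall x : 'rV[K]_n, Theta (symg (gl_x m x)) = symg (vsproj z (gl_ix m x))),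
        (forall (j : 'I_m.-1) (X : 'M[K]_k), slice U e f X ->
           fval (Theta (symg (gl_zeta K n j))) X
           = (-1) ^+ (m - j) * (det1D X)`_(m - j))
      & bijective Theta /\
        (forall l : {vspace 'M[K]_k}, lagrangian U e h l ->
           forall (a b : Hgl K n m) (r : Sym (subvs_of z)),
             slice_bracket U e h f l (Theta a) (Theta b) r
             <-> r = Theta (Hgl_br a b))].
Proof.
have [Y [YE Y_deriv]] := universal_point sl_triple.
have iA0 : gl_iA m (0 : 'M[K]_n) = 0.
  by rewrite gl_iA_block mxtrace0 mul0r raddf0 subr0 block_mx_const.
have iy0 : gl_iy m (0 : 'cV[K]_n) = 0.
  by rewrite /gl_iy big1 // => i _; rewrite mxE scale0r.
have ix0 : gl_ix m (0 : 'rV[K]_n) = 0.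
  by rewrite /gl_ix big1 // => i _; rewrite mxE scale0r.
have lin0 (u : V) : u.2 = 0 ->
    lin_theta (leqnn k) gam sl_prj uM uy ux uz sg dg Y u =
    symg (vsproj z (gl_iA m u.1.1.1 + gl_iy m u.1.1.2 + gl_ix m u.1.2)).
  move=> u0; rewrite /lin_theta /= sl_prj_iota [X in _ + X]big1 ?addr0 // => j _.
  by rewrite u0 mxE mul0r scale0r.
have thetaE (u : V) (u0 : u.2 = 0) := etrans
  (sym_morph_symg (lin_theta (leqnn k) gam sl_prj uM uy ux uz sg dg Y) u) (lin0 u u0).
have valE := sl_val YE; have zetaE := sl_val_zeta YE; have brE := sl_bracket YE.
have hamE := Theta_hamiltonians m_gt0 sl_gam_out sl_bi_bij sl_triple sl_prj_mem
  sl_prj_id sl_prj_adj (fun X a _ => sl_prj_commx X a) sl_iota_centr YE Y_deriv brE.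
exists (sym_morph (lin_theta (leqnn k) gam sl_prj uM uy ux uz sg dg Y)).
split=> [A|y|x|j X SX|].
- by rewrite (thetaE (gl_A m A) erefl) /= iy0 ix0 !addr0.
- by rewrite (thetaE (gl_y m y) erefl) /= iA0 ix0 add0r addr0.
- by rewrite (thetaE (gl_x m x) erefl) /= iA0 iy0 !add0r.
- by rewrite zetaE // det1B_D.
split; last by move=> l lagr a b r; apply: (slice_bracketP sl_triple hamE lagr).
move: valE zetaE {hamE brE thetaE lin0}; move: (sym_morph _) => Th valE zetaE.
have valA X A b c E M : slice U e f X -> X = slice_mx A b c E ->
    fval (Th (symg (gl_A m M))) X = trform M A.
  move=> SX XE; rewrite (valE _ _ _ _ _ _ SX XE) /= mulmx0 mul0mx !mxE !addr0.
  by rewrite big1 ?addr0 // => l _; rewrite mxE mul0r.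
have valy X A b c E y : slice U e f X -> X = slice_mx A b c E ->
    fval (Th (symg (gl_y m y))) X = (c *m y) 0 0.
  move=> SX XE; rewrite (valE _ _ _ _ _ _ SX XE) /= trform0l mul0mx add0r.
  by rewrite [X in _ + X + _]mxE addr0 big1 ?addr0 // => l _; rewrite mxE mul0r.
have valx X A b c E x : slice U e f X -> X = slice_mx A b c E ->
    fval (Th (symg (gl_x m x))) X = (x *m b) 0 0.
  move=> SX XE; rewrite (valE _ _ _ _ _ _ SX XE) /= trform0l mulmx0 add0r.
  by rewrite [X in X + _ + _]mxE add0r big1 ?addr0 // => l _; rewrite mxE mul0r.
(* Indices are transposed since the trace form with [delta_mx j i] reads the entry (i, j); likewise
   y reads c and x reads b. *)
pose AH : 'M[Sym V]_n := \matrix_(i, j) symg (gl_A m (delta_mx j i : 'M[K]_n)).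
pose bH : 'cV[Sym V]_n := \col_i symg (gl_x m (delta_mx 0 i : 'rV[K]_n)).
pose cH : 'rV[Sym V]_n := \row_j symg (gl_y m (delta_mx j 0 : 'cV[K]_n)).
(* The coefficient of tau^(j+1) has to be zeta_l with l = m - 1 - j. For j = 0 there is no such l:
   a_0 = - tr A / m is imposed instead, to make the trace of the point vanish. *)
pose t j : Sym V := if insub (m.-1 - j)%N is Some l then symg (gl_zeta K n l) else 0.
have [a [a0 at_]] := toep_exists m AH bH cH (fun j => 0 < j)%N
  (fun=> - (m%:R^-1 : K) *: \tr AH) t.
pose XH : 'M[Sym V]_k := toep_mx m AH bH cH a.
have XHE : blk (leqnn k) gam XH = XH by exact: sl_blk.
have ptE phi := map_point XHE phi.
have nz_m : m%:R != 0 :> K by rewrite pnatr_eq0; lia.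
have slice_pt phi : slice U e f (map_mx (meval phi) XH).
  apply/sliceP; split; last first.
    by apply: (blk_kerf sl_gam_out (bi_surj sl_bi_bij) (ptE phi)).
  apply: memvB; last exact: gl_e_sl.
  have tr0 : \tr (map_mx (meval phi) AH) + (a 0%N).@[phi] *+ m = 0.
    rewrite trace_map_mx a0 // mevalZ -[_ * _ *+ m]mulr_natr mulrAC mulNr mulVf //.
    by rewrite mulN1r subrr.
  have := ptE phi; rewrite sl_blk memv_sl => ->.
  have trE := @trace_slice K K^o n m (map_mx (meval phi) AH) (map_mx (meval phi) bH)
    (map_mx (meval phi) cH) (fun j => (a j).@[phi]).
  by apply/eqP; exact: (etrans trE tr0).
apply: (Theta_bijective sl_triple slice_pt) => [phi u|X X' SX SX' XX'].
  have := ptE phi; rewrite sl_blk => XE; rewrite (valE _ _ _ _ _ _ (slice_pt phi) XE).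
  pose L (v : V) : K^o := (symg v).@[phi].
  have Llin : linear L by move=> s v w; rewrite /L linearP mevalD mevalZ.
  pose Ll := HB.pack_for {linear V -> K^o} L (GRing.isLinear.Build K V K^o _ L Llin).
  have uE : u = (gl_A m u.1.1.1 + gl_y m u.1.1.2 + gl_x m u.1.2 + (0, 0, 0, u.2) : V).
    case: (u) => [[[M y] x] s]; rewrite /gl_A /gl_y /gl_x /=.
    by congr (_, _, _, _); rewrite /= ?(addr0, add0r).
  rewrite -[RHS]/(Ll u) [in RHS]uE !linearD; congr (_ + _ + _ + _).
  - rewrite (@delta_expand _ _ _ _ (fun M => Ll (gl_A m M)) u.1.1.1) ?trformE.
      by apply: eq_bigr => i _; apply: eq_bigr => j _; rewrite !mxE.
    move=> s M M'; rewrite -linearP; congr (Ll _); rewrite /gl_A.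
    by congr (_, _, _, _); rewrite /= ?scaler0 ?addr0.
  - rewrite (@delta_expand _ _ _ _ (fun y => Ll (gl_y m y)) u.1.1.2) ?mxE.
      by apply: eq_bigr => i _; rewrite big_ord1 !mxE mulrC.
    move=> s M M'; rewrite -linearP; congr (Ll _); rewrite /gl_y.
    by congr (_, _, _, _); rewrite /= ?scaler0 ?addr0.
  - rewrite (@delta_expand _ _ _ _ (fun x => Ll (gl_x m x)) u.1.2) ?mxE.
      by rewrite big_ord1; apply: eq_bigr => i _; rewrite !mxE.
    move=> s M M'; rewrite -linearP; congr (Ll _); rewrite /gl_x.
    by congr (_, _, _, _); rewrite /= ?scaler0 ?addr0.
  rewrite (@delta_expand _ _ _ _ (fun s => Ll (0, 0, 0, s)) u.2).
    rewrite big_ord1; apply: eq_bigr => j _; congr (_ * _); have lt_j := ltn_ord j.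
    rewrite (det1B_point sl_bi_bij XHE).
    have -> : (m - j = (m.-1 - j).+1)%N by lia.
    rewrite at_; [|lia|lia].
    rewrite /t insubT => [|lt]; first by lia.
    by congr (symg (gl_zeta K n _)).@[phi]; apply: val_inj => /=; lia.
  move=> s M M'; rewrite -linearP; congr (Ll _).
  by congr (_, _, _, _); rewrite /= ?scaler0 ?addr0.
have [_ [A [b [c [s]]]]] := slice_blk (leqnn k) sl_gam_out sl_triple SX.
have [_ [A' [b' [c' [s']]]]] := slice_blk (leqnn k) sl_gam_out sl_triple SX'.
rewrite !sl_blk => X'E XE.
have eqA : A = A'.
  apply/matrixP => i j; rewrite -!trform_delta.
  by rewrite -(valA _ _ _ _ _ _ SX XE) -(valA _ _ _ _ _ _ SX' X'E).
have eqb : b = b'.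
  apply/colP => i; have := XX' (gl_x m (delta_mx 0 i)).
  by rewrite (valx _ _ _ _ _ _ SX XE) (valx _ _ _ _ _ _ SX' X'E) -!rowE !mxE.
have eqc : c = c'.
  apply/rowP => i; have := XX' (gl_y m (delta_mx i 0)).
  by rewrite (valy _ _ _ _ _ _ SX XE) (valy _ _ _ _ _ _ SX' X'E) -!colE !mxE.
subst A' b' c'; rewrite -[X]sl_blk in XE; rewrite -[X']sl_blk in X'E.
apply: (slice_unique m_gt0 sl_bi_bij (P := fun j => (0 < j)%N) XE X'E).
  have diag (W : 'M[K]_k) (s0 : nat -> K^o) :
      blk (leqnn k) gam W = slice_mx A b c (shift_mx K^o m + toep m s0) ->
      slice U e f W -> (s0 0%N : K) * m%:R = - \tr A.
    rewrite sl_blk => WE SW; have tr0 := sl_slice_tr SW; rewrite WE in tr0.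
    have := etrans (esym (@trace_slice K K^o n m A b c s0)) tr0.
    by move/eqP; rewrite addrC addr_eq0 => /eqP <-; rewrite mulr_natr.
  by case=> // _; apply: (mulIf nz_m); rewrite (diag _ _ XE SX) (diag _ _ X'E SX').
move=> j lt_j j_gt0; have lt_l : (m.-1 - j < m.-1)%N by lia.
have := etrans (esym (zetaE X (Ordinal lt_l) SX)) (etrans (XX' _) (zetaE X' _ SX')).
rewrite [nat_of_ord _]/=.
have -> : (m - (m.-1 - j) = j.+1)%N by lia.
by rewrite !det1D_B => ->.
Qed.

End SlCase.
(** * The case of sp_(2n+2m) *)

Section SymplecticProjection.
Variables (K : numClosedFieldType) (k : nat).
Hypothesis even_k : ~~ odd k.
Local Notation J := (Jmx K k).
Local Notation U := (spv K k).
Implicit Types a b X : 'M[K]_k.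

Lemma Jmx_tr : J^T = - J.
Proof.
apply/matrixP => i j; rewrite !mxE; have [lt_i lt_j] := (ltn_ord i, ltn_ord j).
case: ifP => [eq_ij|ne_ij]; last by rewrite ifF ?oppr0 //; lia.
rewrite ifT; last by lia.
rewrite -[RHS]mulN1r -exprS -signr_odd -[RHS]signr_odd; congr (_ ^+ _); lia.
Qed.

(** Minus the adjoint for the symplectic form, as J^-1 = - J: an involution whose fixed points form
    sp. *)
Definition adjJ a : 'M[K]_k := J *m a^T *m J.

Lemma JJ : J *m J = - 1%:M. Proof. exact: Jmx_sqr. Qed.

Lemma adjJE a i j : adjJ a i j = (-1) ^+ (i + j).+1 * a (rev_ord j) (rev_ord i).
Proof.
have [lt_i lt_j] := (ltn_ord i, ltn_ord j).
rewrite mxE (bigD1 (rev_ord j)) //= big1 ?addr0 => [|l ne_l]; last first.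
  by rewrite [X in _ * X]mxE ifF ?mulr0 //; move: ne_l; rewrite -val_eqE /=; lia.
rewrite mxE (bigD1 (rev_ord i)) //= big1 ?addr0 => [|l ne_l]; last first.
  by rewrite [X in X * _]mxE ifF ?mul0r //; move: ne_l; rewrite -val_eqE /=; lia.
rewrite !mxE !ifT /=; [|lia|lia].
rewrite mulrAC -exprD; congr (_ * _).
rewrite -[LHS]signr_odd -[RHS]signr_odd; congr (_ ^+ _).
lia.
Qed.

Lemma adjJK : involutive adjJ.
Proof.
move=> a; apply/matrixP => i j; rewrite !adjJE !rev_ordK mulrA -exprD.
have [lt_i lt_j] := (ltn_ord i, ltn_ord j).
by rewrite -signr_odd (_ : odd _ = false) ?mul1r //=; lia.
Qed.

Lemma memv_spJ a : (a \in U) = (adjJ a == a).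
Proof.
rewrite memv_sp; apply/eqP/eqP => [|E].
  move/(canRL (addrK _)); rewrite sub0r => E.
  by rewrite /adjJ -mulmxA E mulmxN mulmxA JJ mulNmx mul1mx opprK.
by rewrite -{2}E /adjJ !mulmxA JJ !mulNmx mul1mx subrr.
Qed.

Lemma adjJ_linear : linear adjJ.
Proof.
by move=> t a b; rewrite /adjJ linearP /= mulmxDr mulmxDl -scalemxAr -scalemxAl.
Qed.

Lemma trform_adjJ a b : trform (adjJ a) b = trform a (adjJ b).
Proof.
rewrite /trform /adjJ -mxtrace_tr !trmx_mul trmxK Jmx_tr !(mulNmx, mulmxN) opprK.
by rewrite mxtrace_mulC -!mulmxA mxtrace_mulC -!mulmxA.
Qed.

(** The involution [adjJ] preserves commutators, and it fixes X. *)
Lemma adjJ_commx X a : X \in U -> adjJ (commx X a) = commx X (adjJ a).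
Proof.
rewrite memv_spJ => /eqP XE; have E1 : X^T *m J = - (J *m X).
  by rewrite -{2}XE /adjJ !mulmxA JJ !mulNmx mul1mx opprK.
have E2 : J *m X^T = - (X *m J).
  by rewrite -{2}XE /adjJ -!mulmxA JJ !mulmxN mulmx1 opprK.
rewrite /adjJ /commx linearB /= !trmx_mul mulmxBr mulmxBl.
rewrite (mulmxA J X^T) E2 -!mulmxA E1.
by rewrite !(mulNmx, mulmxN) opprK addrC !mulmxA.
Qed.

Definition sp_prj a : 'M[K]_k := 2^-1 *: (a + adjJ a).
Fact sp_prj_is_linear : linear sp_prj.
Proof.
move=> t a b; rewrite /sp_prj adjJ_linear addrACA -(scalerDr t).
by rewrite [LHS]scalerDr !scalerA mulrC.
Qed.
HB.instance Definition _ :=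
  GRing.isLinear.Build K 'M[K]_k 'M[K]_k _ sp_prj sp_prj_is_linear.

Let nz2 : 2 != 0 :> K. Proof. by rewrite pnatr_eq0. Qed.

Lemma adjJZ t a : adjJ (t *: a) = t *: adjJ a.
Proof. by rewrite /adjJ linearZ /= -scalemxAr -scalemxAl. Qed.

Lemma sp_prj_mem a : sp_prj a \in U.
Proof.
rewrite memv_spJ /sp_prj adjJZ; apply/eqP; congr (_ *: _).
by rewrite -[X in adjJ (X + _)]scale1r adjJ_linear scale1r adjJK addrC.
Qed.

Lemma sp_prj_id a : a \in U -> sp_prj a = a.
Proof.
rewrite memv_spJ /sp_prj => /eqP ->.
by rewrite -mulr2n -scaler_nat scalerA mulVf // scale1r.
Qed.

Lemma sp_prj_adj a b : trform (sp_prj a) b = trform a (sp_prj b).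
Proof. by rewrite /sp_prj trformZl trformZr trformDl trformDr trform_adjJ. Qed.

Lemma sp_prj_commx X a : X \in U -> commx X (sp_prj a) = sp_prj (commx X a).
Proof. by move=> UX; rewrite /sp_prj adjJ_commx // commxZr commxDr. Qed.

End SymplecticProjection.

(* Conjugation by J turns A into - A. *)
Lemma det1B_odd (K : numClosedFieldType) k (J A : 'M[K]_k) j :
  J *m J = - 1%:M -> J *m A^T *m J = A -> odd j -> (det1B A)`_j = 0.
Proof.
move=> J2 JA odd_j; have E : det1B A = det1B (- A).
  rewrite -det1B_tr -(@det1B_embed _ _ _ J (- J)).
    by rewrite mulmxN JA.
  by rewrite mulNmx J2 opprK.
have ED : det1B (- A) = det1D A.
  by rewrite /det1B /det1D map_mxN scalerN opprK.
have := congr1 (fun q : {poly K} => q`_j) (etrans E ED).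
rewrite /= det1D_B -signr_odd odd_j expr1 mulN1r => /eqP.
by rewrite -addr_eq0 -mulr2n mulrn_eq0 => /eqP.
Qed.
Section SpCase.
Variables (K : numClosedFieldType) (n m : nat).
Hypotheses (n_gt0 : (0 < n)%N) (m_gt0 : (0 < m)%N).
Local Notation k := (n + m).*2.
Local Notation r := m.*2.
Local Notation p := n.*2.
Local Notation U := (spv K k).
Local Notation e := (sp_e K n m).
Local Notation f := (sp_f K n m).
Local Notation h := (sp_h K n m).
Local Notation z := (centr U e).

Let even_k : ~~ odd k. Proof. by rewrite odd_double. Qed.
Let r_gt0 : (0 < r)%N. Proof. by rewrite double_gt0. Qed.
Let nz2 : 2 != 0 :> K. Proof. by rewrite pnatr_eq0. Qed.

Lemma sp_le_nr : (n + r <= k)%N. Proof. lia. Qed.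

Lemma sp_gam_lt (a : 'I_p) : ((if a < n then a : nat else a + r) < k)%N.
Proof. by have := ltn_ord a; case: ifP; lia. Qed.

Definition sp_gam (a : 'I_p) : 'I_k := Ordinal (sp_gam_lt a).

Lemma sp_gam_out a : ~~ (n <= sp_gam a < n + r)%N.
Proof. by have := ltn_ord a; rewrite /=; case: ifP; lia. Qed.

Lemma sp_gam_inj : injective sp_gam.
Proof.
move=> a b /(congr1 val) /= E; apply: val_inj; move: E.
by have [lt_a lt_b] := (ltn_ord a, ltn_ord b); do 2!case: ifP => /=; lia.
Qed.

Lemma sp_bi_bij : bijective (blk_index sp_le_nr sp_gam).
Proof.
by apply: blk_index_bij; [exact: sp_gam_out | exact: sp_gam_inj | lia].
Qed.

Local Notation blk := (blk sp_le_nr sp_gam).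
Local Notation mid := (mid sp_le_nr).

Lemma off_wt_rev (i : 'I_k) : off_wt n r (rev_ord i) = - off_wt n r i.
Proof. by have := ltn_ord i; rewrite /off_wt /=; do 2!case: ifP; lia. Qed.

(** Since t (r - t) is symmetric under t -> r - t, the two partial products complement each other.
    The product being independent of i makes [star] compatible with the symplectic form. *)
Lemma off_d_rev (i : 'I_k) :
  off_d K n r i * off_d K n r (rev_ord i) = \prod_(1 <= t < r) fcoef K r t.
Proof.
have lt_i := ltn_ord i; rewrite /off_d.
set u := minn (i - n) _; set v := minn _ _.
have uv : (u + v = r.-1)%N by rewrite /u /v /=; lia.
have -> : \prod_(1 <= t < v.+1) fcoef K r t = \prod_(u.+1 <= t < r) fcoef K r t.
  rewrite [RHS]big_nat_rev big_add1 [RHS](_ : _ = \prod_(0 + u.+1 <= t < v + u.+1)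
    fcoef K r (u.+1 + r - t.+1)); last by congr bigop; congr index_iota; lia.
  rewrite big_addn addnK; apply: eq_big_nat => t lt_t.
  rewrite /fcoef; congr (_%:R).
  rewrite (_ : u.+1 + r - (t + u.+1).+1 = r - t.+1)%N; last by lia.
  by rewrite mulnC; congr (_ * _)%N; lia.
rewrite -big_cat_nat //; lia.
Qed.

Lemma sp_triple : graded_triple U e h f (off_wt n r) (off_d K n r).
Proof.
apply: (off_triple sp_le_nr); first exact: sp_e_sp.
- by move=> a b; apply: commx_sp.
- move=> a; rewrite !memv_spJ // => /eqP aE; apply/eqP/matrixP => i j.
  have aji : a j i = (-1) ^+ (i + j).+1 * a (rev_ord i) (rev_ord j).
    by rewrite -{1}aE adjJE // addnC.
  have nz (l : 'I_k) : off_d K n r l != 0 by rewrite gt_eqF // (off_d_gt0 K sp_le_nr).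
  have dE : off_d K n r (rev_ord j) / off_d K n r (rev_ord i) =
      off_d K n r i / off_d K n r j.
    by apply/eqP; rewrite eqr_div // mulrC off_d_rev off_d_rev.
  rewrite adjJE // !mxE aji rmorphM rmorph_sign dE mulrCA //.
move=> t a; rewrite !memv_spJ // => /eqP aE; apply/eqP/matrixP => i j.
have aij : a i j = (-1) ^+ (i + j).+1 * a (rev_ord j) (rev_ord i).
  by rewrite -{1}aE adjJE.
rewrite adjJE // !mxE aij mulrnAr; congr (_ *+ _).
by rewrite !off_wt_rev opprK addrC.
Qed.
Lemma sp_gam_corner (a b : 'I_p) : ((sp_gam a).+1 == corner n m b.+1) = (a == b).
Proof.
have [lt_a lt_b] := (ltn_ord a, ltn_ord b).
by rewrite -[RHS]val_eqE /corner /=; do 2!case: ifP => /=; lia.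
Qed.

Lemma mid_corner (x : 'I_r) (b : 'I_p) : ((mid x).+1 == corner n m b.+1) = false.
Proof. by have := ltn_ord x; have := ltn_ord b; rewrite /corner /=; case: ifP; lia. Qed.

Local Notation iota := (iota sp_le_nr sp_gam).

Lemma sp_iota_A (M : 'M[K]_p) : iota M 0 0 = sp_iA m M.
Proof.
apply: (blk_inj (bi_surj sp_bi_bij)); rewrite (unblkK sp_bi_bij) mul0mx mulmx0.
apply/matrixP => i j; rewrite [RHS]mxE summxE.
under eq_bigr => a _.
  rewrite summxE; under eq_bigr => b _ do rewrite !mxE.
  over.
case: (split_ordP i) => a' ->; last first.
  rewrite big1 => [|a _]; last first.
    by rewrite big1 // => b _; rewrite blk_indexr mid_corner mulr0.
  by case: (split_ordP j) => b' ->; rewrite ?block_mxEdl ?block_mxEdr mxE.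
case: (split_ordP j) => b' ->; last first.
  rewrite big1 => [|a _]; last first.
    by rewrite big1 // => b _; rewrite blk_indexr mid_corner andbF mulr0.
  by rewrite block_mxEur mxE.
rewrite block_mxEul (bigD1 a') //= [X in _ + X]big1 => [|a ne_a]; last first.
  by rewrite big1 // => b _; rewrite !blk_indexl sp_gam_corner eq_sym (negbTE ne_a) mulr0.
rewrite addr0 (bigD1 b') //= big1 => [|b ne_b]; last first.
  by rewrite !blk_indexl !sp_gam_corner [b' == b]eq_sym (negbTE ne_b) andbF mulr0.
by rewrite !blk_indexl !sp_gam_corner !eqxx mulr1 addr0.
Qed.

Lemma sp_iota_y (y : 'cV[K]_p) :
  iota 0 y 0 = \sum_(a < p) y a 0 *: Emx (corner n m a.+1) (n + r).
Proof.
apply: (blk_inj (bi_surj sp_bi_bij)); rewrite (unblkK sp_bi_bij) mulmx0.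
apply/matrixP => i j; rewrite [RHS]mxE summxE.
under eq_bigr => a _ do rewrite !mxE.
case: (split_ordP i) => a' ->; last first.
  rewrite big1 => [|a _]; last by rewrite blk_indexr mid_corner mulr0.
  by case: (split_ordP j) => b' ->; rewrite ?block_mxEdl ?block_mxEdr mxE.
rewrite (bigD1 a') //= [X in _ + X]big1 => [|a ne_a]; last first.
  by rewrite blk_indexl sp_gam_corner eq_sym (negbTE ne_a) mulr0.
rewrite blk_indexl sp_gam_corner eqxx addr0.
case: (split_ordP j) => b' ->; rewrite ?blk_indexl ?blk_indexr.
  rewrite block_mxEul mxE (_ : _ && _ = false) ?mulr0 //.
  by have := sp_gam_out b'; have := ltn_ord b'; lia.
rewrite block_mxEur mul_colrow !mxE; congr (_ * _%:R).
by have := ltn_ord b'; rewrite /=; lia.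
Qed.

Lemma adjJ_Emx (i j : nat) : (0 < i <= k)%N -> (0 < j <= k)%N ->
  adjJ (Emx i j) = (-1) ^+ (i + j).+1 *: Emx (k.+1 - j) (k.+1 - i) :> 'M[K]_k.
Proof.
move=> lt_i lt_j; apply/matrixP => a b; have [lt_a lt_b] := (ltn_ord a, ltn_ord b).
rewrite adjJE // !mxE /=.
have -> : ((k - b.+1).+1 == i) && ((k - a.+1).+1 == j) =
   (a.+1 == k.+1 - j)%N && (b.+1 == k.+1 - i)%N by lia.
case: andP => [[ai bj]|_]; last by rewrite !mulr0.
rewrite !mulr1 -[LHS]signr_odd -[RHS]signr_odd; congr (_ ^+ _); lia.
Qed.

Lemma sp_iota_iy (y : 'cV[K]_p) : iota 0 y 0 + adjJ (iota 0 y 0) = sp_iy m y.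
Proof.
rewrite sp_iota_y /adjJ linear_sum mulmx_sumr mulmx_suml -big_split /=.
apply: eq_bigr => a _; have lt_a := ltn_ord a.
rewrite linearZ /= -scalemxAr -scalemxAl -scalerDr; congr (_ *: _).
rewrite -/(adjJ _) adjJ_Emx; [|by rewrite /corner; case: ifP; lia|lia].
rewrite /sp_iy1 /corner; case: ifP => le_a; congr (Emx _ _ + _ *: Emx _ _); try lia.
  by rewrite -[LHS]signr_odd -[RHS]signr_odd; congr (_ ^+ _); lia.
by rewrite -[LHS]signr_odd -[RHS]signr_odd; congr (_ ^+ _); lia.
Qed.

Lemma sp_prj_iota (M : 'M[K]_p) y : M \in spv K p ->
  sp_prj (iota M (2 *: y) 0) = sp_iA m M + sp_iy m y.
Proof.
move=> spM; have iM : sp_iA m M \in U.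
  have := @sp_iA_z K n m (vsproj _ M) nz2; rewrite vsprojK // => zM.
  by apply: (subvP _ _ zM); exact: capvSl.
have -> : iota M (2 *: y) 0 = 2 *: iota 0 y 0 + iota M 0 0.
  by rewrite -iotaP scaler0 add0r addr0 scaler0 addr0.
rewrite linearD /= sp_iota_A (sp_prj_id even_k iM) addrC; congr (_ + _).
by rewrite linearZ /= /sp_prj sp_iota_iy scalerA mulfV // scale1r.
Qed.

Local Notation Jp := (Jmx K p).
Local Notation Jr := ((-1) ^+ n *: Jmx K r).

(** The middle indices are shifted by n, which multiplies the standard form there by (-1)^n; the
    last n corner indices are shifted by the even number r, without effect on signs. This is the
    origin of the sign under the square root. *)
Lemma blk_Jmx : blk (Jmx K k) = block_mx Jp 0 0 Jr.
Proof.
apply/matrixP => i j; rewrite [LHS]mxE mxE.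
case: (split_ordP i) => a ->; case: (split_ordP j) => b ->;
  rewrite ?blk_indexl ?blk_indexr; have [lt_a lt_b] := (ltn_ord a, ltn_ord b).
- rewrite block_mxEul mxE /= (_ : (_ == k.+1) = (a.+1 + b.+1 == p.+1)).
    by case: ifP => // _; rewrite -[LHS]signr_odd -[RHS]signr_odd; congr (_ ^+ _);
      case: ifP => _; lia.
  by do 2!case: ifP; lia.
- by rewrite block_mxEur mxE ifF //=; case: ifP; lia.
- by rewrite block_mxEdl mxE ifF //=; case: ifP; lia.
rewrite block_mxEdr !mxE /= (_ : (_ == k.+1) = (a.+1 + b.+1 == r.+1)); last lia.
case: ifP => _; last by rewrite mulr0.
by rewrite -exprD -addnS.
Qed.

Lemma Jr_sqr : Jr *m Jr = - 1%:M.
Proof.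
rewrite -scalemxAl -scalemxAr scalerA -expr2 sqrr_sign scale1r Jmx_sqr //.
by rewrite odd_double.
Qed.

Lemma eps1_Jr : (eps1 K r)^T *m Jr = (-1) ^+ n *: (epsr K r)^T.
Proof.
rewrite -scalemxAr; congr (_ *: _); apply/rowP => j.
rewrite mxE (bigD1 (Ordinal r_gt0)) //= big1 ?addr0 => [|l ne_l]; last first.
  by rewrite !mxE (_ : (l == 0 :> nat) = false) ?mul0r //; apply/negbTE.
rewrite !mxE /= mul1r; have lt_j := ltn_ord j.
rewrite (_ : (1 + j.+1 == r.+1)%N = (j.+1 == r)); last lia.
case: ifP => // /eqP ->; by rewrite -signr_odd odd_double.
Qed.

Lemma sp_blk X A b c E : blk X = slice_mx A b c E -> X \in U ->
  [/\ Jp *m A^T *m Jp = A, Jr *m E^T *m Jr = E & Jp *m b = (-1) ^+ n *: c^T].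
Proof.
move=> XE; rewrite memv_spJ // => /eqP.
have blk_trmx (W : 'M[K]_k) : blk W^T = (blk W)^T by apply/matrixP => i j; rewrite !mxE.
move/(congr1 (fun W : 'M[K]_k => blk W)); rewrite /adjJ !(blkM sp_bi_bij) blk_trmx XE blk_Jmx.
rewrite tr_block_mx !mulmx_block !(mulmx0, mul0mx) !(addr0, add0r).
case/eq_block_mx => EA Eb Ec EE; split=> //.
have err := epsr_dot K r_gt0.
have l1 : Jp *m (epsr K r *m c)^T *m Jr *m Jr *m epsr K r = - (Jp *m c^T).
  rewrite -(mulmxA _ Jr Jr) Jr_sqr mulmxN mulmx1 mulNmx trmx_mul.
  by rewrite -!mulmxA err mulmx1.
have l2 : b *m (eps1 K r)^T *m Jr *m epsr K r = (-1) ^+ n *: b.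
  by rewrite -(mulmxA b) eps1_Jr -!mulmxA -scalemxAl err -scalemxAr mulmx1.
have bE : (-1) ^+ n *: b = - (Jp *m c^T) by rewrite -l2 -Eb l1.
have -> : b = (-1) ^+ n *: (- (Jp *m c^T)).
  by rewrite -bE scalerA -expr2 sqrr_sign scale1r.
rewrite -scalemxAr mulmxN mulmxA Jmx_sqr ?odd_double //.
by rewrite mulNmx mul1mx opprK.
Qed.
Local Notation V := (sp_space K n m).
(** Chosen so that [kap ^+ 2 * (-1) ^+ n] is -2, the value needed for the bracket of two vectors
    y. *)
Let s : K := sqrtC ((-1) ^+ n.+1 * 2).
(* The projection halves the part of iota coming from y, whence the factor 2. *)
Let kap : K := 2 / s.
Local Notation uM := (@vsval _ _ _ \o (fst \o fst) : {linear V -> 'M[K]_p}).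
Local Notation uy := (kap \*: (snd \o fst) : {linear V -> 'cV[K]_p}).
Local Notation ux := (\0 : {linear V -> 'rV[K]_p}).
Local Notation uz := (snd : {linear V -> 'rV[K]_m}).
Let sg (j : 'I_m) : K := 1.
Let dg (j : 'I_m) : nat := (m - j).*2.-1.

Let dgE j : (dg j).+1 = (m - j).*2.
Proof. by rewrite /dg prednK //; have := ltn_ord j; lia. Qed.

Let s_sqr : s ^+ 2 = (-1) ^+ n.+1 * 2. Proof. exact: sqrtCK. Qed.

Let nz_s : s != 0.
Proof. by rewrite /s sqrtC_eq0 mulf_neq0 // signr_eq0. Qed.

Lemma sp_prj_uiota (u : V) : sp_prj (iota (uM u) (uy u) (ux u)) =
  sp_iA m (vsval u.1.1) + s^-1 *: sp_iy m u.1.2.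
Proof.
have -> : uy u = 2 *: (s^-1 *: u.1.2) by rewrite scalerA.
rewrite sp_prj_iota ?subvsP //; congr (_ + _); rewrite /sp_iy scaler_sumr.
by apply: eq_bigr => a _; rewrite mxE scalerA.
Qed.

Lemma sp_iota_centr (u : V) : sp_prj (iota (uM u) (uy u) (ux u)) \in z.
Proof.
by rewrite sp_prj_uiota memvD ?memvZ //; [exact: sp_iA_z | exact: sp_iy_z].
Qed.

Section SpTheta.
Variable Y : 'M[Sym (subvs_of z)]_k.
Hypothesis YE : forall X, slice U e f X -> forall a b, fval (Y a b) X = X a b.
Hypothesis Y_deriv : forall X v, v \in U -> commx f v = 0 -> forall a b,
  \sum_i fval (Y a b)^`M(i) X * trform (vsval (symb i : subvs_of z)) v = v a b.
Local Notation Theta :=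
  (sym_morph (lin_theta sp_le_nr sp_gam (@sp_prj K k) uM uy ux uz sg dg Y)).

Lemma sp_val X A b c E (u : V) : slice U e f X -> blk X = slice_mx A b c E ->
  fval (Theta (symg u)) X =
  trform (vsval u.1.1) A + kap * (c *m u.1.2) 0 0 +
  \sum_j u.2 0 j * (det1D X)`_(m - j).*2.
Proof.
move=> SX XE; rewrite sym_morph_symg.
rewrite (fval_lin_theta r_gt0 sp_gam_out sp_bi_bij sp_triple
  (fun a => sp_prj_id even_k (a := a)) (sp_prj_adj even_k)
  uz sg dg sp_iota_centr YE u SX XE).
rewrite /= -scalemxAr [X in _ + X + _ + _]mxE mul0mx [X in _ + X + _]mxE addr0.
by congr (_ + _); apply: eq_bigr => j _; rewrite dgE mulr1.
Qed.

Lemma sp_slice_blk X : slice U e f X -> X \in U /\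
  exists A b c (a : nat -> K^o), blk X = slice_mx A b c (shift_mx K^o r + toep r a).
Proof. exact: (slice_blk sp_le_nr sp_gam_out sp_triple). Qed.

Lemma sp_val_beta X A b c E x y j : slice U e f X -> blk X = slice_mx A b c E ->
  fval (Theta (symmap (@sp_A K n m) (beta x y j))) X = beta_at A x y j.
Proof.
move=> SX XE; have [UX _] := sp_slice_blk SX.
have [EA _ _] := sp_blk XE UX.
have spA : A \in spv K p by rewrite memv_spJ ?odd_double // /adjJ EA.
rewrite fval_symmap -[A in RHS](vsprojK spA) -betaE // /fval /symev.
apply: meval_eq => i; apply: etrans (sp_val (sp_A m (symb i)) SX XE) _.
rewrite /= vsprojK // mulmx0 !mxE mulr0 addr0.
by rewrite big1 ?addr0 // => l _; rewrite mxE mul0r.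
Qed.

Lemma sp_val_zeta X (j : 'I_m) : slice U e f X ->
  fval (Theta (symg (sp_zeta K n j))) X = (det1D X)`_(m - j).*2.
Proof.
move=> SX; have [_ [A [b [c [a XE]]]]] := sp_slice_blk SX.
rewrite (sp_val _ SX XE) /= mulmx0 trform0l !mxE mulr0 !add0r.
rewrite (bigD1 j) //= big1 ?addr0 => [|l ne_l]; first by rewrite mxE !eqxx mul1r.
by rewrite mxE (negbTE ne_l) andbF mul0r.
Qed.

Lemma sum_double (M : nat) (F : nat -> K) :
  \sum_(j < M.*2) F j = \sum_(l < M) (F l.*2 + F l.*2.+1).
Proof.
elim: M => [|M IHM]; first by rewrite !big_ord0.
by rewrite doubleS !big_ord_recr /= IHM addrA.
Qed.

Lemma sp_slice_odd X j : slice U e f X -> odd j -> (det1B X)`_j = 0.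
Proof.
move=> /sp_slice_blk[]; rewrite memv_spJ // => /eqP XJ _.
exact: (@det1B_odd _ _ (Jmx K k) X j (Jmx_sqr K even_k) XJ).
Qed.

(** For even i the form omega (x, A^i y) is antisymmetric in x and y, whence the sign. Odd i do not
    contribute: r is even and det (1 - tau E) is an even polynomial. The same parity for X leaves
    only the even beta. *)
Lemma sp_val_yy X A b c E x y : slice U e f X -> hessenberg E ->
  blk X = slice_mx A b c E ->
  fval (Theta (sp_yy m x y)) X = - (y^T *m Jmx K p *m ham_vec E A x) 0 0.
Proof.
move=> SX hE XE; have [UX _] := sp_slice_blk SX.
have [EA EE _] := sp_blk XE UX.
have JAi i : (y^T *m Jmx K p *m A ^+ i *m x) 0 0 =
    - ((-1) ^+ i * (x^T *m Jmx K p *m A ^+ i *m y) 0 0).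
  have AJ : A^T *m Jmx K p = - (Jmx K p *m A).
    by rewrite -[A in RHS]EA !mulmxA Jmx_sqr ?odd_double // !mulNmx mul1mx opprK.
  have AiJ : (A ^+ i)^T *m Jmx K p = (-1) ^+ i *: (Jmx K p *m A ^+ i).
    elim: i => [|i IHi]; first by rewrite !expr0 scale1r trmx1 mul1mx mulmx1.
    rewrite [in LHS]exprS -[A * _]/(A *m _) trmx_mul -mulmxA AJ mulmxN mulmxA IHi.
    rewrite -scalemxAl -mulmxA [A ^+ i.+1]exprSr -[A ^+ i * A]/(A ^+ i *m A).
    by rewrite exprS mulN1r scaleNr.
  rewrite -[LHS]tr11 !trmx_mul trmxK Jmx_tr ?odd_double //.
  rewrite mulNmx !mulmxN (mulmxA _ (Jmx K p) y) AiJ -scalemxAl -scalemxAr !mulmxA.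
  by rewrite [LHS]mxE [X in - X]mxE.
rewrite ham_vecE.
pose a i := if odd i then 0 else (x^T *m Jmx K p *m A ^+ i *m y) 0 0.
have oddE j : odd j -> (det1B E)`_j = 0.
  exact: (det1B_odd Jr_sqr EE).
have detE l : (l <= r)%N -> (det1B X)`_l = (det1B A * det1B E)`_l.
  by move=> le_l; rewrite -(blk_det1B sp_bi_bij) XE det1B_slice.
transitivity (\sum_(i < r.+1) (det1B E)`_(r - i) * a i); last first.
  rewrite -sumrN; apply: eq_bigr => i _; have lt_i := ltn_ord i.
  rewrite JAi mulrN opprK /a -signr_odd; case: ifP => odd_i; last by rewrite mul1r.
  by rewrite oddE ?mul0r //; lia.
have vb j := sp_val_beta x y j SX XE; have vz j := sp_val_zeta j SX.
move: vb vz; move: (sym_morph _) => Th vb vz.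
rewrite (psmul_det1B a detE) big_ord_recr /= subnn det1B_0 mul1r.
have -> : fval (Th (sp_yy m x y)) X = fval (Th (symmap (@sp_A K n m) (beta x y r))) X +
    \sum_(j < m) fval (Th (symg (sp_zeta K n j))) X *
      fval (Th (symmap (@sp_A K n m) (beta x y j.*2))) X.
  rewrite /sp_yy rmorphD fvalD; congr (_ + _); rewrite rmorph_sum fval_sum.
  by apply: eq_bigr => j _; rewrite rmorphM fvalM.
rewrite vb addrC; congr (_ + _).
rewrite (sum_double m (fun j => (det1B X)`_(r - j) * psmul a (psinv (det1B A)) j)).
apply: eq_bigr => j _; have lt_j := ltn_ord j; rewrite vz vb.
rewrite [X in _ + X * _](sp_slice_odd SX) ?mul0r ?addr0; last by lia.
by rewrite det1D_B -doubleB -signr_odd odd_double mul1r.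
Qed.

(** The image of a Hamiltonian vector under [adjJ] has its y-part moved to the lower left block,
    where it meets the y-part of the commutator. The term in M b becomes one in c through the
    relation between b and c. *)
Lemma sp_adj_bracket X A b c E M M' y y' : X \in U -> hessenberg E ->
  blk X = slice_mx A b c E -> M \in spv K p -> M' \in spv K p ->
  trform (commx X (hamU sp_le_nr sp_gam A E M y 0))
    (adjJ (hamU sp_le_nr sp_gam A E M' y' 0)) =
  trform A (commx M M') + (c *m (M *m y' - M' *m y)) 0 0 +
  (-1) ^+ n * (y'^T *m Jmx K p *m ham_vec E A y) 0 0.
Proof.
move=> UX hE XE spM spM'; have [EA EE Eb] := sp_blk XE UX.
have blk_trmx (W : 'M[K]_k) : blk W^T = (blk W)^T by apply/matrixP => i j; rewrite !mxE.
have ham0 : ham_left A E 0 = 0.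
  by rewrite /ham_left trmx0 /ham_mx big1 ?trmx0 // => i _; rewrite mulmx0 !mul0mx.
have JM' : Jmx K p *m M'^T *m Jmx K p = M'.
  by apply/eqP; rewrite -memv_spJ ?odd_double.
have JM : Jmx K p *m M = - (M^T *m Jmx K p).
  by apply/eqP; rewrite -addr_eq0 addrC -memv_sp.
have L : blk (adjJ (hamU sp_le_nr sp_gam A E M' y' 0)) =
    block_mx M' 0 (Jr *m (ham_right A E y')^T *m Jmx K p) 0.
  rewrite /adjJ !(blkM sp_bi_bij) blk_trmx (unblkK sp_bi_bij) blk_Jmx /ham_block ham0.
  rewrite tr_block_mx !mulmx_block !trmx0 !(mulmx0, mul0mx) !(addr0, add0r).
  by rewrite !mul0mx JM'.
rewrite (blk_trform sp_bi_bij) (blk_commx sp_bi_bij) (unblkK sp_bi_bij) XE L.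
rewrite (commx_ham_block _ _ _ hE r_gt0) /trform mulmx_block mxtrace_block.
rewrite !mulmx0 !addr0 mxtrace0 addr0 raddfD /= mulmxBl raddfB /=.
rewrite -/(trform (commx A M) M') trform_commx -(mulmxA y) [\tr (y *m _)]scalar_tr.
have mxB (P Q : 'M[K]_1) : (P - Q) 0 0 = P 0 0 - Q 0 0 by rewrite !mxE.
have -> : (ham_vec E A y - M *m b) *m (eps1 K r)^T *m
    (Jr *m (ham_right A E y')^T *m Jmx K p) =
    (ham_vec E A y - M *m b) *m ((-1) ^+ n *: (y'^T *m Jmx K p)).
  rewrite !mulmxA -(mulmxA _ _ Jr) eps1_Jr -!mulmxA; congr (_ *m _).
  rewrite -scalemxAl; congr (_ *: _); rewrite mulmxA; congr (_ *m _).
  by rewrite -trmx_mul ham_right_epsr.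
rewrite scalar_tr -scalemxAl mulmxBr [X in _ + X]mxE mxB mulrBr addrA.
have -> : (y'^T *m Jmx K p *m (M *m b)) 0 0 = - ((-1) ^+ n * (c *m (M *m y')) 0 0).
  rewrite !mulmxA -(mulmxA y'^T) JM mulmxN mulNmx -!mulmxA Eb.
  rewrite -!scalemxAr [LHS]mxE [X in - X]mxE; congr (- (_ * _)).
  by rewrite -[LHS]tr11 !trmx_mul !trmxK !mulmxA.
rewrite mulrN opprK mulrA -expr2 sqrr_sign mul1r [c *m (_ - _)]mulmxBr mxB !mulmxA.
rewrite -/(trform A (commx M M')).
move: (trform A _) (_ * _) => t1 t2; ring.
Qed.

Lemma sp_bracketE X A b c E : slice U e f X -> hessenberg E ->
  blk X = slice_mx A b c E -> forall u w : V,
  trform (commx X (hamU sp_le_nr sp_gam A E (uM u) (uy u) (ux u)))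
    (sp_prj (hamU sp_le_nr sp_gam A E (uM w) (uy w) (ux w))) =
  fval (Theta (sp_bracket u w)) X.
Proof.
move=> SX hE XE [[M y] zt] [[M' y'] zt']; have [UX _] := sp_slice_blk SX.
have [EA EE Eb] := sp_blk XE UX.
have e1 := sp_val_yy y y' SX hE XE.
have e2 := @sp_val _ _ _ _ _ (lie M M', vsval M *m y' - vsval M' *m y, 0) SX XE.
move: e1 e2; move: (sym_morph _) => Th e1 e2.
have -> : fval (Th (sp_bracket (M, y, zt) (M', y', zt'))) X =
    fval (Th (symg ((lie M M', vsval M *m y' - vsval M' *m y, 0) : V))) X +
    fval (Th (sp_yy m y y')) X.
  by rewrite /sp_bracket rmorphD fvalD.
apply: etrans (f_equal2 (fun s t => s + t) (esym e2) (esym e1)) => /=.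
rewrite [\sum_(j < m) _]big1 ?addr0 => [|j _]; last by rewrite mxE mul0r.
rewrite vsval_lie; last by move=> *; apply: commx_sp.
have [spM spM'] := (subvsP M, subvsP M'); move: spM spM'.
move: {e1 e2 M M'}(vsval M) (vsval M') => M M' spM spM'.
rewrite /sp_prj trformZr trformDr (hamU_bracket r_gt0 sp_bi_bij XE hE).
rewrite (sp_adj_bracket _ _ UX hE XE spM spM') !mul0mx sub0r oppr0 mul0mx.
rewrite [(0 : 'M[K]_1) 0 0]mxE !addr0 subr0.
have hvZ (x : 'rV[K]_p) : (x *m ham_vec E A (kap *: y)) 0 0 = kap * (x *m ham_vec E A y) 0 0.
  rewrite !ham_vecE mulr_sumr; apply: eq_bigr => i _.
  by rewrite -scalemxAr mxE mulrCA.
have -> : (c *m (M *m (kap *: y') - M' *m (kap *: y))) 0 0 =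
    kap * (c *m (M *m y' - M' *m y)) 0 0.
  by rewrite -!scalemxAr -scalerBr -scalemxAr mxE.
have -> : ((kap *: y')^T *m Jmx K p *m ham_vec E A (kap *: y)) 0 0 =
    kap ^+ 2 * (y'^T *m Jmx K p *m ham_vec E A y) 0 0.
  by rewrite hvZ [(kap *: y')^T]linearZ /= -!scalemxAl mxE mulrA.
have kapE : kap ^+ 2 * (-1) ^+ n = - 2.
  rewrite /kap expr_div_n s_sqr [(-1) ^+ n.+1]exprS.
  have := signr_eq0 K n; move: ((-1) ^+ n) => t /negbT nzt.
  by field.
rewrite [trform A _]trformC.
move: (trform _ A) ((c *m _) 0 0) ((_ *m ham_vec E A y) 0 0) => t1 t2 t3.
(* The vector itself and its image under [adjJ] contribute equally to the first two terms,
   compensating the factor 1/2 of the projection; the term in two vectors y comes from the image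
   alone. *)
transitivity (t1 + kap * t2 + 2^-1 * (kap ^+ 2 * (-1) ^+ n) * t3).
  by move: nz2; move: kap ((-1) ^+ n) => k1 k2 nz2'; field.
rewrite kapE mulrN mulVf // mulN1r //.
Qed.

End SpTheta.
Lemma fprod_rev (x y : nat) : (x < r)%N -> (y <= x)%N ->
  fprod K r (r - y.+1) (r - x.+1) = fprod K r x y.
Proof.
move=> lt_x le_y; rewrite /fprod big_nat_rev -[(r - x.+1).+1]add0n big_addn.
rewrite -[y.+1 in RHS]add0n [RHS]big_addn.
rewrite (_ : (r - y.+1).+1 - (r - x.+1).+1 = x.+1 - y.+1)%N; last by lia.
apply: eq_big_nat => t lt_t; rewrite /fcoef; congr (_%:R).
rewrite (_ : _ - _ = r - (t + y.+1))%N; last by lia.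
by rewrite mulnC; congr (_ * _)%N; lia.
Qed.

Lemma shift_toepE (a : nat -> K^o) (x y : 'I_r) : (shift_mx K^o r + toep r a) x y =
  (y == x.+1 :> nat)%:R + (if (y <= x)%N then fprod K r x y * a (x - y)%N else 0).
Proof. by rewrite mxE; congr (_ + _); rewrite mxE. Qed.

Lemma Jr_adjJ (E : 'M[K]_r) : Jr *m E^T *m Jr = adjJ E.
Proof.
by rewrite /adjJ -!scalemxAl -scalemxAr scalerA -expr2 sqrr_sign scale1r.
Qed.

(** The entries of f^j are symmetric about the antidiagonal, and [adjJ] multiplies the j-th
    subdiagonal by (-1)^(j+1): odd powers of f are fixed, even ones change sign. *)
Lemma adjJ_toep (a : nat -> K^o) : (forall j, ~~ odd j -> (j < r)%N -> a j = 0) ->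
  adjJ (shift_mx K^o r + toep r a : 'M[K]_r) = shift_mx K^o r + toep r a.
Proof.
move=> a0; apply/matrixP => x y; rewrite adjJE ?odd_double // !shift_toepE /=.
have [lt_x lt_y] := (ltn_ord x, ltn_ord y).
have -> : (r - x.+1 == (r - y.+1).+1)%N = (y == x.+1 :> nat) by lia.
have -> : (r - x.+1 <= r - y.+1)%N = (y <= x)%N by lia.
have -> : (r - y.+1 - (r - x.+1) = x - y)%N by lia.
have [yx|_] := eqVneq (y : nat) x.+1.
  rewrite yx ltnn addr0 mulr1 -signr_odd.
  by rewrite (_ : odd _ = false) //; lia.
rewrite !add0r; case: leqP => [le_yx|_]; last by rewrite mulr0.
rewrite fprod_rev //; have [odd_xy|ev] := boolP (odd (x - y)).
  by rewrite -signr_odd (_ : odd _ = false) ?mul1r //; lia.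
by rewrite a0 ?mulr0 //; lia.
Qed.

Lemma toep_even (a : nat -> K^o) j : adjJ (shift_mx K^o r + toep r a : 'M[K]_r) =
  shift_mx K^o r + toep r a -> ~~ odd j -> (j < r)%N -> a j = 0.
Proof.
move=> aE ev lt_j; have := congr1 (fun W : 'M[K]_r => W (Ordinal lt_j) (Ordinal r_gt0)) aE.
rewrite adjJE ?odd_double // !shift_toepE /= addn0 !subn1 add0r.
rewrite (_ : (r.-1 - (r - j.+1) = j)%N); last by lia.
rewrite (_ : (r - j.+1 == r.-1.+1)%N = false) ?add0r; last by lia.
rewrite (_ : (r - j.+1 <= r.-1)%N) ?subn0; last by lia.
rewrite -signr_odd /= ev expr1 mulN1r => /eqP; rewrite eq_sym -addr_eq0 -mulrDl mulf_eq0.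
case/orP=> [|/eqP //]; rewrite gt_eqF // addr_gt0 ?fprod_gt0 //; lia.
Qed.

Lemma sp_projK (w : subvs_of (spv K p)) : sp_proj (vsval w) = w.
Proof.
rewrite /sp_proj -/(adjJ _) -/(sp_prj _) sp_prj_id ?odd_double ?subvsP //.
exact: vsvalK.
Qed.

Lemma sp_isomorphism :
  exists Theta : {lrmorphism Hsp K n m -> Sym (subvs_of z)},
    [/\ (forall A : subvs_of (spv K n.*2),
           Theta (symg (sp_A m A)) = symg (vsproj z (sp_iA m (vsval A)))),
        (forall y : 'cV[K]_(n.*2),
           Theta (symg (sp_y m y))
           = (sqrtC ((-1) ^+ n.+1 * 2))^-1 *: symg (vsproj z (sp_iy m y))),
        (forall (j : 'I_m) (X : 'M[K]_k), slice U e f X ->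
           fval (Theta (symg (sp_zeta K n j))) X = (det1D X)`_((m - j).*2))
      & bijective Theta /\
        (forall l : {vspace 'M[K]_k}, lagrangian U e h l ->
           forall (a b : Hsp K n m) (w : Sym (subvs_of z)),
             slice_bracket U e h f l (Theta a) (Theta b) w
             <-> w = Theta (Hsp_br a b))].
Proof.
have [Y [YE Y_deriv]] := universal_point sp_triple.
have iA0 : sp_iA m (0 : 'M[K]_p) = 0.
  by rewrite /sp_iA big1 // => i _; rewrite big1 // => j _; rewrite mxE scale0r.
have iy0 : sp_iy m (0 : 'cV[K]_p) = 0.
  by rewrite /sp_iy big1 // => i _; rewrite mxE scale0r.
have lin0 (u : V) : u.2 = 0 ->
    lin_theta sp_le_nr sp_gam (@sp_prj K k) uM uy ux uz sg dg Y u =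
    symg (vsproj z (sp_iA m (vsval u.1.1) + s^-1 *: sp_iy m u.1.2)).
  move=> u0; rewrite /lin_theta [X in _ + X]big1 ?addr0 => [|j _].
    by congr (symg (vsproj _ _)); apply: etrans (sp_prj_uiota u) _.
  by rewrite /= u0 mxE mul0r scale0r.
have thetaE (u : V) (u0 : u.2 = 0) := etrans
  (sym_morph_symg (lin_theta sp_le_nr sp_gam (@sp_prj K k) uM uy ux uz sg dg Y) u)
  (lin0 u u0).
have valE := sp_val YE; have zetaE := sp_val_zeta YE; have brE := sp_bracketE YE.
have hamE := Theta_hamiltonians r_gt0 sp_gam_out sp_bi_bij sp_triple
  (sp_prj_mem even_k) (fun a => sp_prj_id even_k (a := a)) (sp_prj_adj even_k)
  (fun X a => sp_prj_commx even_k (X := X) a) sp_iota_centr YE Y_deriv brE.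
exists (sym_morph (lin_theta sp_le_nr sp_gam (@sp_prj K k) uM uy ux uz sg dg Y)).
split=> [A|y|j X SX|].
- by rewrite (thetaE (sp_A m A) erefl) /= iy0 scaler0 addr0.
- by rewrite (thetaE (sp_y m y) erefl) /= iA0 add0r !linearZ.
- exact: zetaE.
split; last by move=> l lagr a b w; apply: (slice_bracketP sp_triple hamE lagr).
move: valE zetaE {hamE brE thetaE lin0}; move: (sym_morph _) => Th valE zetaE.
have valA X A b c E w : slice U e f X -> blk X = slice_mx A b c E ->
    fval (Th (symg (sp_A m w))) X = trform (vsval w) A.
  move=> SX XE; apply: etrans (valE _ _ _ _ _ (sp_A m w) SX XE) _ => /=.
  by rewrite mulmx0 mxE mulr0 addr0 big1 ?addr0 // => l _; rewrite mxE mul0r.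
have valy X A b c E y : slice U e f X -> blk X = slice_mx A b c E ->
    fval (Th (symg (sp_y m y))) X = kap * (c *m y) 0 0.
  move=> SX XE; apply: etrans (valE _ _ _ _ _ (sp_y m y) SX XE) _ => /=.
  by rewrite trform0l add0r big1 ?addr0 // => l _; rewrite mxE mul0r.
have nz_kap : kap != 0 by rewrite mulf_neq0 ?invr_eq0.
pose AH : 'M[Sym V]_p := \matrix_(i, j) symg (sp_A m (sp_proj (delta_mx j i : 'M[K]_p))).
(* The factor compensates [kap] in the value of y; the next line is the relation between b and c
   that [sp_blk] forces. *)
pose cH : 'rV[Sym V]_p := \row_j (kap^-1 *: symg (sp_y m (delta_mx j 0 : 'cV[K]_p))).
pose bH : 'cV[Sym V]_p := (-1) ^+ n.+1 *: (Jmx (Sym V) p *m cH^T).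
pose t j : Sym V := if insub (m - j.+1./2)%N is Some l then symg (sp_zeta K n l) else 0.
(* Even a_j with j < r vanish by [toep_even]. Indices from r on do not occur in the matrix and are
   put in [P], so that uniqueness asks for no agreement there. *)
pose P j := odd j || (r <= j)%N.
have [a [a0 at_]] := toep_exists r AH bH cH P (fun=> 0) t.
pose XH : 'M[Sym V]_k := unblk sp_le_nr sp_gam (toep_mx r AH bH cH a).
have XHE : blk XH = toep_mx r AH bH cH a by exact: (unblkK sp_bi_bij).
have ptE phi := map_point XHE phi.
pose L phi (v : V) : K^o := (symg v).@[phi].
have Llin phi : linear (L phi) by move=> q v w; rewrite /L linearP mevalD mevalZ.
pose Ll phi := HB.pack_for {linear V -> K^o} (L phi)
  (GRing.isLinear.Build K V K^o _ (L phi) (Llin phi)).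
have trA phi M : trform M (map_mx (meval phi) AH) = Ll phi (sp_A m (sp_proj M)).
  rewrite (@delta_expand _ _ _ _ (fun M => Ll phi (sp_A m (sp_proj M))) M).
    by rewrite trformE; apply: eq_bigr => i _; apply: eq_bigr => j _; rewrite !mxE.
  move=> q M1 M2; rewrite -linearP; congr (Ll _ _); rewrite /sp_A.
  congr (_, _, _); rewrite /= ?scaler0 ?addr0 // -linearP; congr (vsproj _ _).
  exact: (linearP (@sp_prj K p)).
have adjA phi : adjJ (map_mx (meval phi) AH) = map_mx (meval phi) AH.
  apply/matrixP => i j; rewrite -!trform_delta -trform_adjJ ?odd_double // !trA.
  congr (Ll _ (sp_A m (vsproj _ (_ *: _)))).
  by rewrite -!/(adjJ _) adjJK ?odd_double // addrC.
have slice_pt phi : slice U e f (map_mx (meval phi) XH).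
  apply/sliceP; split; last first.
    by apply: (blk_kerf sp_gam_out (bi_surj sp_bi_bij) (ptE phi)).
  apply: memvB; last exact: sp_e_sp.
  rewrite memv_spJ //; apply/eqP/(blk_inj (bi_surj sp_bi_bij)).
  have blk_trmx (W : 'M[K]_k) : blk W^T = (blk W)^T by apply/matrixP => i j; rewrite !mxE.
  rewrite /adjJ !(blkM sp_bi_bij) blk_trmx ptE blk_Jmx.
  have Ea : adjJ (shift_mx K^o r + toep r (fun j => (a j).@[phi] : K^o) : 'M[K]_r) =
      shift_mx K^o r + toep r (fun j => (a j).@[phi] : K^o).
    apply: adjJ_toep => j ev lt_j; rewrite a0 ?meval0 // /P negb_or ev -ltnNge //.
  have bE : map_mx (meval phi) bH = (-1) ^+ n.+1 *: (Jmx K p *m (map_mx (meval phi) cH)^T).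
    by rewrite map_mxZ /= rmorph_sign map_mxM /= Jmx_map map_trmx.
  rewrite bE; move: (adjA phi) Ea; move: (map_mx _ AH) (map_mx _ cH) => A c.
  set E := _ + _ => EA EE.
  have erJ : (epsr K r)^T *m Jr = (-1) ^+ n.+1 *: (eps1 K r)^T.
    have : (-1) ^+ n *: (epsr K r)^T *m Jr = - (eps1 K r)^T.
      by rewrite -eps1_Jr -mulmxA Jr_sqr mulmxN mulmx1.
    rewrite -scalemxAl => E1; rewrite exprS mulN1r scaleNr -scalerN -E1.
    by rewrite scalerA -expr2 sqrr_sign scale1r.
  have Je1 : Jr *m eps1 K r = (-1) ^+ n.+1 *: epsr K r.
    have := congr1 trmx eps1_Jr; rewrite trmx_mul !linearZ /= !trmxK Jmx_tr ?odd_double //.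
    by rewrite scalerN mulNmx => E1; rewrite -[LHS]opprK E1 exprS mulN1r scaleNr.
  rewrite tr_block_mx !mulmx_block !(mulmx0, mul0mx) !(addr0, add0r).
  rewrite ?mul0mx ?mulmx0 ?addr0 ?add0r.
  congr block_mx; first exact: EA.
  - by rewrite trmx_mul !mulmxA -mulmxA erJ -scalemxAr -scalemxAl.
  - rewrite trmx_mul trmxK linearZ /= trmx_mul trmxK Jmx_tr ?odd_double //.
    rewrite (mulmxA Jr) Je1 -!scalemxAl -scalemxAr -scalemxAl scalerA -expr2.
    rewrite sqrr_sign scale1r -!mulmxA mulNmx Jmx_sqr ?odd_double // opprK.
    by rewrite mulmx1.
  by rewrite Jr_adjJ.
apply: (Theta_bijective sp_triple slice_pt) => [phi u|X X' SX SX' XX'].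
  apply: etrans (valE _ _ _ _ _ u (slice_pt phi) (ptE phi)) _.
  have uE : u = (sp_A m u.1.1 + sp_y m u.1.2 + (0, 0, u.2) : V).
    case: (u) => [[w y] q]; rewrite /sp_A /sp_y /=.
    by congr (_, _, _); rewrite /= ?(addr0, add0r).
  rewrite -[RHS]/(Ll phi u) [in RHS]uE !linearD; congr (_ + _ + _).
  - by rewrite trA sp_projK.
  - rewrite (@delta_expand _ _ _ _ (fun y => Ll phi (sp_y m y)) u.1.2) ?mxE.
      rewrite mulr_sumr; apply: eq_bigr => i _.
      by rewrite big_ord1 !mxE mevalZ !mulrA mulfV // mul1r mulrC.
    move=> q y y'; rewrite -linearP; congr (Ll _ _); rewrite /sp_y.
    by congr (_, _, _); rewrite /= ?scaler0 ?addr0.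
  rewrite (@delta_expand _ _ _ _ (fun q => Ll phi (0, 0, q)) u.2).
    rewrite big_ord1; apply: eq_bigr => j _; congr (_ * _); have lt_j := ltn_ord j.
    rewrite det1D_B -signr_odd odd_double mul1r (det1B_point sp_bi_bij XHE).
    have -> : ((m - j).*2 = ((m - j).*2.-1).+1)%N by lia.
    rewrite at_; [|lia|by rewrite /P; lia].
    rewrite /t insubT => [|lt]; first by lia.
    by congr (symg (sp_zeta K n _)).@[phi]; apply: val_inj => /=; lia.
  move=> q M M'; rewrite -linearP; congr (Ll _ _).
  by congr (_, _, _); rewrite /= ?scaler0 ?addr0.
have [UX [A [b [c [s1 XE]]]]] := sp_slice_blk SX.
have [UX' [A' [b' [c' [s2 X'E]]]]] := sp_slice_blk SX'.
have [EA EE Eb] := sp_blk XE UX; have [EA' EE' Eb'] := sp_blk X'E UX'.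
rewrite Jr_adjJ in EE; rewrite Jr_adjJ in EE'.
have spA : A \in spv K p by rewrite memv_spJ ?odd_double // /adjJ EA.
have spA' : A' \in spv K p by rewrite memv_spJ ?odd_double // /adjJ EA'.
have eqA : A = A'.
  apply/matrixP => i j; rewrite -!trform_delta.
  have prE B : B \in spv K p -> trform (delta_mx j i) B =
      trform (vsval (sp_proj (delta_mx j i : 'M[K]_p))) B.
    move=> spB; have := sp_projE (delta_mx j i) (vsproj (spv K p) B) nz2.
    by rewrite vsprojK.
  rewrite (prE A spA) (prE A' spA').
  by apply: etrans (esym (valA _ _ _ _ _ _ SX XE)) (etrans (XX' _) (valA _ _ _ _ _ _ SX' X'E)).
have eqc : c = c'.
  apply/rowP => i; apply: (mulfI nz_kap).
  have := etrans (esym (valy _ _ _ _ _ (delta_mx i 0) SX XE))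
    (etrans (XX' _) (valy _ _ _ _ _ _ SX' X'E)).
  by rewrite -!colE !mxE.
have Jinj (v : 'cV[K]_p) : v = - (Jmx K p *m (Jmx K p *m v)).
  by rewrite mulmxA Jmx_sqr ?odd_double // mulNmx mul1mx opprK.
have eqb : b = b' by rewrite [b]Jinj [b']Jinj Eb Eb' eqc.
subst A' b' c'; apply: (slice_unique r_gt0 sp_bi_bij (P := P) XE X'E) => [j|j lt_j].
  rewrite negb_or -ltnNge => /andP[ev lt_j].
  by rewrite (toep_even EE ev lt_j) (toep_even EE' ev lt_j).
rewrite /P leqNgt lt_j orbF => odd_j.
have lt_l : (m - j.+1./2 < m)%N by lia.
have := etrans (esym (zetaE X (Ordinal lt_l) SX)) (etrans (XX' _) (zetaE X' _ SX')).
rewrite [nat_of_ord _]/=.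
by have -> : ((m - (m - j.+1./2)).*2 = j.+1)%N by lia.
Qed.

End SpCase.
Theorem theorem3p1 (R : realType) (n m : nat) (hn : (0 < n)%N) :
  ((2 <= m)%N ->
    let g := slv R[i] (n + m) in
    let e := gl_e R[i] n m in
    let h := gl_h R[i] n m in
    let f := gl_f R[i] n m in
    let z := centr g e in
    exists Theta : {lrmorphism Hgl R[i] n m -> Sym (subvs_of z)},
      [/\ (forall A : 'M[R[i]]_n,
             Theta (symg (gl_A m A)) = symg (vsproj z (gl_iA m A))),
          (forall y : 'cV[R[i]]_n,
             Theta (symg (gl_y m y)) = symg (vsproj z (gl_iy m y))),
          (forall x : 'rV[R[i]]_n,
             Theta (symg (gl_x m x)) = symg (vsproj z (gl_ix m x))),
          (forall (k : 'I_m.-1) (X : 'M[R[i]]_(n + m)), slice g e f X ->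
             fval (Theta (symg (gl_zeta R[i] n k))) X
             = (-1) ^+ (m - k) * (det1D X)`_(m - k))
        & bijective Theta /\
          (forall l : {vspace 'M[R[i]]_(n + m)}, lagrangian g e h l ->
             forall (a b : Hgl R[i] n m) (r : Sym (subvs_of z)),
               slice_bracket g e h f l (Theta a) (Theta b) r
               <-> r = Theta (Hgl_br a b))])
  /\
  ((1 <= m)%N ->
    let g := spv R[i] (n + m).*2 in
    let e := sp_e R[i] n m in
    let h := sp_h R[i] n m in
    let f := sp_f R[i] n m in
    let z := centr g e in
    exists Theta : {lrmorphism Hsp R[i] n m -> Sym (subvs_of z)},
      [/\ (forall A : subvs_of (spv R[i] n.*2),
             Theta (symg (sp_A m A)) = symg (vsproj z (sp_iA m (vsval A)))),
          (forall y : 'cV[R[i]]_(n.*2),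
             Theta (symg (sp_y m y))
             = (sqrtC ((-1) ^+ n.+1 * 2))^-1 *: symg (vsproj z (sp_iy m y))),
          (forall (k : 'I_m) (X : 'M[R[i]]_((n + m).*2)), slice g e f X ->
             fval (Theta (symg (sp_zeta R[i] n k))) X
             = (det1D X)`_((m - k).*2))
        & bijective Theta /\
          (forall l : {vspace 'M[R[i]]_((n + m).*2)}, lagrangian g e h l ->
             forall (a b : Hsp R[i] n m) (r : Sym (subvs_of z)),
               slice_bracket g e h f l (Theta a) (Theta b) r
               <-> r = Theta (Hsp_br a b))]).
Proof.
split; [exact: sl_isomorphism | exact: sp_isomorphism].
Qed.
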